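(* Let $(M,\tau)$ be a tracial von Neumann algebra generated (as a von Neumann algebra) by some $x=(x_1,\dots,x_d)\in M_{\mathrm{sa}}^d$, and suppose $\|x\|_\infty<R$. Let $m\in\mathbb N\cup\{\infty\}$ and let $f\in\mathbb C\langle t_1,\dots,t_d\rangle^{\oplus m}$ be a tuple of non-commutative polynomials such that $f(x)=0$. Let $$D_f(x)=\begin{pmatrix}x_1\otimes1-1\otimes x_1&\cdots&x_d\otimes1-1\otimes x_d\\ \partial_{1}f(x)&\cdots&\partial_{d}f(x)\end{pmatrix}\in \mathbb M_{m+1,d}(M\otimes M^{\mathrm{op}}),$$ and let $\mu_{|D_f|}$ be the spectral measure of $|D_f|=(D_f(x)^*D_f(x))^{1/2}$ with respect to the trace $\mathrm{tr}_d\otimes\tau\otimes\tau$. If $$\int_{[0,\infty)}|\log t|\,d\mu_{|D_f|}(t)<\infty$$ (with the convention $\log 0=-\infty$, so that in particular $\mu_{|D_f|}(\{0\})=0$), then $M$ is strongly $1$-bounded.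
   Context: **Norms and laws.** A tracial von Neumann algebra $(M,\tau)$ is a von Neumann algebra with a faithful normal tracial state; $M_{\mathrm{sa}}$ is the set of self-adjoint elements; for $x\in M^d$, $\|x\|_p=(\sum_j\tau(|x_j|^p))^{1/p}$ for $1\le p<\infty$ and $\|x\|_\infty=\max_j\|x_j\|$ (operator norm). On the $n\times n$ matrices $\mathbb M_n(\mathbb C)$ use the normalized trace $\mathrm{tr}_n$. $\mathbb C\langle t_1,\dots,t_d\rangle$ is the $*$-algebra of non-commutative polynomials in self-adjoint variables $t_j$; $f(x)$ denotes evaluation $t_j\mapsto x_j$ (componentwise for tuples). $\mathbb C\langle t_1,\dots,t_d\rangle^{\oplus m}$ is the (algebraic) direct sum of $m$ copies. The law of $x\in M_{\mathrm{sa}}^d$ is $\ell_x(f)=\tau(f(x))$. $\Sigma_{d,R}$ is the set of all laws $\ell_x$ of self-adjoint $d$-tuples in tracial von Neumann algebras with $\|x\|_\infty\le R$, with the weak$^*$ topology (pointwise convergence on polynomials). **Free difference quotients.** $\partial_j:\mathbb C\langle t_1,\dots,t_d\rangle\to\mathbb C\langle t_1,\dots,t_d\rangle\otimes\mathbb C\langle t_1,\dots,t_d\rangle$ is the linear map $\partial_j[t_{i_1}\cdots t_{i_k}]=\sum_{\alpha:\,i_\alpha=j}t_{i_1}\cdots t_{i_{\alpha-1}}\otimes t_{i_{\alpha+1}}\cdots t_{i_k}$. For $p,q$ polynomials $(p\otimes q)(x)=p(x)\otimes q(x)^{\mathrm{op}}\in M\otimes M^{\mathrm{op}}$, extended linearly,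 where $M^{\mathrm{op}}$ is the opposite algebra; $\partial_jf(x)$ is the column with entries $(\partial_jf_i)(x)$. In the first row $1\otimes x_j$ means $1\otimes x_j^{\mathrm{op}}$. $D_f(x)^*D_f(x)$ is an element of $\mathbb M_d(M\overline\otimes M^{\mathrm{op}})$, which carries the trace $\mathrm{tr}_d\otimes\tau\otimes\tau$, $\mathrm{tr}_d$ being the normalized trace. **Strong $1$-boundedness.** Let $x\in M_{\mathrm{sa}}^d$ generate $M$ as a von Neumann algebra and $\|x\|_\infty\le R$. For $\mathcal O\subseteq\Sigma_{d,R}$ open let $\Gamma_R^{(n)}(\mathcal O)=\{X\in\mathbb M_n(\mathbb C)_{\mathrm{sa}}^d:\ell_X\in\mathcal O\}$ (in particular $\|X\|_\infty\le R$). For $\Omega\subseteq\mathbb M_n(\mathbb C)^d$, $K^{\mathrm{orb}}_\varepsilon(\Omega)$ is the minimal cardinality of a set $\Xi\subseteq\mathbb M_n(\mathbb C)^d$ such that for every $A\in\Omega$ there are $B\in\Xi$ and a unitary $V\in\mathbb M_n(\mathbb C)$ with $\|A-VBV^*\|_2<\varepsilon$. Put $$h_{R,\varepsilon}(\mathcal O)=\limsup_{n\to\infty}\tfrac1{n^2}\log K^{\mathrm{orb}}_\varepsilon(\Gamma^{(n)}_R(\mathcal O)),\quad h_{R,\varepsilon}(x)=\inf_{\mathcal O\ni\ell_x}h_{R,\varepsilon}(\mathcal O),\quad h(M)=h_R(x)=\sup_{\varepsilon>0}h_{R,\varepsilon}(x)$$ ($\log 0=-\infty$). It is known that this does not depend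 on $R$ or on the generating tuple $x$. A finitely generated $M$ is called strongly $1$-bounded if $h(M)<\infty$ (this is equivalent to Jung's original definition). *)

(* Defs.v *)
From HB Require Import structures.
From mathcomp Require Import all_boot all_order all_algebra.
From mathcomp Require Import finmap complex.
From mathcomp Require Import all_classical all_reals all_analysis.
From mathcomp Require multinomials.monalg.
(* A full Import of monalg clashes with the notations of mathcomp-analysis. *)
Import(canonicals, coercions) multinomials.monalg.

Set Implicit Arguments.
Unset Strict Implicit.
Unset Printing Implicit Defensive.

Import Order.TTheory GRing.Theory Num.Theory numFieldNormedType.Exports.

Local Open Scope classical_set_scope.
Local Open Scope complex_scope.
Local Open Scope sesquilinear_scope.
Local Open Scope ring_scope.

(** * Non-commutative polynomials *)

(* The free algebra C<t_1, ..., t_d>: the monoid algebra of the free monoid. *)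
Definition ncpoly (R : realType) (d : nat) :=
  monalg.malg (monalg.fmonom 'I_d) R[i].

(* C<t> (x) C<t>, as the free module on the pairs (v, w) of words, which stand
   for v (x) w. *)
Definition ncpoly2 (R : realType) (d : nat) :=
  monalg.malg (monalg.fmonom 'I_d * monalg.fmonom 'I_d)%type R[i].

Section NCPoly.
Context {R : realType} {d : nat}.

Definition free_diff_quot (j : 'I_d) (f : ncpoly R d) : ncpoly2 R d :=
  \sum_(w <- monalg.msupp f) \sum_(a < size w | tnth (in_tuple w) a == j)
     monalg.mkmalgU (monalg.FMonom (take a w), monalg.FMonom (drop a.+1 w))
       (monalg.mcoeff w f).

(* Evaluation of words and polynomials in an algebra [A]; the product and unit
   of [A] are arguments because functions under composition carry no ring
   structure. *)
Definition wordeval (A : Type) (mul : A -> A -> A) (one : A) (x : 'I_d -> A)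
    (w : seq 'I_d) : A :=
  foldr (fun j a => mul (x j) a) one w.

Definition nceval (A : lmodType R[i]) (mul : A -> A -> A) (one : A)
    (x : 'I_d -> A) (f : ncpoly R d) : A :=
  \sum_(w <- monalg.msupp f) monalg.mcoeff w f *: wordeval mul one x w.

End NCPoly.

(* Index set of a tuple of length m in N u {oo}, with [None] for oo. *)
Definition idx (m : option nat) : choiceType :=
  match m return choiceType with Some k => 'I_k | None => nat end.

(* The direct sum of m copies of C<t_1, ..., t_d>. *)
Definition nctuple (R : realType) (d : nat) (m : option nat) :=
  {fsfun idx m -> ncpoly R d with 0}.

(** * Operators on a complex Hilbert space *)

(* The inner product is linear in its first argument and conjugate linear in
   the second. *)
Record hilbert (R : realType) := Hilbert {
  hilbert_sort :> completeNormedModType R[i];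
  inner : {dot hilbert_sort for Num.conj};
  inner_norm : forall u, `|u| ^+ 2 = inner u u }.

Section Operators.
Context {R : realType} {H : hilbert R}.
Implicit Types (a b : H -> H) (M N S : set (H -> H)).

Definition bounded_op a := linear a /\ continuous a.

Definition adj a : H -> H :=
  xget (fun=> 0) [set b | bounded_op b /\
                          forall u v, inner H (a u) v = inner H u (b v)].

Definition selfadj a := bounded_op a /\ adj a = a.

(* The order of R[i] only relates complex numbers with equal imaginary parts. *)
Definition ge0_op a := forall u, 0 <= inner H (a u) u.

Definition opnorm a : R :=
  sup [set complex.Re `|a u| | u in [set u : H | `|u| <= 1]].

Definition tuple_norm d (x : 'I_d -> H -> H) : R :=
  \big[Num.max/0]_(j < d) opnorm (x j).

Definition commutant S : set (H -> H) :=
  [set b | bounded_op b /\ forall a, S a -> a \o b = b \o a].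

(* The bicommutant condition makes [M] a unital algebra of bounded operators. *)
Definition von_neumann M :=
  (forall a, M a -> M (adj a)) /\ commutant (commutant M) = M.

Definition vN_gen S : set (H -> H) :=
  [set a | forall N, von_neumann N -> S `<=` N -> N a].

Definition is_sup_in M (D : set (H -> H)) (s : H -> H) :=
  [/\ M s, forall a, D a -> ge0_op (s - a) &
      forall b, M b -> (forall a, D a -> ge0_op (b - a)) -> ge0_op (b - s)].

(* [tau] preserves suprema of bounded increasing nets of positive elements. *)
Definition normal_on M (tau : (H -> H) -> R[i]) :=
  forall (D : set (H -> H)) s, D !=set0 -> D `<=` [set a | M a /\ ge0_op a] ->
    (forall a b, D a -> D b ->
       exists c, [/\ D c, ge0_op (c - a) & ge0_op (c - b)]) ->
    is_sup_in M D s ->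
    complex.Re (tau s) = sup [set complex.Re (tau a) | a in D].

(* Only the values of [tau] on [M] matter. *)
Record tracial_state M (tau : (H -> H) -> R[i]) : Prop := TracialState {
  state_linear : forall c a b, M a -> M b -> tau (c *: a + b) = c * tau a + tau b;
  state_ge0 : forall a, M a -> 0 <= tau (adj a \o a);
  state_faithful : forall a, M a -> tau (adj a \o a) = 0 -> a = 0;
  state_id : tau id = 1;
  state_tracial : forall a b, M a -> M b -> tau (a \o b) = tau (b \o a);
  state_normal : normal_on M tau }.

Definition tracial_vNa M tau := von_neumann M /\ tracial_state M tau.

Definition generates d (x : 'I_d -> H -> H) M :=
  (forall j, selfadj (x j)) /\ vN_gen (range x) = M.

Definition opeval d (x : 'I_d -> H -> H) (f : ncpoly R d) : H -> H :=
  nceval (fun a b => a \o b) id x f.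

End Operators.

(** * Laws, microstates, and strong 1-boundedness *)

Section Entropy.
Context {R : realType}.

(* {ptws _ -> _} carries the topology of pointwise convergence; R[i]^o is R[i]
   with its usual topology. *)
Definition ncfun (d : nat) := {ptws ncpoly R d -> R[i]^o}.

Definition law (H : hilbert R) (tau : (H -> H) -> R[i]) d (x : 'I_d -> H -> H) :
  ncfun d := fun f => tau (opeval x f).

Definition laws d (r : R) : set (ncfun d) :=
  [set l | exists (H : hilbert R) (M : set (H -> H)) tau (x : 'I_d -> H -> H),
     [/\ tracial_vNa M tau, forall j, M (x j) /\ selfadj (x j),
         tuple_norm x <= r & l = law tau x]].

Definition law_open d (r : R) (O : set (ncfun d)) :=
  exists2 U : set (ncfun d), open U & O = U `&` laws r.

Definition mxtr n (A : 'M[R[i]]_n) : R[i] := n%:R^-1 * \tr A.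

Definition mxtuple (d n : nat) := {ffun 'I_d -> 'M[R[i]]_n}.

Definition mxlaw d n (X : mxtuple d n) : ncfun d :=
  fun f => mxtr (nceval (fun A B : 'M[R[i]]_n => A *m B) 1%:M X f).

Definition microstates d (O : set (ncfun d)) n : set (mxtuple d n) :=
  [set X : mxtuple d n | (forall j, X j \is hermsymmx) /\ O (mxlaw X)].

Definition mxnorm2 d n (A : mxtuple d n) : R :=
  Num.sqrt (complex.Re (\sum_(j < d) mxtr ((A j)^t* *m A j))).

Definition orb_cover d n (eps : R) (Om : set (mxtuple d n))
    (Xi : {fset mxtuple d n}) :=
  forall A, Om A -> exists B V, [/\ B \in Xi, V \is unitarymx &
    mxnorm2 [ffun j => A j - V *m B j *m V^t*] < eps].

Definition Korb d n (eps : R) (Om : set (mxtuple d n)) : \bar R :=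
  ereal_inf [set (#|` Xi|%:R)%:E | Xi in orb_cover eps Om].

Definition h_open d (eps : R) (O : set (ncfun d)) : \bar R :=
  limn_esup (fun n => ((n%:R ^+ 2)^-1)%:E * lne (Korb eps (@microstates d O n)))%E.

Definition h_eps d (r eps : R) (l : ncfun d) : \bar R :=
  ereal_inf [set h_open eps O | O in [set O | law_open r O /\ O l]].

Definition h_law d (r : R) (l : ncfun d) : \bar R :=
  ereal_sup [set h_eps r eps l | eps in [set eps | 0 < eps]].

(* h(M) is [h_law r (law tau x)] for any generating tuple x and any bound r of
   its norm; its value does not depend on that choice. *)
Definition strongly_1_bounded (H : hilbert R) (M : set (H -> H)) tau :=
  exists d (x : 'I_d -> H -> H) (r : R),
    [/\ generates x M, tuple_norm x <= r & (h_law r (law tau x) < +oo)%E].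

End Entropy.

(** * The tensor product of M and its opposite *)

(* M^op acts on the conjugate Hilbert space H^c by b^op v^c = (b^* v)^c.  The
   Hilbert space [K] is H (x) H^c, through [tens u v] = u (x) v^c. *)

Section Tensor.
Context {R : realType} {H K : hilbert R} (tens : H -> H -> K).

Definition hilbert_tensor :=
  [/\ forall v, linear (tens^~ v),
      forall u c v w, tens u (c *: v + w) = Num.conj c *: tens u v + tens u w,
      forall u v u' v',
        inner K (tens u v) (tens u' v') = inner H u u' * inner H v' v &
      closure [set \sum_(p <- s) tens p.1 p.2 | s in [set: seq (H * H)]] = setT].

(* The operator a (x) b^op. *)
Definition optens (a b : H -> H) : K -> K :=
  xget (fun=> 0) [set T | bounded_op T /\
                          forall u v, T (tens u v) = tens (a u) (adj b v)].

Definition tensor_vN (M : set (H -> H)) : set (K -> K) :=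
  vN_gen [set optens a b | a in M & b in M].

Definition tensor_trace (M : set (H -> H)) tau tau2 :=
  tracial_state (tensor_vN M) tau2 /\
  forall a b, M a -> M b -> tau2 (optens a b) = tau a * tau b.

Definition nceval2 d (x : 'I_d -> H -> H) (q : ncpoly2 R d) : K -> K :=
  \sum_(p <- monalg.msupp q) monalg.mcoeff p q *:
    optens (wordeval (fun a b => a \o b) id x p.1)
           (wordeval (fun a b => a \o b) id x p.2).

(* The entry of D_f(x) in row [k] and column [j]; the first row is [None]. *)
Definition Dmx d m (x : 'I_d -> H -> H) (f : nctuple R d m)
    (k : option (idx m)) (j : 'I_d) : K -> K :=
  match k with
  | None => optens (x j) id - optens id (x j)
  | Some i => nceval2 x (free_diff_quot j (f i))
  end.

End Tensor.

(** * Spectral measure of |D_f(x)| *)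

(* Elements of M_d(B(K)), acting on K^d. *)
Definition opmx {R : realType} (K : hilbert R) (d : nat) := 'I_d -> 'I_d -> K -> K.

Section OpMatrix.
Context {R : realType} {K : hilbert R} {d : nat}.
Implicit Types (A B : opmx K d).

Definition opmx_bounded A := forall i j, bounded_op (A i j).

Definition opmx1 : opmx K d := fun i j => if i == j then id else fun=> 0.

Definition opmx_mul A B : opmx K d := fun i j => \sum_(k < d) (A i k \o B k j).

Definition opmx_adj A : opmx K d := fun i j => adj (A j i).

(* <A u, u> for u in K^d *)
Definition opmx_form A (u : 'I_d -> K) : R[i] :=
  \sum_(i < d) \sum_(j < d) inner K (A i j (u j)) (u i).

(* The positive square root of [A]. *)
Definition opmx_sqrt A : opmx K d :=
  xget (fun _ _ _ => 0) [set S | [/\ opmx_bounded S,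
    forall u, 0 <= opmx_form S u & opmx_mul S S = A]].

(* (tr_d (x) tau2)(A) *)
Definition opmx_trace (tau2 : (K -> K) -> R[i]) A : R[i] :=
  d%:R^-1 * \sum_(i < d) tau2 (A i i).

(* [E] is the projection-valued measure on the Borel sets of the line with
   S = \int t dE(t). *)
Record spectral_resolution (S : opmx K d) (E : set (measurableTypeR R) -> opmx K d)
    : Prop := SpectralResolution {
  resolution_bounded : forall X, measurable X -> opmx_bounded (E X);
  resolution_selfadj : forall X, measurable X -> opmx_adj (E X) = E X;
  resolution_setT : E setT = opmx1;
  resolution_setI : forall X Y, measurable X -> measurable Y ->
    E (X `&` Y) = opmx_mul (E X) (E Y);
  resolution_integral : forall u : 'I_d -> K,
    exists nu : {measure set (measurableTypeR R) -> \bar R},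
      [/\ forall X, measurable X -> nu X = (complex.Re (opmx_form (E X) u))%:E,
          nu.-integrable setT (fun t => t%:E) &
          opmx_form S u = (\int[nu]_t t)%:C] }.

Definition spectral_measure tau2 (S : opmx K d)
    (mu : {measure set (measurableTypeR R) -> \bar R}) :=
  exists2 E, spectral_resolution S E &
    forall X, measurable X -> mu X = (complex.Re (opmx_trace tau2 (E X)))%:E.

End OpMatrix.

(* |D_f(x)| = (D_f(x)^* D_f(x))^(1/2); the rows with f_i = 0 vanish. *)
Definition absD {R : realType} {H K : hilbert R} (tens : H -> H -> K) d m
    (x : 'I_d -> H -> H) (f : nctuple R d m) : opmx K d :=
  opmx_sqrt (fun j k =>
    \sum_(l <- None :: [seq Some i | i <- finsupp f])
       (adj (Dmx tens x f l j) \o Dmx tens x f l k)).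

(* Main.v *)
(* Let X and Y be microstates at a small distance eps, where Y has been replaced
   by a nearly optimal unitary conjugate, and put Z = Y - X.  Then D_f(X) Z is
   known up to a small error: optimality of Y makes the first row of D_f(X) Z
   small, and since f(X) and f(Y) are nearly 0 the other rows are small up to
   second order Taylor remainders.  The remainders are sums of terms Z a (Y - X)
   with two small factors, so that they are determined by the spectral part of Z
   for its few large eigenvalues.  Hence the remainders, together with the
   coordinates of Z in the spectral subspace of D_f(X)^* D_f(X) below t^2,
   determine Y at a finer scale.

   At the scale eps_k = E0 / 16^k with t = 2^-k, the code of Y costs n^2 times
   C 2^-k plus the proportion of eigenvalues below t^2; the latter is at most
   twice the normalized trace of (1 - D_f(X)^* D_f(X) / L)^N with N of the order
   of 4^k.  This trace is a polynomial in the moments of X, so for X close to x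
   in law it is almost its value at x, which spectral calculus bounds by
   mu [0, e^(-k/4)) + O(2^-k).  Since log is mu-integrable, the sum over k
   converges, and the entropies at all scales are bounded by the same constant. *)

(* Why the scales shrink by 16: the codes used here cost an amount linear, not logarithmic, in the
   ratio of resolutions ([codable_vec]). Take normalized distances [E0 / p ^ a] with [p = 2 ^ k].
   Inverting |D_f(X)| above the cut t = 1/p loses a factor p, so remainders must be known up to
   order [E0 / p ^ (a + 1)]. Eigenvalues of Z below order 1/p may then be dropped; of order n p^(2 -
   2a) others remain, each with n coordinates, to be coded at ratio of order p^(a + 1). The cost n^2
   p^(3 - a) is summable over k for a > 3, and a = 4 gives n^2 / p.

   A second obstacle is that [adj], [optens] and [opmx_sqrt] return 0 when the object they denote
   does not exist. Existence is extracted from the hypotheses: nonzero traces force the tensors of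
   shifted words to exist, and integrability of log forces the square root of D_f(x)^* D_f(x) to
   exist. Likewise, the spectral projections are placed in the tensor product algebra without
   functional calculus, by comparing growth rates of powers. *)
From HB Require Import structures.
Require Import Defs.
From mathcomp Require Import all_boot all_order all_algebra.
From mathcomp Require Import finmap complex ring lra zify.
From mathcomp Require Import all_classical all_reals all_analysis measurable_realfun.
From mathcomp Require multinomials.monalg.
Import(canonicals, coercions) multinomials.monalg.

Set Implicit Arguments.
Unset Strict Implicit.
Unset Printing Implicit Defensive.

Import Order.TTheory GRing.Theory Num.Theory numFieldNormedType.Exports.
Import Normc.

Local Open Scope classical_set_scope.
Local Open Scope complex_scope.
Local Open Scope sesquilinear_scope.
Local Open Scope ring_scope.

(** * Positive semidefinite forms *)

Ltac nneg := repeat first [ assumption | done | exact: ler01 | exact: ler0n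
  | exact: sqr_ge0 | exact: sqrtr_ge0 | exact: expR_ge0 | exact: normr_ge0
  | apply: addr_ge0 | apply: mulr_ge0 | rewrite invr_ge0 | apply: exprn_ge0
  | (apply: ltW; assumption) ].

Ltac gt0 := repeat first [ assumption | done | exact: ltr01
  | (rewrite ltr0n; assumption) | (rewrite ltr0n; done) | exact: expR_gt0
  | (rewrite sqrtr_gt0; assumption)
  | apply: addr_gt0 | apply: mulr_gt0 | rewrite invr_gt0 | apply: exprn_gt0 ].

Section PsdForm.
Context {R : realType}.

Lemma conjE (z : R[i]) : z^* = Complex (complex.Re z) (- complex.Im z).
Proof. by case: z. Qed.

Lemma Re_mul (z w : R[i]) : complex.Re (z * w) =
  complex.Re z * complex.Re w - complex.Im z * complex.Im w.
Proof. by case: z w => [a b] [c e]. Qed.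

Lemma Im_mul (z w : R[i]) : complex.Im (z * w) =
  complex.Re z * complex.Im w + complex.Im z * complex.Re w.
Proof. by case: z w => [a b] [c e]. Qed.

Lemma ReD (z w : R[i]) : complex.Re (z + w) = complex.Re z + complex.Re w.
Proof. by case: z w => [a b] [c e]. Qed.

Lemma ImD (z w : R[i]) : complex.Im (z + w) = complex.Im z + complex.Im w.
Proof. by case: z w => [a b] [c e]. Qed.

Lemma ReN (z : R[i]) : complex.Re (- z) = - complex.Re z.
Proof. by case: z. Qed.

Lemma ImN (z : R[i]) : complex.Im (- z) = - complex.Im z.
Proof. by case: z. Qed.

Lemma Re_sum I (s : seq I) (P : pred I) (F : I -> R[i]) :
  complex.Re (\sum_(i <- s | P i) F i) = \sum_(i <- s | P i) complex.Re (F i).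
Proof. exact: (big_morph _ ReD). Qed.

Lemma complex_ext (z w : R[i]) : complex.Re z = complex.Re w ->
  complex.Im z = complex.Im w -> z = w.
Proof. by case: z w => [a b] [c e] /= -> ->. Qed.

Lemma sqr_normcE (z : R[i]) : normc z ^+ 2 = complex.Re z ^+ 2 + complex.Im z ^+ 2.
Proof. by case: z => a b /=; rewrite sqr_sqrtr // addr_ge0 ?sqr_ge0. Qed.

Lemma normc_ge0 (z : R[i]) : 0 <= normc z.
Proof. by case: z => a b; exact: sqrtr_ge0. Qed.

Lemma mul_conjE (z : R[i]) : z * z^* = (normc z ^+ 2)%:C.
Proof.
rewrite sqr_normcE conjE; case: z => a b; apply: complex_ext => /=; ring.
Qed.

Lemma normc_conj (z : R[i]) : normc z^* = normc z.
Proof. by rewrite conjE; case: z => a b /=; rewrite sqrrN. Qed.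

Lemma Re_le_normc (z : R[i]) : complex.Re z <= normc z.
Proof.
apply: (le_trans (ler_norm _)); rewrite -sqrtr_sqr.
by case: z => a b; apply: ler_wsqrtr => /=; rewrite lerDl sqr_ge0.
Qed.

Lemma normcR (a : R) : normc a%:C = `|a|.
Proof. by rewrite /= expr0n addr0 sqrtr_sqr. Qed.

Lemma ReC (a : R) : complex.Re a%:C = a. Proof. by []. Qed.

Record psd (V : lmodType R[i]) (f : V -> V -> R[i]) : Prop := Psd {
  psd_lin : forall c (u v w : V), f (c *: u + v) w = c * f u w + f v w;
  psd_herm : forall u v : V, f v u = (f u v)^*;
  psd_ge0 : forall u : V, 0 <= f u u }.

Definition nr (V : lmodType R[i]) (f : V -> V -> R[i]) (u : V) : R :=
  Num.sqrt (complex.Re (f u u)).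

Section Theory.
Variables (V : lmodType R[i]) (f : V -> V -> R[i]) (Hf : psd f).

Lemma psd0l w : f 0 w = 0.
Proof.
have := psd_lin Hf 1 0 0 w; rewrite scaler0 addr0 mul1r => /eqP.
by rewrite -subr_eq subrr => /eqP/esym.
Qed.

Lemma psdDl u v w : f (u + v) w = f u w + f v w.
Proof. by rewrite -{1}(scale1r u) psd_lin // mul1r. Qed.

Lemma psdZl c u w : f (c *: u) w = c * f u w.
Proof. by rewrite -{1}(addr0 (c *: u)) psd_lin // psd0l addr0. Qed.

Lemma psdDr u v w : f w (u + v) = f w u + f w v.
Proof. by rewrite (psd_herm Hf) psdDl rmorphD /= -!psd_herm. Qed.

Lemma psdZr c u w : f w (c *: u) = c^* * f w u.
Proof. by rewrite (psd_herm Hf) psdZl rmorphM /= -!psd_herm. Qed.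

Lemma psdNl u w : f (- u) w = - f u w.
Proof. by rewrite -scaleN1r psdZl mulN1r. Qed.

Lemma psdNr u w : f w (- u) = - f w u.
Proof. by rewrite (psd_herm Hf) psdNl rmorphN /= -psd_herm. Qed.

Lemma psdBl u v w : f (u - v) w = f u w - f v w.
Proof. by rewrite psdDl psdNl. Qed.

Lemma psdBr u v w : f w (u - v) = f w u - f w v.
Proof. by rewrite psdDr psdNr. Qed.

Lemma psd0r w : f w 0 = 0.
Proof. by rewrite (psd_herm Hf) psd0l rmorph0. Qed.

Lemma psd_suml I (s : seq I) (P : pred I) (F : I -> V) w :
  f (\sum_(i <- s | P i) F i) w = \sum_(i <- s | P i) f (F i) w.
Proof. by apply: (big_morph (f^~ w)) => [u v|]; rewrite ?psdDl ?psd0l. Qed.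

Lemma psd_sumr I (s : seq I) (P : pred I) (F : I -> V) w :
  f w (\sum_(i <- s | P i) F i) = \sum_(i <- s | P i) f w (F i).
Proof. by apply: (big_morph (f w)) => [u v|]; rewrite ?psdDr ?psd0r. Qed.

Lemma Re_psd_ge0 u : 0 <= complex.Re (f u u).
Proof. by have := psd_ge0 Hf u; rewrite lecE => /andP[]. Qed.

Lemma Im_psd u : complex.Im (f u u) = 0.
Proof. by have := psd_ge0 Hf u; rewrite lecE => /andP[/eqP]. Qed.

Lemma nr_ge0 u : 0 <= nr f u. Proof. exact: sqrtr_ge0. Qed.

Lemma sqr_nr u : nr f u ^+ 2 = complex.Re (f u u).
Proof. by rewrite sqr_sqrtr // Re_psd_ge0. Qed.

Lemma psdE u : f u u = (nr f u ^+ 2)%:C.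
Proof. by apply: complex_ext; rewrite ?Im_psd // sqr_nr. Qed.

Lemma psdRe_herm u v : complex.Re (f u v) = complex.Re (f v u).
Proof. by rewrite (psd_herm Hf v u) conjE. Qed.

Lemma sqr_nrD u v :
  nr f (u + v) ^+ 2 = nr f u ^+ 2 + 2 * complex.Re (f u v) + nr f v ^+ 2.
Proof.
rewrite !sqr_nr psdDl !psdDr !ReD (psdRe_herm v u); ring.
Qed.

Lemma sqr_nrZ c u : nr f (c *: u) ^+ 2 = normc c ^+ 2 * nr f u ^+ 2.
Proof.
by rewrite {1}sqr_nr psdZl psdZr mulrA mul_conjE psdE Re_mul /= mul0r subr0.
Qed.

Lemma nrZ c u : nr f (c *: u) = normc c * nr f u.
Proof.
apply/eqP; rewrite -(@eqrXn2 _ 2) ?nr_ge0 ?mulr_ge0 ?normc_ge0 ?nr_ge0 //.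
by rewrite exprMn sqr_nrZ.
Qed.

Lemma nrN u : nr f (- u) = nr f u.
Proof. by rewrite /nr psdNl psdNr opprK. Qed.

Lemma nr0 : nr f 0 = 0.
Proof. by rewrite /nr psd0l sqrtr0. Qed.

Lemma psd_CS u v : normc (f u v) <= nr f u * nr f v.
Proof.
rewrite -(@ler_pXn2r _ 2) ?nnegrE ?mulr_ge0 ?normc_ge0 ?nr_ge0 //.
rewrite exprMn; set c := f u v; set n := normc c ^+ 2.
have n0 : 0 <= n by exact: sqr_ge0.
have key (t : R) : 0 <= nr f u ^+ 2 - 2 * t * n + t ^+ 2 * n * nr f v ^+ 2.
  have := sqr_ge0 (nr f (u - (t%:C * c) *: v)).
  rewrite sqr_nrD nrN sqr_nrZ psdNr psdZr rmorphM /= -mulrA -/c.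
  rewrite [c^* * c]mulrC mul_conjE conjE ReN Re_mul /= -/n normcM normcR.
  rewrite exprMn -/n -normrX ger0_norm ?sqr_ge0 //; lra.
have [v0|v0] := eqVneq (nr f v) 0.
  rewrite v0 expr0n mulr0; have [->//|nn0] := eqVneq n 0.
  have npos : 0 < n by rewrite lt_def nn0.
  (* When [nr f v = 0] the bound [key] is affine in [t], and this [t] gives it the value -1. *)
  have := key ((nr f u ^+ 2 + 1) / (2 * n)).
  rewrite v0 expr0n mulr0 addr0.
  rewrite [X in _ - X](_ : _ = nr f u ^+ 2 + 1); last by field.
  lra.
have vpos : 0 < nr f v ^+ 2 by rewrite exprn_gt0 // lt_def v0 nr_ge0.
have := key (nr f v ^+ 2)^-1.
rewrite [X in 0 <= X](_ : _ = nr f u ^+ 2 - n / nr f v ^+ 2); last by field.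
by rewrite subr_ge0 ler_pdivrMr.
Qed.

Lemma nrD u v : nr f (u + v) <= nr f u + nr f v.
Proof.
rewrite -(@ler_pXn2r _ 2) ?nnegrE ?addr_ge0 ?nr_ge0 //.
rewrite sqr_nrD; have := le_trans (Re_le_normc _) (psd_CS u v); nra.
Qed.

Lemma nrB u v : nr f (u - v) <= nr f u + nr f v.
Proof. by rewrite -(nrN v) nrD. Qed.

Lemma nrBC u v : nr f (u - v) = nr f (v - u).
Proof. by rewrite -nrN opprB. Qed.

Lemma nr_sum I (s : seq I) (P : pred I) (F : I -> V) :
  nr f (\sum_(i <- s | P i) F i) <= \sum_(i <- s | P i) nr f (F i).
Proof.
elim/big_rec2: _ => [|i y x _ le]; first by rewrite nr0.
exact: le_trans (nrD _ _) (lerD _ le).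
Qed.

End Theory.
End PsdForm.

Section LinearMaps.
Context {R : realType} (V W : lmodType R[i]) (g : V -> W) (Hg : linear g).

Lemma linD u v : g (u + v) = g u + g v.
Proof. by rewrite -{1}(scale1r u) Hg scale1r. Qed.

Lemma lin0 : g 0 = 0.
Proof. by apply: (addIr (g 0)); rewrite -linD !add0r. Qed.

Lemma linZ c u : g (c *: u) = c *: g u.
Proof. by rewrite -{1}(addr0 (c *: u)) Hg lin0 addr0. Qed.

Lemma linN u : g (- u) = - g u.
Proof. by rewrite -scaleN1r linZ scaleN1r. Qed.

Lemma linB u v : g (u - v) = g u - g v.
Proof. by rewrite linD linN. Qed.

Lemma lin_sum I (s : seq I) (P : pred I) (F : I -> V) :
  g (\sum_(i <- s | P i) F i) = \sum_(i <- s | P i) g (F i).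
Proof. by apply: (big_morph g) => [u v|]; rewrite ?linD ?lin0. Qed.

End LinearMaps.

Section CoordForm.
Context {R : realType} (V : lmodType R[i]) (I : finType) (phi : I -> V -> R[i]).
Hypothesis phiL : forall i, linear_for *%R (phi i).

Definition cform (u v : V) : R[i] := \sum_i phi i u * (phi i v)^*.

Lemma cform_psd : psd cform.
Proof.
split=> [c u v w|u v|u].
- by rewrite mulr_sumr -big_split; apply: eq_bigr => i _; rewrite phiL mulrDl mulrA.
- by rewrite rmorph_sum; apply: eq_bigr => i _; rewrite rmorphM /= conjCK mulrC.
- by apply: sumr_ge0 => i _; rewrite mul_conjC_ge0.
Qed.

Lemma sqr_nr_cform u : nr cform u ^+ 2 = \sum_i normc (phi i u) ^+ 2.
Proof.
rewrite sqr_nr ?Re_sum; last exact: cform_psd.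
by apply: eq_bigr => i _; rewrite mul_conjE.
Qed.

End CoordForm.

(** * Entropy by codes *)

Section Coding.
Context {R : realType}.

(* Covering numbers are bounded by exhibiting codes: [k] is the entropy of [Om]
   at the resolution [rel]. *)
Definition codable (Y : Type) (Om : set Y) (rel : Y -> Y -> Prop) (k : R) :=
  exists m (c : Y -> 'I_m), m%:R <= expR k /\
    forall y y', Om y -> Om y' -> c y = c y' -> rel y y'.

Variable Y : Type.
Implicit Types (Om : set Y) (rel : Y -> Y -> Prop).

Lemma codable_fin (T : finType) (c : Y -> T) Om rel k : #|T|%:R <= expR k ->
  (forall y y', Om y -> Om y' -> c y = c y' -> rel y y') -> codable Om rel k.
Proof.
move=> Tk H; exists #|T|, (fun y => enum_rank (c y)); split=> // y y' Oy Oy'.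
by move/enum_rank_inj; exact: H.
Qed.

Lemma codable_triv Om rel k : 0 <= k ->
  (forall y y', Om y -> Om y' -> rel y y') -> codable Om rel k.
Proof.
move=> k0 H; apply: (@codable_fin unit (fun=> tt)) => [|y y' Oy Oy' _].
  by rewrite card_unit -expR0 ler_expR.
exact: H.
Qed.

Lemma codable_set (T : finType) (A : {set T}) (c : Y -> T) Om rel k : 0 <= k ->
  #|A|%:R <= expR k -> (forall y, Om y -> c y \in A) ->
  (forall y y', Om y -> Om y' -> c y = c y' -> rel y y') -> codable Om rel k.
Proof.
move=> k0 Ak cA H; have [[y0 Oy0]|Om0] := pselect (exists y, Om y); last first.
  by apply: codable_triv => // y y' Oy; case: Om0; exists y.
exists #|A|, (fun y => enum_rank_in (cA y0 Oy0) (c y)); split=> // y y' Oy Oy' e.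
by apply: H => //; have := enum_rank_in_inj (cA _ Oy) (cA _ Oy') e.
Qed.

Lemma codable_mono Om Om' rel rel' k k' : codable Om rel k -> k <= k' ->
  Om' `<=` Om ->
  (forall y y', Om' y -> Om' y' -> rel y y' -> rel' y y') -> codable Om' rel' k'.
Proof.
move=> [m [c [mk H]]] kk' sub rr; exists m, c; split.
  by apply: le_trans mk _; rewrite ler_expR.
by move=> y y' Oy Oy' e; apply: rr => //; apply: H => //; exact: sub.
Qed.

(** A nonempty class of the coarse code lies in the [rel]-neighbourhood of any of its points [y0],
    so it inherits the fine code of that neighbourhood. The fine codes vary with the class, but all
    fit into one alphabet of size [Num.truncn (expR k')]. *)
Lemma codable_refine Om rel rel' k k' : 0 <= k' -> codable Om rel k ->
  (forall y0, Om y0 -> codable [set y | Om y /\ rel y0 y] rel' k') ->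
  codable Om rel' (k + k').
Proof.
move=> k'0 [m [c [mk H]]] H'.
pose M := Num.truncn (expR k').
have expM : M%:R <= expR k' by rewrite truncn_le // expR_ge0.
have /choice[g gP] (i : 'I_m) : exists g : Y -> nat,
    (forall y, Om y -> c y = i -> (g y < M)%N) /\
    (forall y y', Om y -> Om y' -> c y = i -> c y' = i -> g y = g y' -> rel' y y').
  have [[y0 [Oy0 cy0]]|no] := pselect (exists y0, Om y0 /\ c y0 = i); last first.
    by exists (fun=> 0%N); split=> [y Oy cy|y y' Oy _ cy]; case: no; exists y.
  have [m' [c' [m'k H'']]] := H' _ Oy0.
  exists (fun y => c' y : nat); split=> [y Oy cy|y y' Oy Oy' cy cy' /val_inj e].
    rewrite (leq_trans (ltn_ord _)) // /M truncn_ge_nat // expR_ge0 //.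
  by apply: H'' => //; split=> //; apply: H => //; rewrite cy0.
apply: (@codable_fin ('I_m * 'I_M.-1.+1)%type (fun y => (c y, inord (g (c y) y)))).
  rewrite card_prod !card_ord expRD natrM ler_pM // ?ler0n //.
  by rewrite prednK // truncn_gt0 -expR0 ler_expR.
move=> y y' Oy Oy' [cc /(congr1 val)].
have [gl gI] := gP (c y); have lt1 := gl _ Oy erefl.
have M0 : (0 < M)%N by exact: leq_ltn_trans lt1.
have lt2 := gl _ Oy' (esym cc).
by rewrite /= !inordK ?prednK // -?cc // => e; apply: gI.
Qed.

Lemma codable_and Om rel rel' k k' : 0 <= k' -> codable Om rel k ->
  codable Om rel' k' -> codable Om (fun y y' => rel y y' /\ rel' y y') (k + k').
Proof.
move=> k'0 [m [c [mk H]]] [m' [c' [mk' H']]].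
apply: (@codable_fin ('I_m * 'I_m')%type (fun y => (c y, c' y))).
  by rewrite card_prod !card_ord expRD natrM ler_pM // ?ler0n.
by move=> y y' Oy Oy' [e e']; split; [apply: H|apply: H'].
Qed.

Lemma codable_all (I : eqType) (s : seq I) Om (rel : I -> Y -> Y -> Prop) k :
  0 <= k -> (forall i, i \in s -> codable Om (rel i) k) ->
  codable Om (fun y y' => forall i, i \in s -> rel i y y') (k *+ size s).
Proof.
move=> k0; elim: s => [|i s IH] H.
  by rewrite mulr0n; apply: codable_triv.
rewrite /= mulrS; have ks : 0 <= k *+ size s by rewrite mulrn_wge0.
have H1 := H i (mem_head _ _).
have H2 := IH (fun j js => H j (@mem_behead _ (i :: s) j js)).
apply: codable_mono (codable_and ks H1 H2) _ _ _ => // y y' _ _ [r1 r2] j.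
by rewrite inE => /predU1P[->|/r2].
Qed.

Lemma natr_exp2_le n : (2 ^ n)%:R <= expR n%:R :> R.
Proof.
rewrite natrX; have -> : expR n%:R = expR 1 ^+ n :> R by rewrite -expRM_natl mulr1.
rewrite lerXn2r ?nnegrE ?expR_ge0 //; have := @expR_ge1Dx R 1; lra.
Qed.

Lemma bin_le_exp2 n m : ('C(n, m) <= 2 ^ n)%N.
Proof.
have [mn|/bin_small->//] := leqP m n.
rewrite -[2%N]/(1 + 1)%N expnDn (bigD1 (inord m)) //= inordK ?ltnS //.
by rewrite !exp1n !muln1 leq_addr.
Qed.

(** The integer parts of [g y i / h] form a vector of naturals with sum at most [M]. There are
    binomial(#|P| + M, M) such vectors, hence at most 2^(#|P| + M). Bounding the total mass, rather
    than each coordinate, is what avoids a logarithmic factor. *)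
Lemma codable_nonneg (I : finType) (P : pred I) (g : Y -> I -> R) (M : nat) (h : R)
    Om : 0 < h -> (forall y i, Om y -> 0 <= g y i) ->
  (forall y, Om y -> \sum_(i | P i) g y i <= h * M%:R) ->
  codable Om (fun y y' => forall i, P i -> `|g y i - g y' i| <= h)
    (#|P| + M)%:R.
Proof.
move=> h0 g0 gM; set N := #|P|.
pose a y i := Num.truncn (g y i / h).
have ale y i : Om y -> (a y i)%:R <= g y i / h.
  by move=> Oy; rewrite truncn_le // divr_ge0 ?g0 // ltW.
have asum y : Om y -> (\sum_(i | P i) a y i <= M)%N.
  move=> Oy; rewrite -(ler_nat R) natr_sum.
  apply: (@le_trans _ _ (\sum_(i | P i) g y i / h)).
    by apply: ler_sum => i _; exact: ale.
  by rewrite -mulr_suml ler_pdivrMr // mulrC gM.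
have alt y i : Om y -> P i -> (a y i < M.+1)%N.
  move=> Oy Pi; rewrite ltnS (leq_trans _ (asum _ Oy)) //.
  by rewrite (bigD1 i) //= leq_addr.
pose A := [set t : N.-tuple 'I_M.+1 | (\sum_(i <- t) i <= M)%N]%SET.
pose c y : N.-tuple 'I_M.+1 := [tuple inord (a y (enum_val (A := P) k)) | k < N].
apply: (@codable_set _ A c) => [||y Oy|y y' Oy Oy' e i Pi].
- exact: ler0n.
- rewrite card_partial_ord_partitions (le_trans _ (natr_exp2_le _)) //.
  by rewrite ler_nat bin_le_exp2.
- rewrite inE big_tuple; apply: leq_trans (asum _ Oy).
  rewrite (eq_bigr (fun k => a y (enum_val (A := P) k))); last first.
    by move=> k _; rewrite tnth_mktuple inordK // alt //; exact: enum_valP.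
  by rewrite -(big_enum_val (A := P) (a y)).
- have : a y i = a y' i.
    have := congr1 (fun t => val (tnth t (enum_rank_in Pi i))) e.
    by rewrite !tnth_mktuple /= enum_rankK_in // !inordK ?alt.
  move=> ae.
  have up z : Om z -> g z i / h < (a z i).+1%:R by move=> _; exact: truncnS_gt.
  have l1 := ale _ i Oy; have l2 := ale _ i Oy'.
  have u1 := up _ Oy; have u2 := up _ Oy'.
  rewrite ae -natr1 in l1 u1; rewrite -natr1 in u2.
  have e1 : g y i = (g y i / h) * h by rewrite divfK // gt_eqF.
  have e2 : g y' i = (g y' i / h) * h by rewrite divfK // gt_eqF.
  rewrite e1 e2 -mulrBl normrM (gtr0_norm h0) ger_pMl // ler_norml; lra.
Qed.

(** Each complex coordinate is split into four nonnegative parts, and each family of parts is coded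
    by [codable_nonneg] with [M = 5 * N * kappa]. A volume argument would cost log kappa per
    coordinate; the linear cost is good enough for scales in geometric progression. *)
Lemma codable_vec (I : finType) (P : pred I) (z : Y -> I -> R[i]) (kappa : nat)
    (rho : R) Om : 0 < rho -> (0 < kappa)%N ->
  (forall y, Om y -> \sum_(i | P i) normc (z y i) ^+ 2 <= rho ^+ 2) ->
  codable Om (fun y y' =>
      \sum_(i | P i) normc (z y i - z y' i) ^+ 2 <= (rho / kappa%:R) ^+ 2)
    (#|P| * (4 + 20 * kappa))%:R.
Proof.
move=> rho0 k0 Hz; set N := #|P|.
have [N0|N0] := posnP N.
  apply: codable_triv => [|y y' _ _]; first exact: ler0n.
  by rewrite (eq_bigl _ _ (card0_eq N0)) big_pred0_eq sqr_ge0.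
have N0' : 0 < N%:R :> R by rewrite ltr0n.
have k0' : 0 < kappa%:R :> R by rewrite ltr0n.
have [s s0 s2] : exists2 s : R, 0 < s & s ^+ 2 = 8 * N%:R.
  exists (Num.sqrt (8 * N%:R)); first by rewrite sqrtr_gt0 mulr_gt0 ?ltr0n.
  by rewrite sqr_sqrtr // mulr_ge0 ?ler0n.
(* With mesh [h], the real and imaginary parts are differences of two parts known up to [h], so each
   squared modulus is known up to [8 * h ^ 2]; the [N] coordinates add up to exactly
   [(rho / kappa) ^ 2]. *)
pose h := rho / (kappa%:R * s).
have h0 : 0 < h by rewrite divr_gt0 // mulr_gt0.
have hrho : rho ^+ 2 = 8 * N%:R * kappa%:R ^+ 2 * h ^+ 2.
  by rewrite /h -s2; field; rewrite !gt_eqF.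
clearbody h.
pose part (b1 b2 : bool) (w : R[i]) := Num.max 0
  ((-1) ^+ b1 * (if b2 then complex.Re w else complex.Im w)).
have part0 b1 b2 w : 0 <= part b1 b2 w by rewrite /part le_max lexx.
have partle b1 b2 w : part b1 b2 w ^+ 2 <= normc w ^+ 2.
  rewrite sqr_normcE /part; set x := if _ then _ else _.
  have x2 : x ^+ 2 <= complex.Re w ^+ 2 + complex.Im w ^+ 2.
    by rewrite {}/x; case: b2; rewrite ?lerDl ?lerDr sqr_ge0.
  case: (leP 0 ((-1) ^+ b1 * x)) => _; last by rewrite expr0n addr_ge0 ?sqr_ge0.
  by rewrite exprMn sqrr_sign mul1r.
have C1 b1 b2 : codable Om (fun y y' => forall i, P i ->
    `|part b1 b2 (z y i) - part b1 b2 (z y' i)| <= h) (N + 5 * N * kappa)%:R.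
  apply: codable_nonneg => // y Oy.
  (* A weighted arithmetic-geometric inequality turns the bound on the sum of squares into a bound
     on the sum, here [9/2 * N * kappa * h]. *)
  have b (x : R) : x <= h / 2 * ((x / h) ^+ 2 / kappa%:R + kappa%:R).
    rewrite -subr_ge0 [X in 0 <= X](_ : _ = h / (2 * kappa%:R) * (x / h - kappa%:R) ^+ 2).
      by rewrite mulr_ge0 ?sqr_ge0 // divr_ge0 ?(ltW h0) // mulr_ge0 ?(ltW k0').
    by field; rewrite !gt_eqF.
  apply: (@le_trans _ _ (\sum_(i | P i)
     h / 2 * ((part b1 b2 (z y i) / h) ^+ 2 / kappa%:R + kappa%:R))).
    by apply: ler_sum => i _; exact: b.
  have S : \sum_(i | P i) (part b1 b2 (z y i) / h) ^+ 2 / kappa%:R <= 8 * N%:R * kappa%:R.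
    under eq_bigr do rewrite expr_div_n; rewrite -!mulr_suml.
    rewrite ler_pdivrMr // ler_pdivrMr ?exprn_gt0 //.
    have -> : 8 * N%:R * kappa%:R * kappa%:R * h ^+ 2 = rho ^+ 2 by rewrite hrho; ring.
    by apply: le_trans (Hz _ Oy); apply: ler_sum.
  rewrite -mulr_sumr big_split /= sumr_const -/N -[kappa%:R *+ N]mulr_natr !natrM.
  rewrite -mulrA ler_pM2l //.
  have : 0 < N%:R * kappa%:R :> R by rewrite mulr_gt0.
  lra.
have C2 := codable_and (addr_ge0 (ler0n _ _) (ler0n _ _)) (codable_and (ler0n _ _) (C1 false false) (C1 false true))
  (codable_and (ler0n _ _) (C1 true false) (C1 true true)).
apply: codable_mono C2 _ (fun _ => id) _.
  by rewrite -!natrD ler_nat -/N; lia.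
move=> y y' Oy Oy' [[H1 H2] [H3 H4]].
have dec (b2 : bool) w : (if b2 then complex.Re w else complex.Im w) =
    part false b2 w - part true b2 w.
  rewrite /part expr0 expr1 mul1r mulN1r; set x := if _ then _ else _.
  case: (leP 0 x) => x0; case: (leP 0 (- x)) => x1; lra.
have B (b2 : bool) i : P i -> `|part false b2 (z y i) - part false b2 (z y' i)| <= h ->
    `|part true b2 (z y i) - part true b2 (z y' i)| <= h ->
    (if b2 then complex.Re (z y i - z y' i) else complex.Im (z y i - z y' i)) ^+ 2
     <= 4 * h ^+ 2.
  move=> Pi; have := dec b2 (z y i); have := dec b2 (z y' i).
  rewrite ReD ReN ImD ImN !ler_norml; case: b2 => -> -> /andP[? ?] /andP[? ?]; nra.
apply: (@le_trans _ _ (\sum_(i | P i) 8 * h ^+ 2)).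
  apply: ler_sum => i Pi; rewrite sqr_normcE.
  have := B true i Pi (H2 _ Pi) (H4 _ Pi); have := B false i Pi (H1 _ Pi) (H3 _ Pi).
  by rewrite /=; lra.
rewrite sumr_const -/N -[_ *+ N]mulr_natr expr_div_n hrho.
by rewrite le_eqVlt; apply/orP; left; apply/eqP; field; rewrite gt_eqF.
Qed.

End Coding.

(** * Hilbert-Schmidt geometry of matrices *)

Section Spectral.
Context {R : realType}.

Lemma hermitian_spectral n (A : 'M[R[i]]_n) : A \is hermsymmx ->
  exists (P : 'M[R[i]]_n) (lam : 'I_n -> R), [/\ P *m P^t* = 1%:M, P^t* *m P = 1%:M
    & A = P^t* *m diag_mx (\row_k (lam k)%:C) *m P].
Proof.
move=> Ah; have An := hermitian_normalmx Ah.
have Pu := spectral_unitarymx A; set P := spectralmx A in Pu.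
have PP := unitarymxP Pu.
exists P, (fun k => complex.Re (spectral_diag A 0 k)); split=> //.
  exact: mulmx1C.
rewrite {1}(orthomx_spectralP An) -/P invmx_unitary //; congr (_ *m diag_mx _ *m _).
apply/rowP => k; rewrite mxE.
have /mxOverP /(_ 0 k) := hermitian_spectral_diag_real Ah.
by move/RRe_real => ->.
Qed.

Lemma hermitian_diag (I : finType) (a : I -> I -> R[i]) :
  (forall i j, a j i = (a i j)^*) ->
  exists (u : I -> I -> R[i]) (lam : I -> R),
  [/\ forall z w : I -> R[i], \sum_k (\sum_j u k j * z j) * (\sum_j u k j * w j)^*
                            = \sum_j z j * (w j)^*,
      forall (z : I -> R[i]) k, \sum_j u k j * (\sum_l a j l * z l)
                  = (lam k)%:C * \sum_j u k j * z j
    & forall k l, \sum_j u k j * (u l j)^* = (k == l)%:R].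
Proof.
move=> ah; pose A := \matrix_(i, j) a (enum_val i) (enum_val j) : 'M[R[i]]_(#|I|).
have sumI (F : I -> R[i]) : \sum_k F k = \sum_(k < #|I|) F (enum_val k).
  by rewrite -big_enum_val.
have Ah : A \is hermsymmx.
  apply/is_hermitianmxP; rewrite expr0 scale1r; apply/matrixP => i j.
  by rewrite !mxE ah.
have [P [lam [P1 P2 AE]]] := hermitian_spectral Ah.
pose col (z : I -> R[i]) := \col_j z (enum_val j) : 'cV[R[i]]_(#|I|).
have PE z k : \sum_j (P (enum_rank k) (enum_rank j) * z j) = (P *m col z) (enum_rank k) 0.
  by rewrite sumI mxE; apply: eq_bigr => j _; rewrite enum_valK !mxE.
have ipE n (v w : 'cV[R[i]]_n) : \sum_j v j 0 * (w j 0)^* = (w^t* *m v) 0 0.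
  by rewrite mxE; apply: eq_bigr => j _; rewrite !mxE mulrC.
exists (fun k j => P (enum_rank k) (enum_rank j)), (fun k => lam (enum_rank k)).
split=> [z w|z k|k l].
- rewrite !sumI; under eq_bigr do rewrite !PE enum_valK.
  rewrite (ipE _ (P *m col z)) trmx_mul map_mxM mulmxA -(mulmxA _ (P^t*) P) P2.
  by rewrite mulmx1 -ipE; apply: eq_bigr => j _; rewrite !mxE.
- rewrite !PE.
  have -> : col (fun j => \sum_l a j l * z l) = A *m col z.
    by apply/colP => j; rewrite !mxE sumI; apply: eq_bigr => l _; rewrite !mxE.
  rewrite AE !mulmxA P1 mul1mx -mulmxA mxE (bigD1 (enum_rank k)) //= big1.
    by rewrite addr0 !mxE eqxx mulr1n.
  by move=> j jk; rewrite !mxE eq_sym (negPf jk) mulr0n mul0r.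
- rewrite sumI -(inj_eq enum_rank_inj).
  rewrite (_ : _%:R = (P *m P^t*) (enum_rank k) (enum_rank l)); last by rewrite P1 mxE.
  by rewrite mxE; apply: eq_bigr => j _; rewrite enum_valK !mxE.
Qed.

End Spectral.

Section Frobenius.
Context {R : realType} {n : nat}.
Implicit Types A B : 'M[R[i]]_n.

(** The trace is not normalized, so a distance [e] for [mxnorm2] appears as [e * Num.sqrt n%:R]. *)
Definition fro : 'M[R[i]]_n -> 'M[R[i]]_n -> R[i] :=
  cform (fun (p : 'I_n * 'I_n) A => A p.1 p.2).

Lemma fro_psd : psd fro.
Proof. by apply: cform_psd => p c A B; rewrite !mxE. Qed.

Definition nF A : R := nr fro A.

Lemma nF_ge0 A : 0 <= nF A. Proof. exact: nr_ge0. Qed.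

Lemma sqr_nF A : nF A ^+ 2 = \sum_(p : 'I_n * 'I_n) normc (A p.1 p.2) ^+ 2.
Proof. by apply: sqr_nr_cform => p c B D; rewrite !mxE. Qed.

Lemma froE A B : fro A B = \tr (A *m B^t*).
Proof.
rewrite /mxtrace /fro /cform -(pair_big xpredT xpredT (fun i j => A i j * (B i j)^*)) /=.
apply: eq_bigr => i _.
by rewrite mxE; apply: eq_bigr => j _; rewrite !mxE.
Qed.

Lemma sqr_nFE A : nF A ^+ 2 = complex.Re (\tr (A *m A^t*)).
Proof. by rewrite -froE -sqr_nr //; exact: fro_psd. Qed.

Lemma nF_adj A : nF (A^t*) = nF A.
Proof.
apply/eqP; rewrite -(@eqrXn2 _ 2) ?nF_ge0 // !sqr_nFE trmxCK mxtrace_mulC.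
by [].
Qed.

Lemma nFD A B : nF (A + B) <= nF A + nF B. Proof. exact: nrD fro_psd A B. Qed.
Lemma nFN A : nF (- A) = nF A. Proof. exact: nrN fro_psd A. Qed.
Lemma nFB A B : nF (A - B) <= nF A + nF B. Proof. exact: nrB fro_psd A B. Qed.
Lemma nFZ c A : nF (c *: A) = normc c * nF A. Proof. exact: nrZ fro_psd c A. Qed.
Lemma nF0 : nF 0 = 0. Proof. exact: nr0 fro_psd. Qed.

(* The operator norm is measured on Hilbert-Schmidt operators, from both sides. *)
Definition opb A (c : R) := [/\ 0 <= c, forall B, nF (A *m B) <= c * nF B
  & forall B, nF (B *m A) <= c * nF B].

Lemma opb_le A c c' : c <= c' -> opb A c -> opb A c'.
Proof.
move=> cc' [c0 H1 H2]; split; first exact: le_trans cc'.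
  by move=> B; apply: le_trans (H1 B) _; rewrite ler_wpM2r ?nF_ge0.
by move=> B; apply: le_trans (H2 B) _; rewrite ler_wpM2r ?nF_ge0.
Qed.

Lemma opbM A B a b : opb A a -> opb B b -> opb (A *m B) (a * b).
Proof.
move=> [a0 A1 A2] [b0 B1 B2]; split=> [|D|D]; first exact: mulr_ge0.
  by rewrite -mulmxA (le_trans (A1 _)) // -mulrA ler_wpM2l.
by rewrite mulmxA (le_trans (B2 _)) // [a * b]mulrC -mulrA ler_wpM2l.
Qed.

Lemma opbD A B a b : opb A a -> opb B b -> opb (A + B) (a + b).
Proof.
move=> [a0 A1 A2] [b0 B1 B2]; split=> [|D|D]; first exact: addr_ge0.
  by rewrite mulmxDl mulrDl (le_trans (nFD _ _)) // lerD.
by rewrite mulmxDr mulrDl (le_trans (nFD _ _)) // lerD.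
Qed.

Lemma opbN A a : opb A a -> opb (- A) a.
Proof. by move=> [a0 A1 A2]; split=> // D; rewrite ?mulNmx ?mulmxN nFN. Qed.

Lemma opb1 : opb 1%:M 1.
Proof. by split=> // D; rewrite ?mulmx1 ?mul1mx mul1r. Qed.

Lemma opb_adj A a : opb A a -> opb (A^t*) a.
Proof.
move=> [a0 A1 A2]; split=> // D; rewrite -nF_adj trmx_mul map_mxM trmxCK.
  by rewrite (le_trans (A2 _)) // nF_adj.
by rewrite (le_trans (A1 _)) // nF_adj.
Qed.

Lemma nF_isol P B : P^t* *m P = 1%:M -> nF (P *m B) = nF B.
Proof.
move=> PP; apply/eqP; rewrite -(@eqrXn2 _ 2) ?nF_ge0 // !sqr_nFE mxtrace_mulC.
by rewrite trmx_mul map_mxM mulmxA -(mulmxA _ _ P) PP mulmx1 mxtrace_mulC.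
Qed.

Lemma opb_unitary P : P *m P^t* = 1%:M -> opb P 1.
Proof.
move=> PP; have PP' := mulmx1C PP; split=> // D; rewrite mul1r.
  by rewrite nF_isol.
by rewrite -nF_adj trmx_mul map_mxM nF_isol ?nF_adj // trmxCK.
Qed.

Lemma opb_diag (b : 'I_n -> R[i]) c : 0 <= c -> (forall i, normc (b i) <= c) ->
  opb (diag_mx (\row_i b i)) c.
Proof.
move=> c0 bc; split=> // D; rewrite -(@ler_pXn2r _ 2) ?nnegrE ?mulr_ge0 ?nF_ge0 //;
  rewrite exprMn !sqr_nF mulr_sumr; apply: ler_sum => p _;
  rewrite ?mul_diag_mx ?mul_mx_diag !mxE normcM exprMn ?[_ ^+ 2 * normc (b _) ^+ 2]mulrC;
  by rewrite ler_wpM2r ?sqr_ge0 // lerXn2r ?nnegrE ?normc_ge0.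
Qed.

Lemma sqr_nF_diag (b : 'I_n -> R[i]) :
  nF (diag_mx (\row_i b i)) ^+ 2 = \sum_i normc (b i) ^+ 2.
Proof.
rewrite sqr_nF -(pair_big xpredT xpredT (fun i j => normc (diag_mx (\row_i b i) i j) ^+ 2)) /=.
apply: eq_bigr => i _; rewrite (bigD1 i) //= big1.
  by rewrite addr0 !mxE eqxx.
by move=> j ji; rewrite !mxE eq_sym (negPf ji) mulr0n normc0 expr0n.
Qed.

End Frobenius.

(** * Entropy of a product of two small matrices *)

Section CodableProduct.
Context {R : realType}.

Lemma nat_above (a : R) : exists K : nat, (0 < K)%N /\ a <= K%:R.
Proof.
exists (Num.truncn a).+1; split=> //; exact: ltW (truncnS_gt _).
Qed.

(* The product [Z Delta] is determined up to a small error by the spectral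
   projection of [Z] on its few large eigenvalues. *)
Lemma codable_product (gamma E0 rho : R) : 0 < gamma -> 0 < E0 -> 0 < rho ->
  exists2 C : R, 0 <= C & forall (n p : nat) (Y : Type) (Om : set Y)
    (Z Delta : Y -> 'M[R[i]]_n), (0 < n)%N -> (0 < p)%N ->
  let eps := E0 / p%:R ^+ 4 * Num.sqrt n%:R in
  (forall y, Om y -> [/\ Z y \is hermsymmx, opb (Z y) rho & nF (Z y) <= eps]) ->
  (forall y, Om y -> opb (Delta y) rho /\ nF (Delta y) <= rho * eps) ->
  codable Om (fun y y' => nF (Z y *m Delta y - Z y' *m Delta y') <= gamma * eps / p%:R)
    (C * (n%:R ^+ 2 / p%:R + n%:R)).
Proof.
move=> g0 E00 r0.
have [K1 [K10 K1P]] := nat_above (4 * rho ^+ 2 / (gamma * E0)).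
have [K2 [K20 K2P]] := nat_above (4 * rho ^+ 2 / gamma).
exists (16 * rho ^+ 2 * E0 ^+ 2 / gamma ^+ 2 * (8 + 20 * K1%:R + 20 * K2%:R) + 1).
  by nneg.
move=> n p Y Om Z Delta n0 p0 eps HZ HD.
have n0' : 0 < n%:R :> R by rewrite ltr0n.
have p0' : 0 < p%:R :> R by rewrite ltr0n.
have p1 : 1 <= p%:R :> R by rewrite ler1n.
have sn0 : 0 < Num.sqrt n%:R :> R by rewrite sqrtr_gt0.
have sn2 : Num.sqrt n%:R ^+ 2 = n%:R :> R by rewrite sqr_sqrtr // ltW.
have eps0 : 0 < eps by rewrite /eps; gt0.
have /choice[PL PLP] (y : Y) : exists q : 'M[R[i]]_n * ('I_n -> R), Om y ->
    [/\ q.1 *m q.1^t* = 1%:M, q.1^t* *m q.1 = 1%:M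
      & Z y = q.1^t* *m diag_mx (\row_k (q.2 k)%:C) *m q.1].
  have [Oy|nOy] := pselect (Om y); last by exists (0, fun=> 0).
  have [Zh _ _] := HZ _ Oy.
  by have [P [lam H]] := hermitian_spectral Zh; exists (P, lam).
(* Dropping the eigenvalues of [Z] up to [theta] changes the product by at most [theta * rho * eps],
   one quarter of the allowed error. *)
pose theta := gamma / (4 * rho * p%:R).
have th0 : 0 < theta by rewrite /theta; gt0.
pose B y := [set k | theta < `|(PL y).2 k| ]%SET.
pose D1 y : 'M[R[i]]_n := diag_mx (\row_k (k \in B y)%:R).
pose DL y : 'M[R[i]]_n := diag_mx (\row_k ((PL y).2 k)%:C).
pose DS y : 'M[R[i]]_n := diag_mx (\row_k (if k \in B y then 0 else ((PL y).2 k)%:C)).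
(* The projection [D1] is inserted in both factors: [G] then has only the columns and [H] only the
   rows indexed by [B], so both have few entries. *)
pose G y := (PL y).1^t* *m D1 y.
pose H y := D1 y *m ((PL y).1 *m (Z y *m Delta y)).
pose S y := (PL y).1^t* *m DS y *m (PL y).1 *m Delta y.
have D1b y : opb (D1 y) 1.
  by apply: opb_diag => // i; case: (i \in B y); rewrite ?normc0 // normc1.
have PLb y : Om y -> opb (PL y).1 1.
  by move=> /PLP[PP _ _]; exact: opb_unitary.
have ZD y : Om y -> Z y *m Delta y = G y *m H y + S y.
  move=> Oy; have [PP PP' ZE] := PLP _ Oy.
  have PZ : (PL y).1 *m Z y = DL y *m (PL y).1.
    by rewrite ZE !mulmxA PP mul1mx.
  have DLE : DL y = D1 y *m (D1 y *m DL y) + DS y.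
    rewrite /D1 !mul_diag_mx; apply/matrixP => i j; rewrite !mxE.
    by case: (i \in B y); rewrite ?mul1r ?mul0r ?mul0rn ?addr0 ?add0r.
  rewrite /G /H /S [(PL y).1 *m _]mulmxA PZ {1}ZE -/(DL y) {1}DLE.
  by rewrite mulmxDr !mulmxDl !mulmxA.
have Hn y : Om y -> nF (H y) <= rho ^+ 2 * eps.
  move=> Oy; have [_ h1 _] := D1b y; have [_ h2 _] := PLb _ Oy.
  have [_ [_ h3 _] _] := HZ _ Oy; have [_ h4] := HD _ Oy.
  apply: le_trans (h1 _) _; rewrite mul1r; apply: le_trans (h2 _) _.
  rewrite mul1r; apply: le_trans (h3 _) _.
  by rewrite expr2 -mulrA ler_wpM2l // ltW.
have Hb y : Om y -> opb (H y) (rho ^+ 2).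
  move=> Oy; have [_ h3 _] := HZ _ Oy; have [h4 _] := HD _ Oy.
  by have := opbM (D1b y) (opbM (PLb _ Oy) (opbM h3 h4)); rewrite !mul1r expr2.
have Gb y : Om y -> opb (G y) 1.
  by move=> Oy; have := opbM (opb_adj (PLb _ Oy)) (D1b y); rewrite mul1r.
have Gn y : Om y -> nF (G y) <= Num.sqrt n%:R.
  move=> Oy; have [_ h1 _] := opb_adj (PLb _ Oy).
  apply: le_trans (h1 _) _; rewrite mul1r.
  rewrite -(@ler_pXn2r _ 2) ?nnegrE ?nF_ge0 ?sqrtr_ge0 // sn2 sqr_nF_diag.
  rewrite -[X in _ <= X%:R]card_ord -sum1_card natr_sum; apply: ler_sum => i _.
  by case: (i \in B y); rewrite ?normc0 ?normc1 ?expr0n ?expr1n.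
have Sn y : Om y -> nF (S y) <= gamma * eps / p%:R / 4.
  move=> Oy; have [_ h1 _] := opb_adj (PLb _ Oy); have [_ h2 _] := PLb _ Oy.
  have [_ h4] := HD _ Oy.
  have [_ h3 _] : opb (DS y) theta.
    apply: opb_diag => [|i]; first exact: ltW.
    case: ifPn => [_|]; first by rewrite normc0 ltW.
    by rewrite inE -leNgt => le; rewrite normcR.
  rewrite /S -!mulmxA; apply: le_trans (h1 _) _; rewrite mul1r.
  apply: le_trans (h3 _) _.
  apply: (@le_trans _ _ (theta * (rho * eps))).
    by rewrite ler_wpM2l ?(ltW th0) // (le_trans (h2 _)) // mul1r.
  rewrite /theta le_eqVlt; apply/orP; left; apply/eqP; field.
  by rewrite !gt_eqF.
have Bcard y : Om y -> #|B y|%:R * theta ^+ 2 <= eps ^+ 2.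
  move=> Oy; have [PP PP' ZE] := PLP _ Oy; have [_ _ Zn] := HZ _ Oy.
  have e : nF (Z y) ^+ 2 = \sum_k normc (((PL y).2 k)%:C) ^+ 2.
    rewrite -sqr_nF_diag ZE -/(DL y) -mulmxA nF_isol ?trmxCK //.
    by rewrite -nF_adj trmx_mul map_mxM nF_isol ?trmxCK ?nF_adj.
  apply: (@le_trans _ _ (nF (Z y) ^+ 2)); last by rewrite lerXn2r ?nnegrE ?nF_ge0 // ltW.
  rewrite e (bigID (mem (B y))) -[X in X <= _]addr0 lerD //; last first.
    by apply: sumr_ge0 => i _; exact: sqr_ge0.
  rewrite mulr_natl -sumr_const; apply: ler_sum => i.
  by rewrite inE => /ltW h; rewrite normcR lerXn2r ?nnegrE // ltW.
(* The positions of the large eigenvalues are coded first: 2^n subsets, of cost linear in [n],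
   negligible against n^2. *)
have C1 : codable Om (fun y y' => B y = B y') (n%:R : R).
  apply: (@codable_fin _ _ _ B) => //.
  by rewrite -cardsT -powersetT card_powerset cardsT card_ord natr_exp2_le.
(* [G] has norm up to [Num.sqrt n] and multiplies a bounded [H], so it must be resolved to order
   [eps / p], a ratio of order p^5. [H] already has norm of order [eps] and needs only the ratio
   p. *)
pose k1 := (K1 * p ^ 5)%N; pose k2 := (K2 * p)%N.
(* From [#|B| * theta ^ 2 <= eps ^ 2], an upper bound for the number [#|B| * n] of entries. The
   power p^6 pays for the ratio p^5 of [G] and leaves n^2 / p. *)
pose N := n%:R ^+ 2 * (16 * rho ^+ 2 * E0 ^+ 2 / gamma ^+ 2 / p%:R ^+ 6).
have N0 : 0 <= N.
  by rewrite /N; nneg.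
have NB y : Om y -> (#|B y| * n)%:R <= N.
  move=> Oy; rewrite natrM -ler_pdivlMr // -(ler_pM2r (exprn_gt0 2 th0)).
  apply: le_trans (Bcard _ Oy) _; rewrite /eps exprMn sn2 /N /theta le_eqVlt.
  by apply/orP; left; apply/eqP; field; rewrite !gt_eqF.
have GQ y q : q.2 \notin B y -> G y q.1 q.2 = 0.
  by move=> /negPf qB; rewrite /G mul_mx_diag !mxE qB mulr0.
have HQ y q : q.1 \notin B y -> H y q.1 q.2 = 0.
  by move=> /negPf qB; rewrite /H mul_diag_mx !mxE qB mul0r.
clearbody G H S B.
have C2 : codable Om (fun y y' => nF (Z y *m Delta y - Z y' *m Delta y')
    <= gamma * eps / p%:R) (n%:R + N * (8 + 20 * k1%:R + 20 * k2%:R)).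
  apply: codable_refine C1 _ => [|y0 Oy0].
    by nneg.
  pose Q := [pred q : 'I_n * 'I_n | q.2 \in B y0].
  pose Q' := [pred q : 'I_n * 'I_n | q.1 \in B y0].
  have cQ : #|Q| = (#|B y0| * n)%N.
    rewrite -[RHS](_ : #|[predX 'I_n & B y0]| = _); last by rewrite cardX card_ord mulnC.
    by apply: eq_card => q; rewrite !inE.
  have cQ' : #|Q'| = (#|B y0| * n)%N.
    rewrite -[RHS](_ : #|[predX B y0 & 'I_n]| = _); last by rewrite cardX card_ord.
    by apply: eq_card => q; rewrite !inE andbT.
  have sumQ (A : 'M[R[i]]_n) : (forall q, ~~ Q q -> A q.1 q.2 = 0) ->
      \sum_(q | Q q) normc (A q.1 q.2) ^+ 2 = nF A ^+ 2.
    move=> A0; rewrite sqr_nF [RHS](bigID Q) /= [X in _ + X]big1 ?addr0 //.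
    by move=> q /A0 ->; rewrite normc0 expr0n.
  have sumQ' (A : 'M[R[i]]_n) : (forall q, ~~ Q' q -> A q.1 q.2 = 0) ->
      \sum_(q | Q' q) normc (A q.1 q.2) ^+ 2 = nF A ^+ 2.
    move=> A0; rewrite sqr_nF [RHS](bigID Q') /= [X in _ + X]big1 ?addr0 //.
    by move=> q /A0 ->; rewrite normc0 expr0n.
  have subE (A1 A2 : 'M[R[i]]_n) i j : (A1 - A2) i j = A1 i j - A2 i j.
    by rewrite !mxE.
  have k10 : (0 < k1)%N by rewrite muln_gt0 K10 expn_gt0 p0.
  have k20 : (0 < k2)%N by rewrite muln_gt0 K20.
  pose Om' := [set y | Om y /\ B y0 = B y].
  have CG := @codable_vec R Y _ Q (fun y q => G y q.1 q.2) k1 (Num.sqrt n%:R) Om' sn0 k10.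
  have {}CG := CG (fun y Oy => ltac:(rewrite sumQ ?lerXn2r ?nnegrE ?nF_ge0 ?(ltW sn0) ?Gn //; [exact: Oy.1|move=> q; rewrite /= Oy.2; exact: GQ])).
  have re0 : 0 < rho ^+ 2 * eps by rewrite mulr_gt0 ?exprn_gt0.
  have CH := @codable_vec R Y _ Q' (fun y q => H y q.1 q.2) k2 (rho ^+ 2 * eps) Om' re0 k20.
  have {}CH := CH (fun y Oy => ltac:(rewrite sumQ' ?lerXn2r ?nnegrE ?nF_ge0 ?(ltW re0) ?Hn //; [exact: Oy.1|move=> q; rewrite /= Oy.2; exact: HQ])).
  apply: codable_mono (codable_and (ler0n _ _) CG CH) _ (fun _ => id) _.
    have b := NB _ Oy0; rewrite cQ cQ' -natrD -mulnDr natrM.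
    have -> : 8 + 20 * k1%:R + 20 * k2%:R = (4 + 20 * k1 + (4 + 20 * k2))%:R :> R.
      by rewrite !natrD !natrM; ring.
    by rewrite ler_wpM2r ?ler0n.
  move=> y y' [Oy ey] [Oy' ey'] [].
  have -> : \sum_(q | Q q) normc (G y q.1 q.2 - G y' q.1 q.2) ^+ 2 = nF (G y - G y') ^+ 2.
    rewrite -sumQ => [|q Qq]; first by apply: eq_bigr => q _; rewrite subE.
    by rewrite subE (GQ y) ?(GQ y') ?subrr -?ey -?ey'.
  have -> : \sum_(q | Q' q) normc (H y q.1 q.2 - H y' q.1 q.2) ^+ 2 = nF (H y - H y') ^+ 2.
    rewrite -sumQ' => [|q Qq]; first by apply: eq_bigr => q _; rewrite subE.
    by rewrite subE (HQ y) ?(HQ y') ?subrr -?ey -?ey'.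
  rewrite !ler_pXn2r ?nnegrE ?nF_ge0 ?divr_ge0 ?ler0n ?(ltW sn0) ?(ltW re0) // => lG lH.
  rewrite !ZD //.
  have -> : G y *m H y + S y - (G y' *m H y' + S y') =
     (G y - G y') *m H y + G y' *m (H y - H y') + (S y - S y').
    rewrite (_ : (G y - G y') *m H y + G y' *m (H y - H y') = G y *m H y - G y' *m H y').
      by rewrite opprD addrACA.
    by rewrite mulmxBl mulmxBr addrA subrK.
  have [_ _ b1] := Hb _ Oy; have [_ b2 _] := Gb _ Oy'.
  have {}b1 := b1 (G y - G y'); have {}b2 := b2 (H y - H y').
  have b3 := nFB (S y) (S y'); have b4 := Sn _ Oy; have b5 := Sn _ Oy'.
  have t := le_trans (nFD _ _) (lerD (nFD ((G y - G y') *m H y) (G y' *m (H y - H y'))) (lexx (nF (S y - S y')))).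
  apply: le_trans t _.
  have e1 : rho ^+ 2 * nF (G y - G y') <= gamma * eps / p%:R / 4.
    apply: (@le_trans _ _ (rho ^+ 2 * (Num.sqrt n%:R / k1%:R))).
      by rewrite ler_wpM2l // sqr_ge0.
    rewrite mulrA ler_pdivrMr ?ltr0n // /eps /k1 natrM natrX.
    rewrite [leRHS](_ : _ = gamma * E0 * K1%:R / 4 * Num.sqrt n%:R); last first.
      by field; rewrite gt_eqF.
    rewrite ler_wpM2r ?(ltW sn0) //; move: K1P; rewrite ler_pdivrMr; [lra|gt0].
  have e2 : nF (H y - H y') <= gamma * eps / p%:R / 4.
    apply: le_trans lH _; rewrite ler_pdivrMr ?ltr0n // /k2 natrM.
    rewrite [leRHS](_ : _ = gamma * K2%:R / 4 * eps); last by field; rewrite gt_eqF.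
    rewrite ler_wpM2r ?(ltW eps0) //; move: K2P; rewrite ler_pdivrMr //; lra.
  lra.
apply: codable_mono C2 _ (fun _ => id) (fun _ _ _ _ => id).
set c := 16 * rho ^+ 2 * E0 ^+ 2 / gamma ^+ 2.
have c0 : 0 <= c by rewrite /c; nneg.
have q0 : 0 <= n%:R ^+ 2 * c / p%:R by nneg.
have pow k : N * p%:R ^+ k <= n%:R ^+ 2 * c / p%:R * p%:R ^+ k / p%:R ^+ 5.
  rewrite le_eqVlt; apply/orP; left; apply/eqP; rewrite /N -/c; field; rewrite gt_eqF //.
have le5 k : (k <= 5)%N -> N * p%:R ^+ k <= n%:R ^+ 2 * c / p%:R.
  move=> k5; apply: le_trans (pow k) _; rewrite ler_pdivrMr ?exprn_gt0 //.
  by rewrite ler_wpM2l // ler_weXn2l.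
have := le5 0%N isT; have := le5 1%N isT; have := le5 5%N isT.
rewrite expr0 expr1 mulr1 /k1 /k2 (natrM _ K1) natrX (natrM _ K2) => l5 l1 l0.
have K1n : 0 <= K1%:R :> R by []; have K2n : 0 <= K2%:R :> R by [].
have m5 := ler_wpM2l K1n l5; have m1 := ler_wpM2l K2n l1.
have r1 : 0 <= n%:R ^+ 2 / p%:R :> R by nneg.
have r2 : 0 <= c * (8 + 20 * K1%:R + 20 * K2%:R) * n%:R by nneg.
rewrite [leLHS](_ : _ = n%:R + 8 * N + 20 * (K1%:R * (N * p%:R ^+ 5)) + 20 * (K2%:R * (N * p%:R)));
  last by ring.
rewrite [leRHS](_ : _ = n%:R + 8 * (n%:R ^+ 2 * c / p%:R) + 20 * (K1%:R * (n%:R ^+ 2 * c / p%:R))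
  + 20 * (K2%:R * (n%:R ^+ 2 * c / p%:R)) + n%:R ^+ 2 / p%:R
  + c * (8 + 20 * K1%:R + 20 * K2%:R) * n%:R); last by ring.
lra.
Qed.

End CodableProduct.

(** * Taylor remainders of words *)

Section Words.
Context {R : realType} {d n : nat}.
Implicit Types (X Y Z : 'I_d -> 'M[R[i]]_n) (w : seq 'I_d).

Definition mw X w : 'M[R[i]]_n := wordeval (fun A B => A *m B) 1%:M X w.

Arguments mw : simpl never.

Lemma mw0 X : mw X [::] = 1%:M.
Proof. by []. Qed.

Lemma mw_cons X j w : mw X (j :: w) = X j *m mw X w.
Proof. by []. Qed.

Lemma mw_cat X v w : mw X (v ++ w) = mw X v *m mw X w.
Proof.
elim: v => [|j v IH]; first by rewrite mw0 mul1mx.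
by rewrite cat_cons !mw_cons IH mulmxA.
Qed.

Lemma mw_rev_adj X w : (forall j, (X j)^t* = X j) -> (mw X w)^t* = mw X (rev w).
Proof.
move=> Xh; elim: w => [|j w IH]; first by rewrite mw0 trmx1 map_mx1.
rewrite mw_cons rev_cons -cats1 mw_cat trmx_mul map_mxM IH Xh.
by rewrite mw_cons mw0 mulmx1.
Qed.

Lemma opb_mw X w rho : (forall j, opb (X j) rho) -> opb (mw X w) (rho ^+ size w).
Proof.
move=> Xb; elim: w => [|j w IH]; first exact: opb1.
by rewrite mw_cons exprS; apply: opbM.
Qed.

Lemma nF_mwB X Y w rho e : 1 <= rho -> 0 <= e -> (forall j, opb (X j) rho) ->
  (forall j, opb (Y j) rho) -> (forall j, nF (Y j - X j) <= e) ->
  nF (mw Y w - mw X w) <= (size w)%:R * rho ^+ size w * e.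
Proof.
move=> r1 e0 Xb Yb Ye; have r0 : 0 <= rho by exact: le_trans ler01 r1.
elim: w => [|j w IH]; first by rewrite subrr nF0 !mul0r.
rewrite !mw_cons (_ : _ - _ = (Y j - X j) *m mw Y w + X j *m (mw Y w - mw X w)); last first.
  by rewrite mulmxBl mulmxBr addrA subrK.
have [_ _ b1] := opb_mw w Yb; have [_ b2 _] := Xb j.
have h1 : nF ((Y j - X j) *m mw Y w) <= rho ^+ (size w).+1 * e.
  apply: le_trans (b1 _) _; apply: ler_pM; rewrite ?exprn_ge0 ?nF_ge0 //.
  by rewrite exprS ler_peMl // exprn_ge0.
have h2 := le_trans (b2 _) (ler_wpM2l r0 IH).
apply: le_trans (nFD _ _) (le_trans (lerD h1 h2) _).
by rewrite /= -natr1 exprS le_eqVlt; apply/orP; left; apply/eqP; ring.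
Qed.

(** The derivative at [X] in the direction [Z] of evaluation on [w]. The recursion suits
    [remw_cons]; [dwE] is the form given by free difference quotients. *)
Fixpoint dw X Z w : 'M[R[i]]_n :=
  if w is j :: w' then Z j *m mw X w' + X j *m dw X Z w' else 0.

Definition remw X Y w := mw Y w - mw X w - dw X (fun j => Y j - X j) w.

(** The new term is a self-adjoint small factor times another small factor (for self-adjoint
    tuples), which is the situation of [codable_product]; the old remainder is only multiplied by a
    bounded matrix. *)
Lemma remw_cons X Y j w : remw X Y (j :: w) =
  (Y j - X j) *m (mw Y w - mw X w) + X j *m remw X Y w.
Proof.
rewrite /remw !mw_cons /=; set D := dw _ _ _.
rewrite !(mulmxBr, mulmxBl).
move: (Y j *m mw Y w) (Y j *m mw X w) (X j *m mw X w) (X j *m mw Y w) (X j *m D).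
by move=> p1 p2 p3 p4 p5; apply/matrixP => i k; rewrite !mxE; ring.
Qed.

Lemma dwE X Z w : dw X Z w = \sum_(a < size w)
   mw X (take a w) *m Z (tnth (in_tuple w) a) *m mw X (drop a.+1 w).
Proof.
elim: w => [|j w IH]; first by rewrite big_ord0.
rewrite big_ord_recl (_ : dw X Z (j :: w) = Z j *m mw X w + X j *m dw X Z w) //.
congr (_ + _); first by rewrite /= drop0 mw0 mul1mx.
rewrite IH mulmx_sumr; apply: eq_bigr => a _.
by rewrite !(tnth_nth j) lift0 /= mw_cons -!mulmxA.
Qed.

End Words.

Lemma hermsymmxP (R : realType) n (A : 'M[R[i]]_n) : A \is hermsymmx <-> A^t* = A.
Proof.
split=> [/is_hermitianmxP|e]; first by rewrite expr0 scale1r => {2}->.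
by apply/is_hermitianmxP; rewrite expr0 scale1r e.
Qed.

Section CodableRemainder.
Context {R : realType} {d : nat}.
Implicit Types (w : seq 'I_d).

(* The k-th scale is indexed by [p = 2 ^ k]: distances are [E0 / p ^ 4] in the
   normalized norm, and errors are smaller by a factor of the order of [1 / p]. *)
Definition near_tuples (E0 rho : R) n p (Y : Type) (Om : set Y)
    (X : 'I_d -> 'M[R[i]]_n) (F : Y -> 'I_d -> 'M[R[i]]_n) :=
  [/\ (0 < n)%N, (0 < p)%N,
      forall j, (X j)^t* = X j /\ opb (X j) rho &
      forall y j, Om y -> [/\ (F y j)^t* = F y j, opb (F y j) rho
        & nF (F y j - X j) <= E0 / p%:R ^+ 4 * Num.sqrt n%:R]].

Definition small_at_scale (E0 gamma : R) n p := gamma * (E0 / p%:R ^+ 4 * Num.sqrt n%:R) / p%:R.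

(** [C] may depend on the precision [gamma] but not on [n], [p] or [Om]. Sums and bounded left
    factors are then absorbed by rescaling [gamma]. *)
Definition codable_at_all_scales (E0 rho : R)
    (A : forall n, ('I_d -> 'M[R[i]]_n) -> ('I_d -> 'M[R[i]]_n) -> 'M[R[i]]_n) :=
  forall gamma, 0 < gamma -> exists2 C : R, 0 <= C &
  forall n p (Y : Type) (Om : set Y) X F, @near_tuples E0 rho n p Y Om X F ->
  codable Om (fun y y' => nF (A n X (F y) - A n X (F y')) <= small_at_scale E0 gamma n p)
     (C * (n%:R ^+ 2 / p%:R + n%:R)).

Variables (E0 rho : R) (E00 : 0 < E0) (rho1 : 1 <= rho).

Lemma smallyD g g' n p : small_at_scale E0 g n p + small_at_scale E0 g' n p = small_at_scale E0 (g + g') n p.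
Proof. by rewrite /small_at_scale -mulrDl -mulrDl. Qed.

Lemma smallyM c g n p : c * small_at_scale E0 g n p = small_at_scale E0 (c * g) n p.
Proof. by rewrite /small_at_scale !mulrA. Qed.

Lemma smally_le g g' n p : g <= g' -> small_at_scale E0 g n p <= small_at_scale E0 g' n p.
Proof.
move=> gg'; rewrite /small_at_scale ler_wpM2r ?invr_ge0 // ler_wpM2r //.
have E0' := ltW E00; nneg.
Qed.

Lemma smally_ge0 g n p : 0 <= g -> 0 <= small_at_scale E0 g n p.
Proof. by move=> g0; rewrite -[leLHS](_ : small_at_scale E0 0 n p = 0) ?smally_le // /small_at_scale !mul0r. Qed.

Lemma codable_sum A B : codable_at_all_scales E0 rho A ->
  codable_at_all_scales E0 rho B ->
  codable_at_all_scales E0 rho (fun n X Y => A n X Y + B n X Y).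
Proof.
move=> HA HB g g0; have g2 : 0 < g / 2 by gt0.
have [C C0 {}HA] := HA _ g2; have [C' C'0 {}HB] := HB _ g2.
exists (C + C') => [|n p Y Om X F H]; first exact: addr_ge0.
have k0 : 0 <= C' * (n%:R ^+ 2 / p%:R + n%:R) by nneg.
apply: codable_mono (codable_and k0 (HA n p Y Om X F H) (HB n p Y Om X F H)) _ (fun _ => id) _.
  by rewrite -mulrDl.
move=> y y' Oy Oy' [h1 h2].
rewrite opprD addrACA; apply: le_trans (nFD _ _) _.
apply: le_trans (lerD h1 h2) _.
by rewrite smallyD -splitr.
Qed.

Lemma codable_lmul A (G : forall n, ('I_d -> 'M[R[i]]_n) -> 'M[R[i]]_n) c :
  (forall n X, (forall j, opb (X j) rho) -> opb (G n X) c) -> 0 < c ->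
  codable_at_all_scales E0 rho A ->
  codable_at_all_scales E0 rho (fun n X Y => G n X *m A n X Y).
Proof.
move=> Gc c0 HA g g0; have g2 : 0 < g / c by gt0.
have [C C0 {}HA] := HA _ g2; exists C => // n p Y Om X F H.
apply: codable_mono (HA n p Y Om X F H) (lexx _) (fun _ => id) _.
move=> y y' Oy Oy' h; rewrite -mulmxBr.
have [_ _ HX _] := H.
have [_ b _] := Gc n X (fun j => proj2 (HX j)).
apply: le_trans (b _) _; apply: (@le_trans _ _ (c * small_at_scale E0 (g / c) n p)).
  by rewrite ler_wpM2l // ltW.
by rewrite smallyM mulrCA divff ?gt_eqF // mulr1.
Qed.

Lemma codable_const0 : codable_at_all_scales E0 rho (fun n _ _ => 0).
Proof.
move=> g g0; exists 0 => // n p Y Om X F H; rewrite mul0r.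
by apply: codable_triv => // y y' _ _; rewrite subr0 nF0 smally_ge0 // ltW.
Qed.

Lemma codable_ext A B : (forall n X Y, A n X Y = B n X Y) ->
  codable_at_all_scales E0 rho A -> codable_at_all_scales E0 rho B.
Proof.
move=> AB HA g g0; have [C C0 {}HA] := HA _ g0; exists C => // n p Y Om X F H.
by apply: codable_mono (HA n p Y Om X F H) (lexx _) (fun _ => id) _ => y y' _ _; rewrite !AB.
Qed.

Lemma codable_remw w : codable_at_all_scales E0 rho (fun n X Y => remw X Y w).
Proof.
have r0 : 0 < rho by exact: lt_le_trans ltr01 rho1.
elim: w => [|j w IH].
  apply: codable_ext codable_const0 => n X Y.
  by rewrite /remw !mw0 /= !subrr.
apply: codable_ext (fun n X Y => esym (remw_cons X Y j w)) _.
apply: codable_sum; last by apply: codable_lmul r0 IH => n X; exact.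
move=> g g0.
(* One constant dominating the norm of [Y j - X j], the norm of the difference of words, and the
   Lipschitz constant of the word [w]. *)
pose rho' := 2 * rho ^+ (size w).+1 * (size w).+1%:R.
have rp k : 1 <= rho ^+ k by rewrite exprn_ege1.
have s1 : 1 <= (size w).+1%:R :> R by rewrite ler1n.
have r'0 : 0 < rho' by rewrite /rho'; gt0.
have b1 : 2 * rho <= rho'.
  by rewrite /rho' exprS -!mulrA ler_pM2l // ler_peMr ?(ltW r0) // mulr_ege1.
have b2 : 2 * rho ^+ size w <= rho'.
  by rewrite /rho' -mulrA ler_pM2l // exprSr -mulrA ler_peMr ?exprn_ge0 ?(ltW r0) // mulr_ege1.
have b3 : (size w)%:R * rho ^+ size w <= rho'.
  rewrite mulrC /rho'; apply: ler_pM => //; rewrite ?exprn_ge0 ?(ltW r0) ?ler_nat //.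
  by rewrite exprSr; have := rp (size w); move: rho1; nra.
have [C C0 H] := codable_product g0 E00 r'0; exists C => // n p Y Om X F [n0 p0 HX HF].
apply: codable_mono (H n p Y Om (fun y => F y j - X j)
   (fun y => mw (F y) w - mw X w) n0 p0 _ _) (lexx _) (fun _ => id) _ => //.
  move=> y Oy; have [Fh Fb Fe] := HF y j Oy; have [Xh Xb] := HX j; split=> //.
    by apply/hermsymmxP; rewrite linearB map_mxB /= Fh Xh.
  by apply: opb_le b1 _; rewrite mulr_natl; apply: opbD => //; exact: opbN.
move=> y Oy; have Xb i : opb (X i) rho by have [] := HX i.
have Fb i : opb (F y i) rho by have [] := HF y i Oy.
split.
  apply: opb_le b2 _; rewrite mulr_natl; apply: opbD; first exact: opb_mw.
  by apply: opbN; exact: opb_mw.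
have e0 : 0 <= E0 / p%:R ^+ 4 * Num.sqrt n%:R by have E0' := ltW E00; nneg.
have Fe i : nF (F y i - X i) <= E0 / p%:R ^+ 4 * Num.sqrt n%:R by have [] := HF y i Oy.
apply: le_trans (nF_mwB w rho1 e0 Xb Fb Fe) _.
by rewrite ler_wpM2r.
Qed.

End CodableRemainder.

(** * Matrices of tensors acting on bimodules *)

Section TensorPoly.
Context {R : realType} {d : nat}.

(* The list of the terms c * (v (x) w), each stored as (c, (v, w)). *)
Definition tpoly := seq (R[i] * (seq 'I_d * seq 'I_d)).

(** The second legs are multiplied in the reverse order, as in the opposite algebra. *)
Definition tmul (S T : tpoly) : tpoly :=
  [seq (p.1 * q.1, (p.2.1 ++ q.2.1, q.2.2 ++ p.2.2)) | p <- S, q <- T].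

Definition tstar (T : tpoly) : tpoly :=
  [seq (p.1^*, (rev p.2.1, rev p.2.2)) | p <- T].

Definition tscale (c : R[i]) (T : tpoly) : tpoly := [seq (c * p.1, p.2) | p <- T].

Definition ttr (phi : seq 'I_d -> R[i]) (T : tpoly) : R[i] :=
  \sum_(p <- T) p.1 * (phi p.2.1 * phi p.2.2).

Definition tmx := 'I_d -> 'I_d -> tpoly.

Definition tmx1 : tmx := fun j k => if j == k then [:: (1, ([::], [::]))] else [::].

Definition tmx_mul (S T : tmx) : tmx :=
  fun j k => flatten [seq tmul (S j l) (T l k) | l <- enum 'I_d].

Definition tmx_gram (I : Type) (rows : seq I) (D : I -> 'I_d -> tpoly) : tmx :=
  fun j k => flatten [seq tmul (tstar (D l j)) (D l k) | l <- rows].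

(* 1 - T / L *)
Definition tmx_compl (L : R) (T : tmx) : tmx :=
  fun j k => tmx1 j k ++ tscale (- L^-1%:C) (T j k).

Fixpoint tmx_pow (T : tmx) (N : nat) : tmx :=
  if N is N'.+1 then tmx_mul T (tmx_pow T N') else tmx1.

(** There are two models: left and right multiplication on matrices by words in a microstate
    ([actX_bimodule]), and words in [x] acting on the tensor product Hilbert space
    ([actK_bimodule]). The same symbolic matrix of tensors thus gives D_f^* D_f on both sides. *)
Record bimodule_action (V : lmodType R[i]) (f : V -> V -> R[i])
    (act : seq 'I_d -> seq 'I_d -> V -> V) : Prop := BimoduleAction {
  bact_psd : psd f;
  bact_lin : forall a b, linear (act a b);
  bact1 : forall v, act [::] [::] v = v;
  bactM : forall a b a' b' v, act (a ++ a') (b' ++ b) v = act a b (act a' b' v);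
  bact_adj : forall a b u v, f (act a b u) v = f u (act (rev a) (rev b) v) }.

Definition vip (V : lmodType R[i]) (f : V -> V -> R[i]) (u v : 'I_d -> V) :=
  \sum_j f (u j) (v j).

Lemma vip_psd (V : lmodType R[i]) (f : V -> V -> R[i]) : psd f -> psd (vip f).
Proof.
move=> Hf; split=> [c u v w|u v|u].
- by rewrite mulr_sumr -big_split; apply: eq_bigr => j _; exact: psd_lin Hf _ _ _ _.
- by rewrite rmorph_sum; apply: eq_bigr => j _; exact: psd_herm Hf _ _.
- by apply: sumr_ge0 => j _; exact: psd_ge0.
Qed.

Section Action.
Variables (V : lmodType R[i]) (f : V -> V -> R[i]).
Variable act : seq 'I_d -> seq 'I_d -> V -> V.
Hypothesis Hact : bimodule_action f act.
Let Hf := bact_psd Hact.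

Definition tev (T : tpoly) (v : V) : V := \sum_(p <- T) p.1 *: act p.2.1 p.2.2 v.

Lemma act_sum a b I (s : seq I) (F : I -> V) :
  act a b (\sum_(i <- s) F i) = \sum_(i <- s) act a b (F i).
Proof. exact/lin_sum/(bact_lin Hact). Qed.

Lemma actZ a b c v : act a b (c *: v) = c *: act a b v.
Proof. exact/linZ/(bact_lin Hact). Qed.

Lemma tev_cat S T v : tev (S ++ T) v = tev S v + tev T v.
Proof. exact: big_cat. Qed.

Lemma tev_flatten (s : seq tpoly) v : tev (flatten s) v = \sum_(T <- s) tev T v.
Proof.
elim: s => [|T s IH]; first by rewrite /tev !big_nil.
by rewrite /= tev_cat IH big_cons.
Qed.

Lemma tev_linear T : linear (tev T).
Proof.
move=> c u v; rewrite /tev scaler_sumr -big_split; apply: eq_bigr => p _.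
by rewrite (bact_lin Hact) scalerDr !scalerA mulrC.
Qed.

Lemma tev_sum T I (s : seq I) (F : I -> V) :
  tev T (\sum_(i <- s) F i) = \sum_(i <- s) tev T (F i).
Proof.
rewrite /tev exchange_big; apply: eq_bigr => p _.
by rewrite act_sum scaler_sumr.
Qed.

Lemma tev_mul S T v : tev (tmul S T) v = tev S (tev T v).
Proof.
rewrite /tev /tmul big_allpairs_dep; apply: eq_bigr => p _.
rewrite act_sum scaler_sumr; apply: eq_bigr => q _ /=.
by rewrite (bactM Hact) actZ scalerA.
Qed.

Lemma tev_scale c T v : tev (tscale c T) v = c *: tev T v.
Proof.
by rewrite /tev /tscale big_map scaler_sumr; apply: eq_bigr => p _; rewrite scalerA.
Qed.

Lemma tev_star T u v : f (tev T u) v = f u (tev (tstar T) v).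
Proof.
rewrite /tev /tstar big_map psd_suml // psd_sumr //; apply: eq_bigr => p _.
by rewrite psdZl // psdZr // conjCK (bact_adj Hact).
Qed.

Definition mev (M : tmx) (u : 'I_d -> V) : 'I_d -> V :=
  fun j => \sum_k tev (M j k) (u k).

Lemma mev_linear M : linear (mev M).
Proof.
move=> c u v; apply/funext => j; rewrite /mev !fctE scaler_sumr -big_split.
by apply: eq_bigr => k _; exact: tev_linear.
Qed.

Lemma mev1 u : mev tmx1 u = u.
Proof.
apply/funext => j; rewrite /mev (bigD1 j) //= big1 => [|k kj].
  by rewrite addr0 /tmx1 eqxx /tev big_seq1 scale1r (bact1 Hact).
by rewrite /tmx1 eq_sym (negPf kj) /tev big_nil.
Qed.

Lemma mev_mul S T u : mev (tmx_mul S T) u = mev S (mev T u).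
Proof.
apply/funext => j; rewrite /mev /tmx_mul.
under eq_bigr do rewrite tev_flatten big_map big_enum /=.
rewrite exchange_big; apply: eq_bigr => l _; rewrite tev_sum.
by apply: eq_bigr => k _; rewrite tev_mul.
Qed.

Lemma mev_pow T N u : mev (tmx_pow T N) u = iter N (mev T) u.
Proof. by elim: N => [|N IH] /=; rewrite ?mev1 // mev_mul IH. Qed.

Lemma mev_compl L T u : mev (tmx_compl L T) u = u - L^-1%:C *: mev T u.
Proof.
rewrite -{2}(mev1 u); apply/funext => j; rewrite /mev !fctE scaler_sumr -sumrB.
by apply: eq_bigr => k _; rewrite /tmx_compl tev_cat tev_scale scaleNr.
Qed.

Definition gradient (I : Type) (D : I -> 'I_d -> tpoly) (u : 'I_d -> V) (l : I) : V :=
  \sum_j tev (D l j) (u j).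

Lemma mev_gram I (rows : seq I) D u v : vip f (mev (tmx_gram rows D) u) v =
  \sum_(l <- rows) f (gradient D u l) (gradient D v l).
Proof.
rewrite /vip /mev /tmx_gram; under eq_bigr => j _ do rewrite psd_suml //.
under eq_bigr => j _ do under eq_bigr => k _ do
  rewrite tev_flatten big_map psd_suml //.
under eq_bigr => j _ do rewrite exchange_big.
rewrite exchange_big; apply: eq_bigr => l _.
rewrite /gradient psd_sumr //; apply: eq_bigr => j _.
rewrite psd_suml //; apply: eq_bigr => k _; rewrite tev_mul.
rewrite (psd_herm Hf) [RHS](psd_herm Hf) [in RHS]tev_star.
by [].
Qed.

End Action.
End TensorPoly.

(** * Small eigenvalues and nearly optimal unitary conjugates *)

Section PositiveOperators.
Context {R : realType} (V : lmodType R[i]) (f : V -> V -> R[i]) (Hf : psd f).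

(** Polarization: the quadratic form is real at [u + c *: v], and [c = 1], [c = 'i] give the real
    and imaginary parts of the identity. *)
Lemma pos_symmetric (S : V -> V) : linear S -> (forall u, 0 <= f (S u) u) ->
  forall u v, f (S u) v = f u (S v).
Proof.
move=> Sl Sp u v.
have im w : complex.Im (f (S w) w) = 0.
  by have := Sp w; rewrite lecE => /andP[/eqP].
rewrite (psd_herm Hf (S v) u).
have e c : complex.Im (c^* * f (S u) v + c * f (S v) u) = 0.
  have E : f (S (u + c *: v)) (u + c *: v) =
      f (S u) u + (c^* * f (S u) v + c * f (S v) u) + (c * c^*) * f (S v) v.
    by rewrite (linD Sl) (linZ Sl) !(psdDl Hf) !(psdDr Hf) !(psdZl Hf) !(psdZr Hf); ring.
  have := im (u + c *: v); rewrite E mul_conjE ImD (ImD (f (S u) u)) im add0r.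
  by rewrite Im_mul im mulr0 /= mul0r !addr0.
have := e 1; have := e 'i%C.
rewrite !ImD !Im_mul !conjE /= => h1 h2; apply: complex_ext => /=; lra.
Qed.

Variables (S : V -> V) (Sl : linear S) (Sp : forall u, 0 <= f (S u) u).

Let g u v := f (S u) v.

Lemma pos_form_psd : psd g.
Proof.
split=> [c u v w|u v|u]; last exact: Sp.
  by rewrite /g Sl psd_lin.
by rewrite /g (pos_symmetric Sl Sp) (psd_herm Hf).
Qed.

(** Cauchy-Schwarz for the form [g], applied to [u] and [S u], gives |S u|^4 <= g(u, u) g(S u, S u).
    The predicate [W] stands for an invariant subspace, later a spectral one. *)
Lemma pos_nr_le (W : V -> Prop) b : (forall u, W u -> W (S u)) -> 0 <= b ->
  (forall u, W u -> complex.Re (f (S u) u) <= b * nr f u ^+ 2) ->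
  forall u, W u -> nr f (S u) <= b * nr f u.
Proof.
move=> WS b0 Sb u Wu.
have [Su0|Su0] := eqVneq (nr f (S u)) 0; first by rewrite Su0 mulr_ge0 ?nr_ge0.
have Sup : 0 < nr f (S u) by rewrite lt_def Su0 nr_ge0.
have h : (nr f (S u) ^+ 2) ^+ 2 <= (b * nr f u ^+ 2) * (b * nr f (S u) ^+ 2).
  have -> : nr f (S u) ^+ 2 = complex.Re (g u (S u)) by rewrite sqr_nr.
  have := le_trans (Re_le_normc _) (psd_CS pos_form_psd u (S u)).
  rewrite -(@ler_pXn2r _ 2) ?nnegrE ?mulr_ge0 ?nr_ge0 //; last first.
    by rewrite -[complex.Re _]sqr_nr // sqr_ge0.
  move/le_trans; apply; rewrite exprMn !(sqr_nr pos_form_psd) -[complex.Re (f (S u) (S u))](sqr_nr Hf).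
  apply: ler_pM; rewrite ?Re_psd_ge0 //; try exact: pos_form_psd.
    exact: Sb.
  by apply: Sb; exact: WS.
rewrite -(@ler_pXn2r _ 2) ?nnegrE ?mulr_ge0 ?nr_ge0 //.
have s0 : 0 < nr f (S u) ^+ 2 by rewrite exprn_gt0.
rewrite -(ler_pM2r s0) exprMn; move: h; rewrite [(_ ^+ 2) ^+ 2]expr2.
by move/le_trans; apply; rewrite le_eqVlt; apply/orP; left; apply/eqP; ring.
Qed.

Lemma pos_nr_ge (W : V -> Prop) b : 0 <= b ->
  (forall u, W u -> b * nr f u ^+ 2 <= complex.Re (f (S u) u)) ->
  forall u, W u -> b * nr f u <= nr f (S u).
Proof.
move=> b0 Sb u Wu; have [u0|u0] := eqVneq (nr f u) 0; first by rewrite u0 mulr0 nr_ge0.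
have up : 0 < nr f u by rewrite lt_def u0 nr_ge0.
rewrite -(ler_pM2r up) -mulrA -expr2; apply: le_trans (Sb _ Wu) _.
exact: le_trans (Re_le_normc _) (psd_CS Hf _ _).
Qed.

(** By symmetry half of the iterates move to the other argument, leaving the form of the identity
    ([N] even) or of [S] ([N] odd) at [iter N./2 S u]. *)
Lemma pos_iter_form (W : V -> Prop) b : (forall u, W u -> W (S u)) -> 0 <= b ->
  (forall u, W u -> complex.Re (f (S u) u) <= b * nr f u ^+ 2) ->
  forall N u, W u -> 0 <= f (iter N S u) u
     /\ complex.Re (f (iter N S u) u) <= b ^+ N * nr f u ^+ 2.
Proof.
move=> WS b0 Sb N u Wu.
have WI k : W (iter k S u) by elim: k => //= k IH; exact: WS.
have nI k : nr f (iter k S u) ^+ 2 <= (b ^+ k) ^+ 2 * nr f u ^+ 2.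
  rewrite -exprMn lerXn2r ?nnegrE ?mulr_ge0 ?exprn_ge0 ?nr_ge0 //.
  elim: k => [|k IH]; first by rewrite expr0 mul1r.
  by rewrite /= (le_trans (pos_nr_le WS b0 Sb (WI k))) // exprS -mulrA ler_wpM2l.
have sym k : forall v w, f (iter k S v) w = f v (iter k S w).
  by elim: k => // k IH v w; rewrite iterS iterSr (pos_symmetric Sl Sp) IH.
rewrite -(odd_double_half N) -addnn; set k := N./2.
have fE : f (iter (odd N + (k + k)) S u) u = f (iter (odd N) S (iter k S u)) (iter k S u).
  by rewrite addnCA iterD sym iterD.
rewrite fE; have [_|_] /= := boolP (odd N).
  split; first exact: Sp.
  apply: le_trans (Sb _ (WI k)) _; rewrite exprD expr1 exprD -expr2 -mulrA.
  by rewrite ler_wpM2l.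
split; first exact: psd_ge0.
by rewrite -sqr_nr // add0n exprD -expr2.
Qed.

End PositiveOperators.

Lemma bernoulli_ineq (R : realDomainType) (x : R) N : 0 <= x <= 1 ->
  1 - N%:R * x <= (1 - x) ^+ N.
Proof.
move=> /andP[x0 x1]; elim: N => [|N IH]; first by rewrite mul0r subr0 expr0.
rewrite exprS; have y0 : 0 <= 1 - x by rewrite subr_ge0.
apply: le_trans (ler_wpM2l y0 IH); rewrite -natr1.
have : 0 <= N%:R * x ^+ 2 by rewrite mulr_ge0 ?sqr_ge0.
lra.
Qed.

Section SpectralCut.
Context {R : realType} (V : lmodType R[i]) (I : finType).
Variables (phi : I -> V -> R[i]) (e : I -> V).
Hypothesis phiL : forall i, linear_for *%R (phi i).
Hypothesis eK : forall u, u = \sum_i phi i u *: e i.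
Hypothesis phie : forall i j, phi i (e j) = (i == j)%:R.

Let f := cform phi.
Let Hf : psd f := cform_psd phiL.

Lemma cform_basis u i : f u (e i) = phi i u.
Proof.
rewrite /f /cform (bigD1 i) //= big1 => [|j ji].
  by rewrite phie eqxx rmorph1 mulr1 addr0.
by rewrite phie (negPf ji) rmorph0 mulr0.
Qed.

(* By Bernoulli, each eigenvalue of [T] below [t ^ 2] contributes at least 1/2 to
   the trace of [(1 - T / L) ^ N]. *)
Lemma spectral_cut (T : V -> V) (L t : R) (N : nat) : linear T -> 0 < L -> 0 < t ->
  (forall u, 0 <= f (T u) u /\ complex.Re (f (T u) u) <= L * nr f u ^+ 2) ->
  N%:R * t ^+ 2 <= L / 2 ->
  exists (P : pred I) (psi : I -> V -> R[i]),
  [/\ forall i u v, psi i (u - v) = psi i u - psi i v,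
      forall u, \sum_i normc (psi i u) ^+ 2 = nr f u ^+ 2,
      #|P|%:R <= 2 * \sum_i complex.Re
          (f (iter N (fun u => u - L^-1%:C *: T u) (e i)) (e i))
    & forall u, t ^+ 2 * (\sum_(i | ~~ P i) normc (psi i u) ^+ 2)
        <= complex.Re (f (T u) u)].
Proof.
move=> Tl L0 t0 HT Nt.
have Tp u : 0 <= f (T u) u by have [] := HT u.
pose a i j := phi i (T (e j)).
have ah i j : a j i = (a i j)^*.
  by rewrite /a -!cform_basis (pos_symmetric Hf Tl Tp) (psd_herm Hf).
have [u [lam [u1 u2 u3]]] := hermitian_diag ah.
pose psi k v := \sum_j u k j * phi j v.
have phi_sum i (s : seq I) (F : I -> V) : phi i (\sum_(j <- s) F j) = \sum_(j <- s) phi i (F j).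
  elim: s => [|j s IH]; rewrite ?big_nil ?big_cons.
    by have := phiL i 1 0 0; rewrite scaler0 addr0 mul1r => /eqP; rewrite -subr_eq subrr => /eqP/esym.
  by have := phiL i 1 (F j) (\sum_(j <- s) F j); rewrite scale1r mul1r IH.
have phiZ i c v : phi i (c *: v) = c * phi i v.
  rewrite -{1}(addr0 (c *: v)) (phiL i c v 0).
  by have := phi_sum i [::] (fun=> 0); rewrite !big_nil => ->; rewrite addr0.
have phiB i v w : phi i (v - w) = phi i v - phi i w.
  by rewrite addrC -scaleN1r (phiL i) mulN1r addrC.
have psiB k v w : psi k (v - w) = psi k v - psi k w.
  by rewrite /psi -sumrB; apply: eq_bigr => j _; rewrite phiB mulrBr.
have psiZ k c v : psi k (c *: v) = c * psi k v.
  by rewrite /psi mulr_sumr; apply: eq_bigr => j _; rewrite phiZ mulrCA.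
have psiT k v : psi k (T v) = (lam k)%:C * psi k v.
  rewrite /psi -u2; apply: eq_bigr => j _; congr (_ * _).
  rewrite [in LHS](eK v) (lin_sum Tl) phi_sum; apply: eq_bigr => l _.
  by rewrite (linZ Tl) phiZ mulrC.
have fpsi v w : f v w = \sum_k psi k v * (psi k w)^*.
  by rewrite /f /cform /psi u1.
have psie k i : psi k (e i) = u k i.
  rewrite /psi (bigD1 i) //= big1 => [|j ji]; first by rewrite phie eqxx mulr1 addr0.
  by rewrite phie (negPf ji) mulr0.
have nrpsi v : \sum_i normc (psi i v) ^+ 2 = nr f v ^+ 2.
  rewrite (sqr_nr Hf) fpsi Re_sum; apply: eq_bigr => k _.
  by rewrite mul_conjE.
have fT v : complex.Re (f (T v) v) = \sum_k lam k * normc (psi k v) ^+ 2.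
  rewrite fpsi Re_sum; apply: eq_bigr => k _.
  by rewrite psiT -mulrA mul_conjE Re_mul /= mul0r subr0.
have lamb k : 0 <= lam k <= L.
  (* The unit eigenvector for [lam k], on which the bounds on [T] are tested. *)
  pose v := \sum_j (u k j)^* *: e j.
  have pv l : psi l v = (l == k)%:R.
    rewrite /psi -u3; apply: eq_bigr => j _; congr (_ * _).
    rewrite /v phi_sum (bigD1 j) //= big1 => [|i ij].
      by rewrite phiZ phie eqxx mulr1 addr0.
    by rewrite phiZ phie eq_sym (negPf ij) mulr0.
  have sumv (c : I -> R) : \sum_l c l * normc (psi l v) ^+ 2 = c k.
    rewrite (bigD1 k) //= big1 => [|l lk].
      by rewrite pv eqxx normc1 expr1n mulr1 addr0.
    by rewrite pv (negPf lk) normc0 expr0n mulr0.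
  have [h1 h2] := HT v.
  have n1 : nr f v ^+ 2 = 1.
    by rewrite -nrpsi -[RHS](sumv (fun=> 1)); apply: eq_bigr => l _; rewrite mul1r.
  move: h2; rewrite n1 mulr1 fT sumv => ->; rewrite andbT.
  by have : 0 <= complex.Re (f (T v) v) by [move: h1; rewrite lecE => /andP[]]; rewrite fT sumv.
pose q k := (1 - lam k / L) ^+ N.
have base k : 0 <= 1 - lam k / L.
  by have /andP[_] := lamb k; rewrite subr_ge0 ler_pdivrMr // mul1r.
have psiN k M v : psi k (iter M (fun u => u - L^-1%:C *: T u) v)
    = ((1 - lam k / L) ^+ M)%:C * psi k v.
  elim: M => [|M IH] /=; first by rewrite expr0 mul1r.
  rewrite psiB psiZ psiT IH exprS rmorphM rmorphB rmorph1 rmorphM /=.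
  by ring.
pose P := [pred k | lam k <= t ^+ 2].
exists P, psi; split=> //.
  have -> : \sum_i complex.Re (f (iter N (fun u => u - L^-1%:C *: T u) (e i)) (e i))
      = \sum_k q k.
    under eq_bigr do rewrite fpsi Re_sum; rewrite exchange_big; apply: eq_bigr => k _.
    have <- : q k * \sum_i complex.Re (u k i * (u k i)^*) = q k.
      by rewrite -Re_sum u3 eqxx mulr1.
    rewrite mulr_sumr; apply: eq_bigr => i _.
    by rewrite psiN -mulrA psie mul_conjE Re_mul /= mul0r subr0.
  rewrite mulr_sumr (bigID P) /= -[leLHS]addr0 lerD //; last first.
    by apply: sumr_ge0 => k _; rewrite mulr_ge0 // exprn_ge0.
  rewrite -sumr_const; apply: ler_sum => k; rewrite inE => lk.
  have /andP[l0 lL] := lamb k.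
  have x01 : 0 <= lam k / L <= 1 by rewrite divr_ge0 ?(ltW L0) //= ler_pdivrMr ?mul1r.
  have := bernoulli_ineq N x01; rewrite -/(q k).
  have : N%:R * (lam k / L) <= 1 / 2.
    rewrite mulrA ler_pdivrMr // mul1r mulrC.
    apply: le_trans (_ : N%:R * t ^+ 2 <= _); first by rewrite mulrC ler_wpM2l.
    by rewrite [leRHS]mulrC.
  lra.
move=> v; rewrite fT [leRHS](bigID P) /= -[leLHS]add0r lerD //.
  by apply: sumr_ge0 => k _; rewrite mulr_ge0 ?sqr_ge0 //; have /andP[] := lamb k.
rewrite mulr_sumr; apply: ler_sum => k; rewrite -ltNge => lk.
by rewrite ler_wpM2r ?sqr_ge0 // ltW.
Qed.

End SpectralCut.

(** An approximate infimum replaces compactness of the unitary group. If the approximate minimizer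
    happens to be worse than [V0], then [V0] is itself an approximate minimizer. *)
Lemma near_minimizer (R : realType) (T : Type) (P : set T) (val : T -> R) V0 tau :
  (forall V, 0 <= val V) -> P V0 -> 0 < tau ->
  exists V, [/\ P V, val V <= val V0 & forall W, P W -> val V <= val W + tau].
Proof.
move=> val0 P0 tau0; pose A := val @` P.
have hA : has_inf A.
  by split; [exists (val V0), V0|exists 0 => _ [V _ <-]].
have [_ [V1 V11 <-] lt1] := inf_adherent tau0 hA.
have lb1 W : P W -> val V1 <= val W + tau.
  move=> PW; apply: le_trans (ltW lt1) _; rewrite lerD2r.
  by apply: ge_inf; [case: hA|exists W].
case/orP: (le_total (val V1) (val V0)) => le; first by exists V1.
by exists V0; split=> // W PW; apply: le_trans le (lb1 _ PW).
Qed.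

Section NearOptimalUnitary.
Context {R : realType} {d n : nat}.
Implicit Types (X Y : 'I_d -> 'M[R[i]]_n).

Definition nT (X : 'I_d -> 'M[R[i]]_n) : R := nr (vip fro) X.

Lemma nT_psd : psd (vip (d := d) (@fro R n)). Proof. exact: vip_psd fro_psd. Qed.

Lemma sqr_nT X : nT X ^+ 2 = \sum_j nF (X j) ^+ 2.
Proof.
rewrite /nT (sqr_nr nT_psd) /vip Re_sum; apply: eq_bigr => j _.
by rewrite -sqr_nr //; exact: fro_psd.
Qed.

Lemma nT_ge0 X : 0 <= nT X. Proof. exact: nr_ge0. Qed.

Lemma nF_le_nT X j : nF (X j) <= nT X.
Proof.
rewrite -(@ler_pXn2r _ 2) ?nnegrE ?nF_ge0 ?nT_ge0 // sqr_nT (bigD1 j) //= lerDl.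
by apply: sumr_ge0 => i _; exact: sqr_ge0.
Qed.

Definition conjt (V : 'M[R[i]]_n) X : 'I_d -> 'M[R[i]]_n :=
  fun j => V *m X j *m V^t*.

Lemma nF_conj (V A : 'M[R[i]]_n) : V *m V^t* = 1%:M -> nF (V *m A *m V^t*) = nF A.
Proof.
move=> VV; have VV' := mulmx1C VV.
by rewrite -mulmxA nF_isol // -nF_adj trmx_mul map_mxM trmxCK nF_isol // nF_adj.
Qed.

Lemma nT_conj V X : V *m V^t* = 1%:M -> nT (conjt V X) = nT X.
Proof.
move=> VV; apply/eqP; rewrite -(@eqrXn2 _ 2) ?nT_ge0 // !sqr_nT; apply/eqP.
by apply: eq_bigr => j _; rewrite nF_conj.
Qed.

Lemma unitaryM (V W : 'M[R[i]]_n) : V *m V^t* = 1%:M -> W *m W^t* = 1%:M ->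
  (V *m W) *m (V *m W)^t* = 1%:M.
Proof.
by move=> VV WW; rewrite trmx_mul map_mxM mulmxA -(mulmxA V) WW mulmx1.
Qed.

Lemma conjtM V W X : conjt (V *m W) X = conjt V (conjt W X).
Proof. by apply/funext => j; rewrite /conjt trmx_mul map_mxM !mulmxA. Qed.

(* First-order optimality of the unitary conjugate [Y] of a tuple nearest to
   [X], tested on the unitaries [1 + z P] for a projection [P]. *)
Lemma optimal_commutator X Y (K tau s : R) (P : 'M[R[i]]_n) :
  (forall j, (X j)^t* = X j) -> (forall j, (Y j)^t* = Y j) ->
  P^t* = P -> P *m P = P -> opb P 1 ->
  \sum_j nF (X j) * nF (Y j) <= K ->
  (forall W, W *m W^t* = 1%:M -> nT (Y - X) ^+ 2 <= nT (conjt W Y - X) ^+ 2 + tau) ->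
  0 < s -> s <= 1 ->
  normc (\tr (P *m \sum_j (X j *m Y j - Y j *m X j))) <= tau / s + 4 * s * K.
Proof.
move=> Xh Yh Ph PP [_ P1 P2] HK opt s0 s1.
pose c := \sum_j \tr (P *m Y j *m X j).
pose g := \sum_j \tr (P *m Y j *m P *m X j).
have cK : normc c <= K.
  apply: le_trans _ HK; rewrite /c; apply: le_trans (_ : \sum_j normc (\tr (P *m Y j *m X j)) <= _).
    by elim/big_rec2: _ => [|j x y _ h]; [rewrite normc0|apply: le_trans (le_normcD _ _) _; rewrite lerD].
  apply: ler_sum => j _; rewrite -{1}(Xh j) -froE.
  apply: le_trans (psd_CS fro_psd _ _) _; rewrite mulrC ler_wpM2l ?nF_ge0 //.
  by apply: le_trans (P1 _) _; rewrite mul1r.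
have gK : normc g <= K.
  apply: le_trans _ HK; rewrite /g; apply: le_trans (_ : \sum_j normc (\tr (P *m Y j *m P *m X j)) <= _).
    by elim/big_rec2: _ => [|j x y _ h]; [rewrite normc0|apply: le_trans (le_normcD _ _) _; rewrite lerD].
  apply: ler_sum => j _; rewrite -{1}(Xh j) -froE.
  apply: le_trans (psd_CS fro_psd _ _) _; rewrite mulrC ler_wpM2l ?nF_ge0 //.
  by apply: le_trans (P2 _) _; rewrite mul1r; apply: le_trans (P1 _) _; rewrite mul1r.
have c' : \sum_j \tr (P *m X j *m Y j) = c^*.
  rewrite /c rmorph_sum; apply: eq_bigr => j _.
  transitivity (\tr ((P *m Y j *m X j)^t*)); last by rewrite trace_map_mx mxtrace_tr.
  by rewrite !trmx_mul !map_mxM Xh Yh Ph [X j *m _]mulmxA [RHS]mxtrace_mulC mulmxA.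
have trB : \tr (P *m \sum_j (X j *m Y j - Y j *m X j)) = c^* - c.
  rewrite -c' /c -sumrB mulmx_sumr (big_morph _ (@mxtraceD _ _) (@mxtrace0 _ _)).
  by apply: eq_bigr => j _; rewrite mulmxBr linearB /= !mulmxA.
(* For a projection [P], [1 + z P] is unitary as soon as |1 + z| = 1. Conjugation preserves the norm
   of [Y], so only the inner product with [X] varies. *)
have ineq z : normc (1 + z) = 1 ->
    2 * (complex.Re (z * c) *+ 2 + normc z ^+ 2 * complex.Re g) <= tau.
  move=> z1; pose W := 1%:M + z *: P.
  have WW : W *m W^t* = 1%:M.
    have -> : W^t* = 1%:M + z^* *: P.
      by rewrite /W linearD /= map_mxD trmx1 map_mx1 linearZ /= map_mxZ Ph.
    rewrite /W mulmxDl !mulmxDr !mul1mx mulmx1 -scalemxAl -scalemxAr PP scalerA.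
    rewrite -addrA -!scalerDl.
    have -> : z^* + (z + z * z^*) = (1 + z) * (1 + z)^* - 1.
      by rewrite rmorphD rmorph1; ring.
    by rewrite mul_conjE z1 expr1n subrr scale0r addr0.
  have := opt W WW.
  have exp T : nT (T - X) ^+ 2 = nT T ^+ 2 - 2 * complex.Re (vip fro T X) + nT X ^+ 2.
    rewrite /nT (sqr_nrD nT_psd) (nrN nT_psd) (psdNr nT_psd) ReN; ring.
  rewrite !exp nT_conj //.
  have vE T : vip fro T X = \sum_j \tr (T j *m X j).
    by apply: eq_bigr => j _; rewrite froE Xh.
  have -> : vip fro (conjt W Y) X = vip fro Y X + (z * c + z^* * c^*)
      + (z * z^*) * g.
    rewrite !vE -c' /c /g !mulr_sumr -!big_split /=; apply: eq_bigr => j _.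
    rewrite /conjt.
    have -> : W^t* = 1%:M + z^* *: P.
      by rewrite /W linearD /= map_mxD trmx1 map_mx1 linearZ /= map_mxZ Ph.
    rewrite /W !(mulmxDl, mulmxDr) !mul1mx !mulmx1 -!(scalemxAl, scalemxAr).
    rewrite !mxtraceD !mxtraceZ.
    have -> : \tr (Y j *m P *m X j) = \tr (P *m X j *m Y j).
      by rewrite -mulmxA mxtrace_mulC.
    ring.
  clear exp vE.
  rewrite mul_conjE !ReD (Re_mul (_%:C)) /= mul0r subr0.
  have -> : complex.Re (z^* * c^*) = complex.Re (z * c).
    by rewrite -rmorphM; case: (z * c).
  clear; lra.
(* [1 + w] is the Cayley transform (1 + i s) / (1 - i s), a rational point of the unit circle. Its
   conjugate gives the other sign, hence a bound on |Im c|, and the trace to be bounded is -2 i Im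
   c. *)
pose w : R[i] := Complex (- 2 * s ^+ 2 / (1 + s ^+ 2)) (2 * s / (1 + s ^+ 2)).
have sp : 0 < 1 + s ^+ 2 by rewrite addr_gt0 // exprn_gt0.
have s2n : 1 + s ^+ 2 != 0 by rewrite gt_eqF.
have nw : normc w ^+ 2 = 4 * s ^+ 2 / (1 + s ^+ 2).
  by rewrite sqr_normcE /=; field.
have unit1 z : normc z = normc w -> complex.Re z = complex.Re w -> normc (1 + z) = 1.
  move=> e1 e2; apply/eqP; rewrite -(@eqrXn2 _ 2) ?normc_ge0 // expr1n.
  have h : normc z ^+ 2 = normc w ^+ 2 by rewrite e1.
  rewrite nw sqr_normcE in h.
  rewrite sqr_normcE; case: z e2 h {e1} => a b /= -> h; apply/eqP.
  rewrite [LHS](_ : _ = 1 + 2 * (- 2 * s ^+ 2 / (1 + s ^+ 2)) + ((- 2 * s ^+ 2 / (1 + s ^+ 2)) ^+ 2 + b ^+ 2)).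
    by rewrite h; field.
  by ring.
have i1 := ineq w (unit1 _ erefl erefl).
have i2 := ineq w^* (unit1 _ (normc_conj w) (congr1 (@complex.Re R) (conjE w))).
rewrite normc_conj in i2; rewrite nw in i1 i2.
rewrite trB; apply: le_trans (_ : 2 * `|complex.Im c| <= _).
  rewrite -(@ler_pXn2r _ 2) ?nnegrE ?normc_ge0 ?mulr_ge0 ?normr_ge0 //.
  rewrite sqr_normcE exprMn real_normK ?num_real // conjE.
  by case: (c) => a b /=; nra.
have [Rc Rg] : `|complex.Re c| <= K /\ `|complex.Re g| <= K.
  split; [apply: le_trans cK|apply: le_trans gK]; rewrite -sqrtr_sqr.
    by case: (c) => a b; apply: ler_wsqrtr => /=; rewrite lerDl sqr_ge0.
  by case: (g) => a b; apply: ler_wsqrtr => /=; rewrite lerDl sqr_ge0.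
have K0 : 0 <= K by exact: le_trans (normr_ge0 _) Rc.
move: i1 i2 Rc Rg; rewrite !Re_mul conjE /= !ler_norml => i1 i2 /andP[c1 c2] /andP[g1 g2].
set ci := complex.Im c in i1 i2 *; set cr := complex.Re c in i1 i2 c1 c2; set gr := complex.Re g in i1 i2 g1 g2.
clearbody ci cr gr; clear ineq unit1 nw.
rewrite -(ler_pM2r s0) [leRHS](_ : _ = tau + 4 * s ^+ 2 * K); last by field; rewrite gt_eqF.
have tau0 : 0 <= tau.
  have := opt 1%:M; rewrite trmx1 map_mx1 mulmx1 => /(_ erefl).
  have -> : conjt 1%:M Y = Y.
    by apply/funext => j; rewrite /conjt trmx1 map_mx1 mulmx1 mul1mx.
  lra.
have clear x y z : 2 * ((x / (1 + s ^+ 2) * cr + y / (1 + s ^+ 2) * ci) *+ 2 + z / (1 + s ^+ 2) * gr) <= tau ->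
    4 * x * cr + 4 * y * ci + 2 * z * gr <= tau * (1 + s ^+ 2).
  rewrite -(ler_pM2r sp) => h; apply: le_trans h; rewrite -mulr_natr.
  by rewrite le_eqVlt; apply/orP; left; apply/eqP; field.
have {}i1 : 4 * (-2 * s ^+ 2) * cr + 4 * (- (2 * s)) * ci + 2 * (4 * s ^+ 2) * gr
    <= tau * (1 + s ^+ 2) by apply: clear; rewrite !mulNr; move: i1; rewrite !mulNr.
have {}i2 : 4 * (-2 * s ^+ 2) * cr + 4 * (2 * s) * ci + 2 * (4 * s ^+ 2) * gr
    <= tau * (1 + s ^+ 2) by apply: clear; apply: le_trans i2; rewrite le_eqVlt;
  apply/orP; left; apply/eqP; ring.
clear opt.
have ss : s ^+ 2 <= 1 by rewrite expr_le1 // ltW.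
have t2 : tau * s ^+ 2 <= tau by rewrite ler_piMr.
have sK : 0 <= s ^+ 2 * (K - cr) by rewrite mulr_ge0 ?sqr_ge0 // subr_ge0.
have sK' : 0 <= s ^+ 2 * (K + gr) by rewrite mulr_ge0 ?sqr_ge0 // addrC -lerBlDr sub0r.
clear -i1 i2 t2 sK sK' tau0.
have [h|h] := leP 0 ci; [rewrite ger0_norm //|rewrite ltr0_norm //]; lra.
Qed.

(** The sum of commutators is skew-adjoint. Tested on its rank one eigenprojections,
    [optimal_commutator] bounds every eigenvalue by [eta / Num.sqrt n], and [n] of them give a
    Hilbert-Schmidt norm at most [eta]. *)
Lemma near_optimal_unitary X Y V0 (e eta : R) : (0 < n)%N ->
  (forall j, (X j)^t* = X j) -> (forall j, (Y j)^t* = Y j) ->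
  V0 *m V0^t* = 1%:M -> nT (conjt V0 Y - X) <= e -> 0 < eta ->
  exists V, [/\ V *m V^t* = 1%:M, nT (conjt V Y - X) <= e
    & nF (\sum_j (X j *m conjt V Y j - conjt V Y j *m X j)) <= eta].
Proof.
move=> n0 Xh Yh V00 He eta0.
pose K := \sum_j nF (X j) * nF (Y j) + 1.
have K0 : 0 < K.
  by rewrite ltr_wpDl // sumr_ge0 // => j _; rewrite mulr_ge0 ?nF_ge0.
pose sn := Num.sqrt n%:R : R.
have sn0 : 0 < sn by rewrite sqrtr_gt0 ltr0n.
(* [s] and [tau] are chosen so that [tau / s] and [4 * s * K] are each at most half of
   [eta / sn]. *)
pose s := Num.min 1 (eta / (8 * K * sn)).
have s0 : 0 < s by rewrite lt_min ltr01 /=; gt0.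
have s1 : s <= 1 by rewrite ge_min lexx.
have s2 : 8 * K * sn * s <= eta.
  rewrite mulrC -ler_pdivlMr; last by gt0.
  by rewrite ge_min lexx orbT.
have s4 : 4 * s * K <= eta / sn / 2.
  rewrite !ler_pdivlMr ?ltr0n //; apply: le_trans s2; rewrite le_eqVlt.
  by apply/orP; left; apply/eqP; ring.
pose tau := s * eta / (2 * sn).
have tau0 : 0 < tau by rewrite /tau; gt0.
pose val V := nT (conjt V Y - X) ^+ 2.
have val0 V : 0 <= val V by exact: sqr_ge0.
have [V [VV Vle Vopt]] := @near_minimizer R 'M[R[i]]_n [set V | V *m V^t* = 1%:M] val V0 tau val0 V00 tau0.
exists V; split; first exact: VV.
  apply: le_trans He; rewrite -(@ler_pXn2r _ 2) ?nnegrE ?nT_ge0 //.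
set Z := conjt V Y.
have Zh j : (Z j)^t* = Z j.
  by rewrite /Z /conjt !trmx_mul !map_mxM trmxCK Yh mulmxA.
have HK : \sum_j nF (X j) * nF (Z j) <= K.
  rewrite /K ler_wpDr // le_eqVlt; apply/orP; left; apply/eqP.
  by apply: eq_bigr => j _; rewrite nF_conj.
have opt W : W *m W^t* = 1%:M -> nT (Z - X) ^+ 2 <= nT (conjt W Z - X) ^+ 2 + tau.
  by move=> WW; rewrite /Z -conjtM; apply: Vopt; exact: unitaryM.
clearbody Z.
pose B := \sum_j (X j *m Z j - Z j *m X j).
have Bs : B^t* = - B.
  rewrite /B raddf_sum raddf_sum /= -sumrN; apply: eq_bigr => j _.
  by rewrite raddfB /= map_mxB !trmx_mul !map_mxM Xh Zh opprB.
pose H := 'i%C *: B.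
have Hh : H \is hermsymmx.
  apply/hermsymmxP; rewrite /H linearZ map_mxZ /= Bs scalerN -scaleNr; congr (_ *: _).
  by apply: complex_ext => /=; rewrite ?oppr0 ?opprK.
have [U [lam [UU UU' HE]]] := hermitian_spectral Hh.
have lamb k : `|lam k| <= eta / sn.
  pose E : 'M[R[i]]_n := diag_mx (\row_i (i == k)%:R).
  have Eh : E^t* = E.
    rewrite /E tr_diag_mx map_diag_mx; congr diag_mx; apply/rowP => i.
    by rewrite !mxE rmorph_nat.
  have EE : E *m E = E.
    rewrite /E mul_diag_mx; apply/matrixP => i j; rewrite !mxE.
    by case: (i == k); rewrite ?mul1r ?mul0r ?mul0rn.
  pose P := U^t* *m E *m U.
  have Ph : P^t* = P by rewrite /P !trmx_mul !map_mxM trmxCK Eh mulmxA.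
  have PP : P *m P = P.
    by rewrite /P !mulmxA -(mulmxA _ U) UU mulmx1 -(mulmxA _ E E) EE.
  have Pb : opb P 1.
    have Eb : opb E 1.
      by apply: opb_diag => // i; case: (i == k); rewrite ?normc0 ?normc1.
    have := opbM (opbM (opb_adj (opb_unitary UU)) Eb) (opb_unitary UU).
    by rewrite !mul1r.
  have := optimal_commutator Xh Zh Ph PP Pb HK opt s0 s1; rewrite -/B.
  have -> : normc (\tr (P *m B)) = `|lam k|.
    have -> : normc (\tr (P *m B)) = normc (\tr (P *m H)).
      rewrite /H -scalemxAr linearZ /= normcM.
      have -> : normc ('i%C : R[i]) = 1 by rewrite /= expr0n expr1n add0r sqrtr1.
      by rewrite mul1r.
    rewrite /P HE !mulmxA -(mulmxA _ U) UU mulmx1 mxtrace_mulC !mulmxA UU mul1mx.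
    rewrite mul_diag_mx /mxtrace (bigD1 k) //= big1 => [|i ik].
      by rewrite !mxE !eqxx mul1r addr0 mulr1n normcR.
    by rewrite !mxE (negPf ik) mul0r.
  move/le_trans; apply.
  have -> : tau / s = eta / sn / 2 by rewrite /tau; field; rewrite !gt_eqF.
  by apply: le_trans (lerD (lexx _) s4) _; rewrite -splitr.
have HB : nF B = nF H.
  by rewrite /H nFZ /= expr0n expr1n add0r sqrtr1 mul1r.
rewrite -/B HB -(@ler_pXn2r _ 2) ?nnegrE ?nF_ge0 ?(ltW eta0) //.
have -> : nF H ^+ 2 = \sum_k normc ((lam k)%:C) ^+ 2.
  rewrite -sqr_nF_diag HE -mulmxA nF_isol ?trmxCK //.
  by rewrite -nF_adj trmx_mul map_mxM nF_isol ?trmxCK ?nF_adj.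
apply: (@le_trans _ _ (\sum_(k < n) (eta / sn) ^+ 2)).
  apply: ler_sum => k _; rewrite lerXn2r ?nnegrE ?normc_ge0 ?divr_ge0 ?(ltW eta0) ?(ltW sn0) //.
  by rewrite normcR.
rewrite sumr_const card_ord -mulr_natr expr_div_n /sn sqr_sqrtr ?ler0n //.
by rewrite divfK // pnatr_eq0 -lt0n.
Qed.

End NearOptimalUnitary.

(** * Covering microstates scale by scale *)

Section Relations.
Context {R : realType} {d : nat} {m : option nat}.
Implicit Type g : ncpoly R d.

Definition tp_of (q : ncpoly2 R d) : @tpoly R d :=
  [seq (monalg.mcoeff p q, (p.1 : seq 'I_d, p.2 : seq 'I_d)) | p <- monalg.msupp q].

Definition rows (f : nctuple R d m) : seq (option (idx m)) :=
  None :: [seq Some i | i <- finsupp f].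

Definition Dtp (f : nctuple R d m) (l : option (idx m)) (j : 'I_d) : @tpoly R d :=
  match l with
  | None => [:: (1, ([:: j], [::])); (-1, ([::], [:: j]))]
  | Some i => tp_of (free_diff_quot j (f i))
  end.

Section MalgSums.
Variables (I : choiceType) (V : lmodType R[i]) (F : I -> V).

Definition malg_sum (q : monalg.malg I R[i]) : V :=
  \sum_(p <- monalg.msupp q) monalg.mcoeff p q *: F p.

Lemma malg_sumw (s : {fset I}) q : (monalg.msupp q `<=` s)%fset ->
  malg_sum q = \sum_(p <- s) monalg.mcoeff p q *: F p.
Proof.
move=> sub; apply: big_fset_incl => // p _ /monalg.mcoeff_outdom ->.
by rewrite scale0r.
Qed.

Lemma malg_sumD q q' : malg_sum (q + q') = malg_sum q + malg_sum q'.
Proof.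
rewrite (@malg_sumw (monalg.msupp q `|` monalg.msupp q')%fset (q + q')); last first.
  exact: monalg.msuppD_le.
rewrite (@malg_sumw (monalg.msupp q `|` monalg.msupp q')%fset q) ?fsubsetUl //.
rewrite (@malg_sumw (monalg.msupp q `|` monalg.msupp q')%fset q') ?fsubsetUr // -big_split /=.
by apply: eq_bigr => p _; rewrite monalg.mcoeffD scalerDl.
Qed.

Lemma malg_sum0 : malg_sum 0 = 0.
Proof. by rewrite /malg_sum monalg.msupp0 big_seq_fset0. Qed.

Lemma malg_sum_sum J (s : seq J) (P : pred J) (G : J -> monalg.malg I R[i]) :
  malg_sum (\sum_(j <- s | P j) G j) = \sum_(j <- s | P j) malg_sum (G j).
Proof. by apply: (big_morph malg_sum) => [u v|]; rewrite ?malg_sumD ?malg_sum0. Qed.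

Lemma malg_sumU p c : malg_sum (monalg.mkmalgU p c) = c *: F p.
Proof.
rewrite (@malg_sumw [fset p]%fset); last exact: monalg.msuppU_le.
by rewrite big_seq_fset1 monalg.mcoeffUU.
Qed.

End MalgSums.

(** Summing over [j] removes the condition that the deleted letter be [j]: each position of a word
    occurs once, with the direction of its own letter. *)
Lemma tev_free_diff_quot (V : lmodType R[i]) (act : seq 'I_d -> seq 'I_d -> V -> V)
    (u : 'I_d -> V) g :
  \sum_j tev act (tp_of (free_diff_quot j g)) (u j) =
  \sum_(w <- monalg.msupp g) monalg.mcoeff w g *:
    \sum_(a < size w) act (take a w) (drop a.+1 w) (u (tnth (in_tuple w) a)).
Proof.
have E j : tev act (tp_of (free_diff_quot j g)) (u j) =
    \sum_(w <- monalg.msupp g) \sum_(a < size w | tnth (in_tuple w) a == j)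
      monalg.mcoeff w g *: act (take a w) (drop a.+1 w) (u j).
  pose F (p : monalg.fmonom 'I_d * monalg.fmonom 'I_d) := act p.1 p.2 (u j).
  rewrite /tev /tp_of big_map -[LHS]/(malg_sum F _) /free_diff_quot malg_sum_sum.
  apply: eq_bigr => w _; rewrite malg_sum_sum; apply: eq_bigr => a _.
  by rewrite malg_sumU.
under eq_bigr do rewrite E; rewrite exchange_big; apply: eq_bigr => w _.
rewrite (exchange_big_dep xpredT) //= scaler_sumr; apply: eq_bigr => a _.
by rewrite (big_pred1 (tnth (in_tuple w) a)) // => j; rewrite /= eq_sym.
Qed.

Section Matrices.
Context {n : nat}.
Implicit Types (X Y Z : 'I_d -> 'M[R[i]]_n).

Definition actX X (a b : seq 'I_d) (Z : 'M[R[i]]_n) := mw X a *m Z *m mw X b.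

Lemma actX_bimodule X : (forall j, (X j)^t* = X j) -> bimodule_action fro (actX X).
Proof.
move=> Xh; split=> [|a b|v|a b a' b' v|a b u v].
- exact: fro_psd.
- move=> c u v; rewrite /actX mulmxDr mulmxDl -scalemxAr -scalemxAl.
  by [].
- by rewrite /actX !mw0 mul1mx mulmx1.
- by rewrite /actX !mw_cat !mulmxA.
- rewrite !froE /actX !trmx_mul !map_mxM -!mw_rev_adj // !trmxCK.
  by rewrite -!mulmxA mxtrace_mulC !mulmxA.
Qed.

Definition peval X g := nceval (fun A B : 'M[R[i]]_n => A *m B) 1%:M X g.

Lemma pevalE X g : peval X g = \sum_(w <- monalg.msupp g) monalg.mcoeff w g *: mw X w.
Proof. by []. Qed.

Lemma gradient_None f X Z : gradient (actX X) (Dtp f) Z None = \sum_j (X j *m Z j - Z j *m X j).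
Proof.
apply: eq_bigr => j _; rewrite /tev /= big_cons big_seq1 /= scale1r scaleN1r.
by rewrite /actX !mw_cons !mw0 !mulmx1 mul1mx.
Qed.

Lemma gradient_Some f X Z i : gradient (actX X) (Dtp f) Z (Some i) =
  \sum_(w <- monalg.msupp (f i)) monalg.mcoeff w (f i) *: dw X Z w.
Proof.
rewrite /gradient tev_free_diff_quot; apply: eq_bigr => w _.
by rewrite dwE.
Qed.

(** Both values of [f i] are small on microstates, so this row of D_f(X)(Y - X) is known as soon as
    the remainder is. *)
Lemma taylor f X Y i : gradient (actX X) (Dtp f) (fun j => Y j - X j) (Some i) =
  peval Y (f i) - peval X (f i)
  - \sum_(w <- monalg.msupp (f i)) monalg.mcoeff w (f i) *: remw X Y w.
Proof.
rewrite gradient_Some !pevalE -!sumrB; apply: eq_bigr => w _.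
by rewrite /remw -scalerBr -scalerBr opprB addrC subrK.
Qed.

Lemma fro_delta (A : 'M[R[i]]_n) k l : fro A (delta_mx k l) = A k l.
Proof.
rewrite /fro /cform (bigD1 (k, l)) //= big1 => [|p pkl].
  by rewrite mxE !eqxx rmorph1 mulr1 addr0.
by rewrite mxE; case: (p.1 =P k) (p.2 =P l) pkl => [<-|_] [<-|_] /=;
  rewrite ?rmorph0 ?mulr0 // -surjective_pairing eqxx.
Qed.

Definition mxmoment X (w : seq 'I_d) : R[i] := mxtr (mw X w).

(** The map Z -> a Z b on matrices has trace Tr(a) Tr(b): the counterpart of the trace tau (x) tau,
    and the reason why eigenvalue counts for D_f(X)^* D_f(X) are controlled by moments. *)
Lemma trace_act X a b : (0 < n)%N ->
  \sum_(q : 'I_n * 'I_n) fro (actX X a b (delta_mx q.1 q.2)) (delta_mx q.1 q.2) =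
  n%:R ^+ 2 * (mxmoment X a * mxmoment X b).
Proof.
move=> n0; have nn : n%:R != 0 :> R[i] by rewrite pnatr_eq0 -lt0n.
rewrite /mxmoment /mxtr [RHS](_ : _ = \tr (mw X a) * \tr (mw X b)); last by field.
rewrite /mxtrace mulr_suml -(pair_big xpredT xpredT
  (fun k l => fro (actX X a b (delta_mx k l)) (delta_mx k l))) /=.
apply: eq_bigr => k _; rewrite mulr_sumr; apply: eq_bigr => l _.
rewrite fro_delta /actX !mxE (bigD1 l) //= big1 => [|i il]; last first.
  rewrite mxE big1 ?mul0r // => i' _.
  by rewrite !mxE eq_sym [_ && _]andbC (negPf (il)) ?mulr0.
rewrite addr0 mxE (bigD1 k) //= big1 => [|i ik]; last first.
  by rewrite mxE (negPf ik) mulr0.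
by rewrite addr0 mxE !eqxx mulr1.
Qed.

End Matrices.
End Relations.

Section TupleBasis.
Context {R : realType} {d n : nat}.

Let J := ('I_d * ('I_n * 'I_n))%type.

Definition entry (q : J) (u : 'I_d -> 'M[R[i]]_n) : R[i] := u q.1 q.2.1 q.2.2.

Definition unit_tuple (q : J) : 'I_d -> 'M[R[i]]_n :=
  fun j => if j == q.1 then delta_mx q.2.1 q.2.2 else 0.

Lemma entryL q : linear_for *%R (entry q).
Proof. by move=> c u v; rewrite /entry !mxE. Qed.

Lemma entry_unit p q : entry p (unit_tuple q) = (p == q)%:R.
Proof.
case: p q => [j [k l]] [j' [k' l']]; rewrite /entry /unit_tuple /= !xpair_eqE.
by case: (j == j'); rewrite mxE.
Qed.

Lemma entryK u : u = \sum_q entry q u *: unit_tuple q.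
Proof.
apply/funext => j; apply/matrixP => k l; rewrite fct_sumE summxE.
rewrite (bigD1 (j, (k, l))) //= big1 => [|[j' [k' l']] ne].
  by rewrite addr0 /unit_tuple /= mxE eqxx mxE !eqxx mulr1.
rewrite /unit_tuple /= mxE; case: (j =P j') ne => [<-|_] ne; rewrite mxE ?mulr0 //.
move: ne; rewrite !xpair_eqE eqxx /= => ne.
by rewrite [k == _]eq_sym [l == _]eq_sym (negPf ne) mulr0.
Qed.

Lemma vip_froE : vip fro = cform entry.
Proof.
apply/funext => u; apply/funext => v; rewrite /vip /cform.
by rewrite pair_bigA /=.
Qed.

Lemma trace_mev X (M : @tmx R d) : (0 < n)%N ->
  \sum_q vip fro (mev (actX X) M (unit_tuple q)) (unit_tuple q) =
  n%:R ^+ 2 * \sum_j ttr (mxmoment X) (M j j).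
Proof.
move=> n0.
have E j : \sum_p vip fro (mev (actX X) M (unit_tuple (j, p))) (unit_tuple (j, p)) =
    n%:R ^+ 2 * ttr (mxmoment X) (M j j).
  have E' p : vip fro (mev (actX X) M (unit_tuple (j, p))) (unit_tuple (j, p)) =
      \sum_(t <- M j j) t.1 * fro (actX X t.2.1 t.2.2 (delta_mx p.1 p.2)) (delta_mx p.1 p.2).
    rewrite /vip (bigD1 j) //= big1 => [|i ij]; last first.
      by rewrite {2}/unit_tuple /= (negPf ij) (psd0r fro_psd).
    rewrite addr0 {2}/unit_tuple /= eqxx /mev (bigD1 j) //= big1 => [|i ij]; last first.
      rewrite /unit_tuple /= (negPf ij) /tev big1 // => t _.
      by rewrite /actX mulmx0 mul0mx scaler0.
    rewrite addr0 /unit_tuple /= eqxx /tev (psd_suml fro_psd).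
    by under [LHS]eq_bigr do rewrite (psdZl fro_psd).
  under eq_bigr do rewrite E'; rewrite exchange_big /=.
  under eq_bigr do rewrite -mulr_sumr trace_act // mulrCA.
  by rewrite -mulr_sumr.
rewrite (eq_bigr (fun q => vip fro (mev (actX X) M (unit_tuple (q.1, q.2)))
  (unit_tuple (q.1, q.2)))); last by case.
rewrite -(pair_bigA _ (fun j p =>
   vip fro (mev (actX X) M (unit_tuple (j, p))) (unit_tuple (j, p)))) /=.
by under eq_bigr do rewrite E; rewrite mulr_sumr.
Qed.

End TupleBasis.

Section GradientBound.
Context {R : realType} {d : nat}.

Definition tbound (rho : R) (T : @tpoly R d) : R :=
  \sum_(p <- T) normc p.1 * rho ^+ (size p.2.1 + size p.2.2).

Lemma tbound_ge0 rho T : 0 <= rho -> 0 <= tbound rho T.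
Proof. by move=> r0; apply: sumr_ge0 => p _; rewrite mulr_ge0 ?normc_ge0 ?exprn_ge0. Qed.

Lemma nF_tev n (X : 'I_d -> 'M[R[i]]_n) rho T (Z : 'M[R[i]]_n) :
  (forall j, opb (X j) rho) -> nF (tev (actX X) T Z) <= tbound rho T * nF Z.
Proof.
move=> Xb; rewrite /tev /tbound; apply: le_trans (nr_sum fro_psd _ _ _) _.
rewrite mulr_suml; apply: ler_sum => p _; rewrite -/(nF _) nFZ -mulrA.
rewrite ler_wpM2l ?normc_ge0 // /actX.
have [a0 a1 _] := opb_mw p.2.1 Xb; have [b0 _ b2] := opb_mw p.2.2 Xb.
by apply: le_trans (b2 _) _; rewrite exprD -mulrA mulrCA ler_wpM2l.
Qed.

Lemma gradient_bound n (X : 'I_d -> 'M[R[i]]_n) rho (I : Type) (s : seq I)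
    (D : I -> 'I_d -> @tpoly R d) (Z : 'I_d -> 'M[R[i]]_n) : 0 <= rho ->
  (forall j, opb (X j) rho) ->
  \sum_(l <- s) nF (gradient (actX X) D Z l) ^+ 2
    <= (\sum_(l <- s) (\sum_j tbound rho (D l j)) ^+ 2) * nT Z ^+ 2.
Proof.
move=> r0 Xb; rewrite mulr_suml; apply: ler_sum => l _; rewrite -exprMn.
rewrite lerXn2r ?nnegrE ?nF_ge0 ?mulr_ge0 ?nT_ge0 //.
  by apply: sumr_ge0 => j _; exact: tbound_ge0.
apply: le_trans (nr_sum fro_psd _ _ _) _; rewrite mulr_suml; apply: ler_sum => j _.
apply: le_trans (nF_tev _ _ Xb) _.
by rewrite ler_wpM2l ?tbound_ge0 // nF_le_nT.
Qed.

End GradientBound.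

Section Step.
Context {R : realType} {d : nat} {m : option nat} (f : nctuple R d m).

Definition orb n (e : R) (Y Y' : 'I_d -> 'M[R[i]]_n) :=
  exists2 V, V *m V^t* = 1%:M & nT (conjt V Y' - Y) <= e.

Definition gram : @tmx R d := tmx_gram (rows f) (Dtp f).

Lemma codable_gradient (E0 rho : R) i : 0 < E0 -> 1 <= rho ->
  codable_at_all_scales E0 rho (fun n X Y =>
    \sum_(w <- monalg.msupp (f i)) monalg.mcoeff w (f i) *: remw X Y w).
Proof.
move=> E00 r1; elim: (enum_fset _) => [|w s IH].
  apply: (codable_ext _ (@codable_const0 R d E0 rho E00)) => n X Y.
  by rewrite big_nil.
apply: codable_ext (fun n X Y => esym (big_cons _ _ _ _ _ _)) _.
apply: codable_sum => //.
pose c := normc (monalg.mcoeff w (f i)) + 1.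
have c0 : 0 < c by rewrite ltr_wpDl ?normc_ge0.
have := @codable_lmul R d E0 rho _ (fun n _ => (monalg.mcoeff w (f i))%:M) c _ c0
  (codable_remw E00 r1 w).
move=> H; apply: codable_ext (H _) => [n X Y|n X _]; first by rewrite mul_scalar_mx.
split=> [|B|B]; rewrite ?mul_scalar_mx ?mul_mx_scalar ?nFZ; first exact: ltW.
  by rewrite ler_wpM2r ?nF_ge0 // /c lerDl.
by rewrite ler_wpM2r ?nF_ge0 // /c lerDl.
Qed.

Lemma nF_sub_sub n (a1 a2 x r1 r2 : 'M[R[i]]_n) b e :
  nF a1 <= b -> nF a2 <= b -> nF (r1 - r2) <= e ->
  nF ((a1 - x - r1) - (a2 - x - r2)) <= b + b + e.
Proof.
move=> h1 h2 h; rewrite (_ : _ - _ = (a1 - a2) - (r1 - r2)); last first.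
  by apply/matrixP => k l; rewrite !mxE; ring.
apply: le_trans (nFB _ _) _; apply: le_trans (lerD (nFB a1 a2) h) _.
exact: lerD (lerD h1 h2) (lexx _).
Qed.

Lemma gradient_None_sub n (X Y : 'I_d -> 'M[R[i]]_n) :
  gradient (actX X) (Dtp f) (fun j => Y j - X j) None =
  \sum_j (X j *m Y j - Y j *m X j).
Proof.
rewrite gradient_None; apply: eq_bigr => j _.
by rewrite mulmxBr mulmxBl opprB addrA subrK.
Qed.

(** One code records the rows of D_f(X)(F Y - X), another the coordinates [psi i] below the cut.
    Above the cut, [E Y - E Y'] is at most [p] times the difference of the rows, so both parts end
    below [eps / 32]. Invariance of [Om] under conjugation keeps the optimized tuple [F Y] in [Om],
    under the same bounds. *)
Lemma codable_step (rho : R) (L' : nat) : 1 <= rho -> (0 < L')%N ->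
  \sum_(l <- rows f) (\sum_j tbound rho (Dtp f l j)) ^+ 2 <= 2 * L'%:R ->
  forall E0 : R, 0 < E0 -> exists g C : R, [/\ 0 < g, 0 <= C &
  forall n p (Om : set ('I_d -> 'M[R[i]]_n)) b, (0 < n)%N -> (0 < p)%N -> 0 <= b ->
  (forall X V, Om X -> V *m V^t* = 1%:M -> Om (conjt V X)) ->
  (forall X, Om X -> [/\ forall j, (X j)^t* = X j /\ opb (X j) rho,
     forall i, i \in finsupp f -> nF (peval X (f i)) <= small_at_scale E0 g n p &
     complex.Re (\sum_j ttr (mxmoment X)
        (tmx_pow (tmx_compl (2 * L'%:R) gram) (L' * p ^ 2) j j)) <= b]) ->
  forall X, Om X ->
  codable [set Y | Om Y /\ orb (E0 / p%:R ^+ 4 * Num.sqrt n%:R) X Y]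
     (orb (E0 / p%:R ^+ 4 / 16 * Num.sqrt n%:R))
     (C * (n%:R ^+ 2 / p%:R + n%:R + n%:R ^+ 2 * b))].
Proof.
move=> r1 L'0 HL E0 E00.
(* The constant of [codable_vec] at ratio 32, for at most [2 * n ^ 2 * b] coordinates. *)
have [c0 c00 c0E] : exists2 c : R, 0 <= c & 2 * (4 + 20 * 32)%:R = c.
  by exists (2 * (4 + 20 * 32)%:R) => //; exact: mulr_ge0 (ler0n _ 2) (ler0n _ _).
pose R0 : R := (size (rows f))%:R.
have R00 : 0 < R0 by rewrite ltr0n.
(* The [R0] rows, each with error [g' * eps / p] and amplified by [p], then contribute at most
   [(eps / 32) ^ 2] to the square. Of [g'], one quarter goes to each of the two values of [f i] and
   one half to the remainder. *)
pose g' := (32 * R0)^-1.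
have g'0 : 0 < g' by rewrite /g'; gt0.
have g4 : 0 < g' / 4 by gt0.
have g2 : 0 < g' / 2 by gt0.
have gsum : g' / 4 + g' / 4 + g' / 2 <= g' by lra.
have gsum' : g' / 4 + g' / 4 <= g' by lra.
have HC i := codable_gradient i E00 r1 g2.
have {HC} /choice[Ci HC] i : exists C : R, 0 <= C /\
  forall n p (Y : Type) (Om : set Y) X F, @near_tuples R d E0 rho n p Y Om X F ->
  codable Om (fun y y' => nF (
     \sum_(w <- monalg.msupp (f i)) monalg.mcoeff w (f i) *: remw X (F y) w -
     \sum_(w <- monalg.msupp (f i)) monalg.mcoeff w (f i) *: remw X (F y') w)
       <= small_at_scale E0 (g' / 2) n p) (C * (n%:R ^+ 2 / p%:R + n%:R)).
  by have [C C0 H] := HC i; exists C; split.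
pose C := \sum_(i <- finsupp f) Ci i.
have Ci0 i : 0 <= Ci i by have [] := HC i.
have C0 : 0 <= C by exact: sumr_ge0.
have CiC i : i \in finsupp f -> Ci i <= C.
  by move=> fi; rewrite /C (big_rem i) //= lerDl sumr_ge0.
exists (g' / 4), (C * (size (finsupp f))%:R + c0); split=> //; first by nneg.
move=> n p Om b n0 p0 b0 Oconj HOm X OX.
have n0' : 0 < n%:R :> R by rewrite ltr0n.
have p0' : 0 < p%:R :> R by rewrite ltr0n.
set eps := E0 / p%:R ^+ 4 * Num.sqrt n%:R.
have eps0 : 0 < eps by rewrite /eps; gt0.
have [HX Xf Xb] := HOm _ OX.
have Xh j : (X j)^t* = X j by have [] := HX j.
have Xop j : opb (X j) rho by have [] := HX j.
set Cl := [set Y | _].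
have /choice[V HV] (Y : 'I_d -> 'M[R[i]]_n) : exists V : 'M[R[i]]_n, Cl Y ->
   [/\ V *m V^t* = 1%:M, nT (conjt V Y - X) <= eps
    & nF (\sum_j (X j *m conjt V Y j - conjt V Y j *m X j)) <= small_at_scale E0 (g' / 4) n p].
  have [[OY [V0 V00 V0e]]|no] := pselect (Cl Y); last by exists 0.
  have [HY _ _] := HOm _ OY.
  have e0 : 0 < small_at_scale E0 (g' / 4) n p by rewrite /small_at_scale -/eps; gt0.
  have [V VP] := near_optimal_unitary n0 Xh (fun j => proj1 (HY j)) V00 V0e e0.
  by exists V.
pose F Y := conjt (V Y) Y.
have OF Y : Cl Y -> Om (F Y).
  by move=> CY; have [VV _ _] := HV _ CY; apply: Oconj => //; case: CY.
have near : near_tuples E0 rho p Cl X F.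
  split=> // Y j CY; have [_ le _] := HV _ CY; have [h _ _] := HOm _ (OF _ CY).
  have [h1 h2] := h j; split=> //.
  exact: le_trans (nF_le_nT _ _) le.
pose G Y l := gradient (actX X) (Dtp f) (fun j => F Y j - X j) l.
have C1 : codable Cl (fun Y Y' => forall l, l \in rows f ->
     nF (G Y l - G Y' l) <= small_at_scale E0 g' n p) (C * (size (finsupp f))%:R * (n%:R ^+ 2 / p%:R + n%:R)).
  have C10 : codable Cl (fun Y Y' => forall i, i \in (finsupp f : seq _) ->
     nF (G Y (Some i) - G Y' (Some i)) <= small_at_scale E0 g' n p)
       ((C * (n%:R ^+ 2 / p%:R + n%:R)) *+ size (finsupp f)).
    apply: codable_all; first by nneg.
    move=> i fi; have [_ H] := HC i.
    apply: codable_mono (H n p _ Cl X F near) _ (fun _ => id) _.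
      by rewrite ler_wpM2r ?CiC //; nneg.
    move=> Y Y' CY CY' h; rewrite /G !taylor.
    have [_ Yf _] := HOm _ (OF _ CY); have [_ Y'f _] := HOm _ (OF _ CY').
    have := Yf _ fi; have := Y'f _ fi.
    move=> h2 h1; apply: le_trans (nF_sub_sub _ h1 h2 h) _.
    by rewrite !smallyD; exact: (smally_le E00 n p gsum).
  apply: codable_mono C10 _ (fun _ => id) _.
    by rewrite -mulr_natr mulrAC.
  move=> Y Y' CY CY' h l; rewrite inE => /predU1P[->|/mapP[i fi ->]]; last exact: h.
  have nn Z : Cl Z -> nF (G Z None) <= small_at_scale E0 (g' / 4) n p.
    by move=> CZ; have [_ _ le] := HV _ CZ; rewrite /G gradient_None_sub.
  apply: le_trans (nFB _ _) _; apply: le_trans (lerD (nn _ CY) (nn _ CY')) _.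
  by rewrite smallyD; exact: (smally_le E00 n p gsum').
pose L : R := 2 * L'%:R.
have L0 : 0 < L by rewrite /L mulr_gt0 // ltr0n.
have Hact := actX_bimodule Xh.
pose T := mev (actX X) gram.
have Tl : linear T by exact: (mev_linear Hact).
have T0 u : cform entry (T u) u = (\sum_(l <- rows f) nF (gradient (actX X) (Dtp f) u l) ^+ 2)%:C.
  rewrite -vip_froE /T /gram (mev_gram Hact) rmorph_sum; apply: eq_bigr => l _.
  by rewrite (psdE fro_psd).
have nTE u : nr (cform entry) u = nT u by rewrite /nT vip_froE.
have HT u : 0 <= cform entry (T u) u /\
    complex.Re (cform entry (T u) u) <= L * nr (cform entry) u ^+ 2.
  rewrite T0 ler0c; split; first by apply: sumr_ge0 => l _; exact: sqr_ge0.
  have gb := gradient_bound (rows f) (Dtp f) u (le_trans ler01 r1) Xop.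
  by rewrite nTE; apply: le_trans gb _; rewrite ler_wpM2r ?sqr_ge0.
have t0 : 0 < p%:R^-1 :> R by rewrite invr_gt0.
(* The exponent is the largest that [spectral_cut] admits at the cut t = 1/p: both sides equal
   [L']. *)
have Nt : (L' * p ^ 2)%:R * p%:R^-1 ^+ 2 <= L / 2.
  rewrite natrM natrX exprVn mulfK ?expf_neq0 ?gt_eqF // /L mulrAC divff ?mul1r // pnatr_eq0.
have [P [psi [psiB nrpsi Pcard Pcut]]] :=
  spectral_cut (@entryL R d n) entryK entry_unit Tl L0 t0 HT Nt.
have Pb : #|P|%:R <= 2 * n%:R ^+ 2 * b.
  apply: le_trans Pcard _; rewrite -mulrA ler_pM2l //.
  have -> : \sum_i complex.Re (cform entry (iter (L' * p ^ 2) (fun u => u - L^-1%:C *: T u)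
      (unit_tuple i)) (unit_tuple i)) = complex.Re (n%:R ^+ 2 * \sum_j ttr (mxmoment X)
        (tmx_pow (tmx_compl L gram) (L' * p ^ 2) j j)).
    rewrite -trace_mev // Re_sum; apply: eq_bigr => q _.
    rewrite -vip_froE (mev_pow Hact); congr (complex.Re (vip fro _ _)).
    by apply: eq_iter => u; rewrite (mev_compl Hact).
  rewrite -natrX -(rmorph_nat (real_complex R)) Re_mul /= mul0r subr0 natrX.
  by rewrite ler_wpM2l ?sqr_ge0.
pose E Y j := F Y j - X j.
have C2 : codable Cl (fun Y Y' => \sum_(i | P i) normc (psi i (E Y) - psi i (E Y')) ^+ 2
     <= (eps / 32%:R) ^+ 2) (c0 * n%:R ^+ 2 * b).
  apply: codable_mono (@codable_vec R _ _ P (fun Y i => psi i (E Y)) 32 eps Cl eps0 isT _) _ (fun _ => id) (fun _ _ _ _ => id).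
    move=> Y CY; apply: (@le_trans _ _ (nT (E Y) ^+ 2)).
      rewrite -nTE -nrpsi [leRHS](bigID P) /= lerDl.
      by apply: sumr_ge0 => i _; exact: sqr_ge0.
    rewrite lerXn2r ?nnegrE ?nT_ge0 ?(ltW eps0) //.
    by have [_ le _] := HV _ CY.
  rewrite natrM -c0E; apply: le_trans (ler_wpM2r (ler0n R (4 + 20 * 32)) Pb) _.
  by rewrite le_eqVlt; apply/orP; left; apply/eqP; rewrite mulrAC [2 * _ * _]mulrAC.
have b'0 : 0 <= c0 * n%:R ^+ 2 * b by nneg.
apply: codable_mono (codable_and b'0 C1 C2) _ (fun _ => id) _.
  have q1 : 0 <= C * (size (finsupp f))%:R * (n%:R ^+ 2 * b) by nneg.
  have q2 : 0 <= c0 * (n%:R ^+ 2 / p%:R + n%:R) by nneg.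
  rewrite [leRHS](_ : _ = C * (size (finsupp f))%:R * (n%:R ^+ 2 / p%:R + n%:R) +
    c0 * n%:R ^+ 2 * b + (C * (size (finsupp f))%:R * (n%:R ^+ 2 * b) +
    c0 * (n%:R ^+ 2 / p%:R + n%:R))); last by ring.
  by rewrite lerDl addr_ge0.
move=> Y Y' CY CY' [h1 h2].
have [VV _ _] := HV _ CY; have [VV' _ _] := HV _ CY'.
have VVs := mulmx1C VV.
exists ((V Y)^t* *m V Y').
  by apply: unitaryM => //; rewrite trmxCK.
have -> : conjt ((V Y)^t* *m V Y') Y' - Y = conjt ((V Y)^t*) (F Y' - F Y).
  apply/funext => j; rewrite conjtM /conjt !fctE mulmxBr mulmxBl trmxCK.
  by rewrite /F /conjt !mulmxA VVs mul1mx -(mulmxA (Y j)) VVs mulmx1.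
rewrite nT_conj ?trmxCK //.
have -> : nT (F Y' - F Y) = nT (F Y - F Y') by exact: (nrBC nT_psd).
rewrite -(@ler_pXn2r _ 2) ?nnegrE ?nT_ge0 //; last first.
  by have E0' := ltW E00; nneg.
have EE : F Y - F Y' = E Y - E Y'.
  by apply/funext => j; rewrite /E !fctE; apply/matrixP => k l; rewrite !mxE; ring.
rewrite EE -nTE -nrpsi (bigID P) /=.
have h1' : \sum_(i | ~~ P i) normc (psi i (E Y - E Y')) ^+ 2 <= (eps / 32) ^+ 2.
  have := Pcut (E Y - E Y'); rewrite T0 /= exprVn ler_pdivrMl ?exprn_gt0 //.
  move/le_trans; apply.
  apply: (@le_trans _ _ (p%:R ^+ 2 * \sum_(l <- rows f) (small_at_scale E0 g' n p) ^+ 2)).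
    rewrite ler_wpM2l ?sqr_ge0 // big_seq [leRHS]big_seq; apply: ler_sum => l lr.
    rewrite lerXn2r ?nnegrE ?nF_ge0 ?smally_ge0 ?(ltW g'0) //.
    have -> : gradient (actX X) (Dtp f) (E Y - E Y') l = G Y l - G Y' l.
      rewrite /G /gradient -sumrB; apply: eq_bigr => j _.
      by rewrite -(linB (tev_linear Hact (Dtp f l j))).
    exact: h1.
  rewrite big_const_seq count_predT iter_addr_0 -mulr_natr -/R0 /small_at_scale -/eps.
  rewrite /g' [leLHS](_ : _ = (eps / 32) ^+ 2 / R0); last by field; rewrite !gt_eqF.
  by rewrite ler_piMr ?sqr_ge0 // invf_le1 // ler1n.
under eq_bigr do rewrite psiB.
apply: le_trans (lerD h2 h1') _.
rewrite [leRHS](_ : _ = (eps / 16) ^+ 2); last by rewrite /eps; field; rewrite gt_eqF.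
by clear; have := sqr_ge0 eps; rewrite !expr_div_n; lra.
Qed.

End Step.

Section Iteration.
Context {R : realType} {d : nat} {m : option nat} (f : nctuple R d m).

Lemma nT_le_opb n (X : 'I_d -> 'M[R[i]]_n) rho : 0 <= rho ->
  (forall j, opb (X j) rho) -> nT X <= rho * d.+1%:R * Num.sqrt n%:R.
Proof.
move=> r0 Xb; rewrite -(@ler_pXn2r _ 2) ?nnegrE ?nT_ge0 ?mulr_ge0 ?sqrtr_ge0 //.
have n1 : nF (1%:M : 'M[R[i]]_n) ^+ 2 = n%:R.
  by rewrite sqr_nFE trmx1 map_mx1 mulmx1 mxtrace1 -(rmorph_nat (real_complex R)).
rewrite sqr_nT !exprMn sqr_sqrtr ?ler0n //.
apply: (@le_trans _ _ (\sum_(j < d) rho ^+ 2 * n%:R)).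
  apply: ler_sum => j _; have [_ b _] := Xb j.
  have := b 1%:M; rewrite mulmx1 -n1 -exprMn => h.
  by rewrite lerXn2r ?nnegrE ?nF_ge0 ?mulr_ge0 ?nF_ge0.
rewrite sumr_const card_ord [leLHS](_ : _ = rho ^+ 2 * d%:R * n%:R); last by rewrite -[_ *+ d]mulr_natr; ring.
rewrite ler_wpM2r ?ler0n //.
rewrite ler_wpM2l ?sqr_ge0 // -natrX ler_nat.
by rewrite expnS expn1 (leq_trans (leqnSn d)) // leq_pmulr.
Qed.

Lemma codable_iterate (rho : R) (L' : nat) : 1 <= rho -> (0 < L')%N ->
  \sum_(l <- rows f) (\sum_j tbound rho (Dtp f l j)) ^+ 2 <= 2 * L'%:R ->
  exists E0 g C : R, [/\ 0 < E0, 0 < g, 0 <= C &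
  forall n K (Om : set ('I_d -> 'M[R[i]]_n)) (b : nat -> R), (0 < n)%N ->
  (forall k, 0 <= b k) ->
  (forall X V, Om X -> V *m V^t* = 1%:M -> Om (conjt V X)) ->
  (forall X, Om X -> [/\ forall j, (X j)^t* = X j /\ opb (X j) rho,
     forall k i, (k < K)%N -> i \in finsupp f ->
       nF (peval X (f i)) <= small_at_scale E0 g n (2 ^ k) &
     forall k, (k < K)%N -> complex.Re (\sum_j ttr (mxmoment X)
        (tmx_pow (tmx_compl (2 * L'%:R) (gram f)) (L' * (2 ^ k) ^ 2) j j)) <= b k]) ->
  codable Om (orb (E0 / (2 ^ K)%:R ^+ 4 * Num.sqrt n%:R))
    (C * (2 * n%:R ^+ 2 + K%:R * n%:R + n%:R ^+ 2 * \sum_(k < K) b k))].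
Proof.
move=> r1 L'0 HL; have r0 := le_trans ler01 r1.
(* [E0] exceeds the normalized diameter of the tuples bounded by [rho], so scale 0 needs no code. *)
pose E0 : R := 2 * (rho * d.+1%:R).
have E00 : 0 < E0 by rewrite !mulr_gt0 ?ltr0n // (lt_le_trans ltr01).
have [g [C [g0 C0 step]]] := codable_step r1 L'0 HL E00.
exists E0, g, C; split=> // n K Om b n0 b0 Oconj HOm.
suff : codable Om (orb (E0 / (2 ^ K)%:R ^+ 4 * Num.sqrt n%:R))
    (\sum_(k < K) (C * (n%:R ^+ 2 / (2 ^ k)%:R + n%:R + n%:R ^+ 2 * b k))).
  move=> H; apply: codable_mono H _ (fun _ => id) (fun _ _ _ _ => id).
  rewrite -mulr_sumr ler_wpM2l // !big_split /= -[in leLHS]mulr_sumr -[X in _ + X <= _]mulr_sumr.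
  rewrite lerD2r sumr_const card_ord -[n%:R *+ K]mulr_natl lerD2r mulrC ler_wpM2r ?sqr_ge0 //.
  suff -> : \sum_(i < K) (2 ^ i)%:R^-1 = 2 - 2 / (2 ^ K)%:R :> R.
    by rewrite lerBlDr lerDl divr_ge0.
  elim: (K) => [|k IH]; first by rewrite big_ord0 expn0 divr1 subrr.
  rewrite big_ord_recr /= IH expnS natrM; field.
  by rewrite pnatr_eq0 expn_eq0.
elim: K HOm => [|K IH] HOm.
  rewrite big_ord0; apply: codable_triv => // Y Y' OY OY'.
  exists 1%:M; first by rewrite trmx1 map_mx1 mulmx1.
  have -> : conjt 1%:M Y' = Y'.
    by apply/funext => j; rewrite /conjt trmx1 map_mx1 mulmx1 mul1mx.
  apply: le_trans (nrB nT_psd _ _) _.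
  have [HY _ _] := HOm _ OY; have [HY' _ _] := HOm _ OY'.
  have b1 := nT_le_opb r0 (fun j => proj2 (HY j)).
  have b2 := nT_le_opb r0 (fun j => proj2 (HY' j)).
  apply: le_trans (lerD b2 b1) _.
  by rewrite expn0 expr1n divr1 /E0 mulr_natl mulr2n mulrDl.
rewrite big_ord_recr /=; apply: codable_refine.
- by rewrite mulr_ge0 ?addr_ge0 ?mulr_ge0 ?divr_ge0 ?sqr_ge0 ?b0.
- apply: IH => X OX; have [h1 h2 h3] := HOm _ OX; split=> // [k i kK|k kK].
    by apply: h2; rewrite ltnS ltnW.
  by apply: h3; rewrite ltnS ltnW.
move=> X OX; rewrite (_ : E0 / (2 ^ K.+1)%:R ^+ 4 = E0 / (2 ^ K)%:R ^+ 4 / 16).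
  apply: step => //; first by rewrite expn_gt0.
  by move=> Y OY; have [h1 h2 h3] := HOm _ OY; split=> // [i|]; [apply: h2|apply: h3].
rewrite expnS natrM; field.
by rewrite pnatr_eq0 expn_eq0.
Qed.

Lemma mxnorm2_le n (A : @mxtuple R d n) e : (0 < n)%N -> 0 <= e ->
  nT A <= e * Num.sqrt n%:R -> mxnorm2 A <= e.
Proof.
move=> n0 e0; have n0' : 0 < n%:R :> R by rewrite ltr0n.
rewrite -(@ler_pXn2r _ 2) ?nnegrE ?nT_ge0 ?mulr_ge0 ?sqrtr_ge0 // => h.
rewrite /mxnorm2 -[e]ger0_norm // -sqrtr_sqr ler_wsqrtr //.
have -> : complex.Re (\sum_j mxtr ((A j)^t* *m A j)) = nT A ^+ 2 / n%:R.
  rewrite sqr_nT mulr_suml Re_sum; apply: eq_bigr => j _.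
  rewrite /mxtr -(rmorph_nat (real_complex R)) -fmorphV Re_mul /= mul0r subr0.
  by rewrite mxtrace_mulC -sqr_nFE mulrC.
by rewrite ler_pdivrMr // (le_trans h) // exprMn sqr_sqrtr ?ler0n.
Qed.

(** One element of each nonempty code class gives an orbital cover; empty classes receive the
    default tuple 0, which does no harm. *)
Lemma Korb_le n (Om : set (@mxtuple R d n)) (e eps kappa : R) : (0 < n)%N -> 0 <= e ->
  e < eps -> codable Om (fun A B => orb (e * Num.sqrt n%:R) A B) kappa ->
  (Korb eps Om <= (expR kappa)%:E)%E.
Proof.
move=> n0 e0 ee [M [c [Mk H]]].
have /choice[rep repP] (i : 'I_M) : exists B, (exists2 A, Om A & c A = i) -> Om B /\ c B = i.
  have [[A OA cA]|no] := pselect (exists2 A, Om A & c A = i); first by exists A.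
  by exists [ffun=> 0].
pose Xi := [fset rep i | i in 'I_M]%fset.
apply: (@le_trans _ _ (#|` Xi|%:R)%:E); last first.
  rewrite lee_fin; apply: le_trans Mk; rewrite ler_nat.
  by apply: leq_trans (leq_imfset_card _ _ _) _; rewrite -cardE card_ord.
apply: ereal_inf_lbound; exists Xi => // A OA.
have [OB cB] := repP (c A) (ex_intro2 _ _ A OA erefl).
exists (rep (c A)).
have [V VV le] := H _ _ OA OB (esym cB).
exists V; split; first by apply/imfsetP; exists (c A).
  exact/unitarymxP.
apply: le_lt_trans ee; apply: mxnorm2_le => //.
apply: le_trans le; rewrite [leRHS](nrBC nT_psd) le_eqVlt; apply/orP; left; apply/eqP.
by congr (nr (vip fro) _); apply/funext => j; rewrite ffunE.
Qed.

Lemma h_open_le (eps c : R) (O : set (@ncfun R d)) n0 :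
  (forall n, (n0 <= n)%N -> (0 < n)%N ->
     (Korb eps (@microstates R d O n) <= (expR (c * n%:R ^+ 2))%:E)%E) ->
  (h_open eps O <= c%:E)%E.
Proof.
move=> H; apply: ereal_inf_le; exists (ereal_sup ((fun n =>
   ((n%:R ^+ 2)^-1)%:E * lne (Korb eps (@microstates R d O n)))%E @` [set n | (n0.+1 <= n)%N])).
  (* The tail starts at [n0.+1] so that n is positive even when [n0 = 0]. *)
  exists [set n | (n0.+1 <= n)%N] => //.
  by exists n0.+1.
apply: ge_ereal_sup => _ [n /= n0n <-].
have np : (0 < n)%N by exact: leq_ltn_trans n0n.
have npR : 0 < n%:R ^+ 2 :> R by rewrite exprn_gt0 // ltr0n.
have le : (lne (Korb eps (@microstates R d O n)) <= (c * n%:R ^+ 2)%:E)%E.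
  rewrite -[leRHS]expeRK lee_lne ?in_itv /= ?leey ?andbT.
  - by apply: H => //; exact: ltnW.
  - by apply: le_ereal_inf_tmp => _ [Xi _ <-]; rewrite lee_fin ler0n.
  - by rewrite lee_fin expR_ge0.
apply: le_trans (lee_wpmul2l _ le) _; first by rewrite lee_fin invr_ge0 ltW.
by rewrite -EFinM lee_fin mulrC mulfK // gt_eqF.
Qed.

End Iteration.

(** * Spectral resolutions *)

Section SpectralMeasure.
Context {R : realType} (V : lmodType R[i]) (f : V -> V -> R[i]) (Hf : psd f).
Hypothesis f_def : forall u, nr f u = 0 -> u = 0.
Variables (S : V -> V) (E : set (measurableTypeR R) -> V -> V).
Hypothesis Sl : linear S.
Hypothesis Sp : forall u, 0 <= f (S u) u.
Hypothesis El : forall X, measurable X -> linear (E X).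
Hypothesis Es : forall X u v, measurable X -> f (E X u) v = f u (E X v).
Hypothesis ET : forall u, E setT u = u.
Hypothesis EI : forall X Y u, measurable X -> measurable Y ->
  E (X `&` Y) u = E X (E Y u).
Hypothesis Eint : forall u,
  exists nu : {measure set (measurableTypeR R) -> \bar R},
  [/\ forall X, measurable X -> nu X = (complex.Re (f (E X u) u))%:E,
      nu.-integrable setT (fun t => t%:E) & f (S u) u = (\int[nu]_t t)%:C].

Lemma Ess X Y u : measurable X -> measurable Y -> E X (E Y u) = E Y (E X u).
Proof. by move=> mX mY; rewrite -!EI // setIC. Qed.

Lemma Eid X u : measurable X -> E X (E X u) = E X u.
Proof. by move=> mX; rewrite -EI // setIid. Qed.

Lemma E_nr X u : measurable X -> complex.Re (f (E X u) u) = nr f (E X u) ^+ 2.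
Proof. by move=> mX; rewrite (sqr_nr Hf) [in RHS]Es // Eid // -Es. Qed.

Lemma E_compl X u : measurable X -> u = E X u + E (~` X) u.
Proof.
move=> mX; have mX' : measurable (~` X) by exact: measurableC.
apply/eqP; rewrite -subr_eq0; apply/eqP; apply: f_def; apply/eqP; rewrite -sqrf_eq0.
have [nu [nuE _ _]] := Eint u.
have : (nu setT = nu X + nu (~` X))%E.
  by rewrite -(setUv X) measureU // setICr.
rewrite !nuE // ET -EFinD => -[e].
have X0 : f (E X u) (E (~` X) u) = 0.
  rewrite Es // -EI // setICr.
  have [nu' [nu'E _ _]] := Eint (E set0 u).
  apply: eq0_normc; apply/eqP; rewrite eq_le normc_ge0 andbT.
  apply: le_trans (psd_CS Hf _ _) _.
  suff -> : nr f (E set0 u) = 0 by rewrite mulr0.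
  apply/eqP; rewrite -sqrf_eq0 -E_nr //; have := nuE set0 measurable0.
  by rewrite measure0 => -[<-].
rewrite (sqr_nrD Hf) (nrN Hf) (psdNr Hf) (psdDr Hf) (sqr_nrD Hf) X0 ReN ReD.
rewrite -!Es // -!E_nr // (sqr_nr Hf) e; apply/eqP; rewrite /=; ring.
Qed.

(** Only the quadratic form of [S] is given as an integral. For [v] in the range and [w] in the
    kernel of [E Y] the cross terms vanish, so the measure of [v + z w] is the sum of those of [v]
    and [z w]. The form of [S] is then additive too, and z = 1, z = i give [f (S v) w = 0]. *)
Lemma S_commutes_E Y u : measurable Y -> S (E Y u) = E Y (S u).
Proof.
move=> mY.
have Ssym := pos_symmetric Hf Sl Sp.
have orth v w : E Y v = v -> E Y w = 0 -> f (S v) w = 0.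
  move=> Ev Ew.
  have cross X : measurable X -> f (E X v) w = 0.
    by move=> mX; rewrite -Ev Ess // Es // Ew (psd0r Hf).
  have cross' X : measurable X -> f (E X w) v = 0.
    by move=> mX; rewrite Es // (psd_herm Hf) cross // conjC0.
  have key z : z * z^* = 1 -> complex.Re (z^* * f (S v) w) = 0.
    move=> z1.
    have [n1 [n1E n1i n1S]] := Eint v; have [n2 [n2E n2i n2S]] := Eint (z *: w).
    have [n3 [n3E n3i n3S]] := Eint (v + z *: w).
    have zw X : measurable X -> complex.Re (f (E X (z *: w)) (z *: w)) = complex.Re (f (E X w) w).
      by move=> mX; rewrite (linZ (El mX)) (psdZl Hf) (psdZr Hf) mulrA z1 mul1r.
    have n3a X : measurable X -> n3 X = measure_add n1 n2 X.
      move=> mX; rewrite measure_addE n1E // n2E // n3E // -EFinD; congr _%:E.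
      rewrite (linD (El mX)) (linZ (El mX)) !(psdDl Hf) !(psdDr Hf) !(psdZl Hf) !(psdZr Hf).
      by rewrite cross // cross' // !mulr0 addr0 add0r ReD.
    have Sw : f (S (v + z *: w)) (v + z *: w) = f (S v) v + f (S (z *: w)) (z *: w).
      rewrite n1S n2S n3S -rmorphD; congr _%:C; rewrite /Rintegral.
      rewrite (eq_measure_integral (measure_add n1 n2)); last first.
        by move=> X mX _; exact: n3a.
      rewrite integral_measure_add // fineD //; exact: integrable_fin_num.
    have := congr1 (@complex.Re R) Sw.
    rewrite (linD Sl) !(psdDl Hf) !(psdDr Hf) !ReD (Ssym (z *: w) v).
    rewrite (psd_herm Hf (S v) (z *: w)) -[complex.Re (_^*)]/(complex.Re _).
    rewrite (psdZr Hf) => h.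
    have hh : complex.Re ((z^* * f (S v) w)^*) = complex.Re (z^* * f (S v) w).
      by rewrite conjE.
    lra.
  have k1 : complex.Re (f (S v) w) = 0 by have := key 1; rewrite rmorph1 !mul1r; apply.
  have ii : 'i%C * ('i%C)^* = 1 :> R[i] by apply: complex_ext => /=; ring.
  have := key 'i%C ii; rewrite Re_mul conjE /= => k2.
  by apply: complex_ext => /=; lra.
have mY' : measurable (~` Y) by exact: measurableC.
have EE' z : E Y (E (~` Y) z) = 0.
  have := E_compl (E Y z) mY; rewrite Eid // => /eqP.
  by rewrite -{1}[E Y z]addr0 -Ess // => /eqP /addrI.
have orth' v w : E Y v = 0 -> E Y w = w -> f (S v) w = 0.
  by move=> v0 w1; rewrite Ssym (psd_herm Hf) orth // conjC0.
have dec w : f (S (E Y u) - E Y (S u)) w = 0.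
  rewrite (psdBl Hf) Es //.
  have -> : f (S (E Y u)) w = f (S (E Y u)) (E Y w).
    by rewrite {1}(E_compl w mY) (psdDr Hf) (orth _ (E (~` Y) w)) ?addr0 ?Eid.
  have -> : f (S u) (E Y w) = f (S (E Y u)) (E Y w).
    by rewrite {1}(E_compl u mY) (linD Sl) (psdDl Hf) (orth' (E (~` Y) u)) ?addr0 ?Eid.
  by rewrite subrr.
apply/eqP; rewrite -subr_eq0; apply/eqP; apply: f_def; apply/eqP.
by rewrite -sqrf_eq0 (sqr_nr Hf) dec.
Qed.

Lemma concentrated_integral (A : set (measurableTypeR R)) u : measurable A ->
  E A u = u ->
  exists nu : {measure set (measurableTypeR R) -> \bar R},
  [/\ nu A = (nr f u ^+ 2)%:E, nu.-integrable A (fun t => t%:E),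
      forall c : R, nu.-integrable A (fun=> c%:E)
    & complex.Re (f (S u) u) = \int[nu]_(t in A) t].
Proof.
move=> mA Eu; have [nu [nuE nui nuS]] := Eint u; exists nu.
have nuA : nu A = (nr f u ^+ 2)%:E by rewrite nuE // Eu (sqr_nr Hf).
have mA' : measurable (~` A) by exact: measurableC.
have nuA' : nu (~` A) = 0.
  have : (nu setT = nu A + nu (~` A))%E.
    by rewrite -(setUv A) measureU // setICr.
  rewrite nuA [nu setT]nuE // ET (nuE (~` A)) // (sqr_nr Hf) -EFinD => -[] e.
  by congr _%:E; lra.
split=> //.
- exact: integrableS nui.
- move=> c; apply/integrableP; split; first exact: measurable_cst.
  under eq_integral do rewrite abse_EFin.
  by rewrite integral_cst // nuA -EFinM ltry.
- rewrite nuS /= /Rintegral (negligible_integral mA' measurableT nui nuA').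
  by rewrite setTD setCK.
Qed.

Lemma S_le (a : R) (A : set (measurableTypeR R)) u : measurable A ->
  (forall t, A t -> t <= a) -> E A u = u ->
  complex.Re (f (S u) u) <= a * nr f u ^+ 2.
Proof.
move=> mA Aa Eu; have [nu [nuA i1 i2 ->]] := concentrated_integral mA Eu.
have -> : nr f u ^+ 2 = fine (nu A) by rewrite nuA.
rewrite -Rintegral_cst //; apply: le_Rintegral => //; exact: i2.
Qed.

Lemma S_ge (b : R) (A : set (measurableTypeR R)) u : measurable A ->
  (forall t, A t -> b <= t) -> E A u = u ->
  b * nr f u ^+ 2 <= complex.Re (f (S u) u).
Proof.
move=> mA Aa Eu; have [nu [nuA i1 i2 ->]] := concentrated_integral mA Eu.
have -> : nr f u ^+ 2 = fine (nu A) by rewrite nuA.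
rewrite -Rintegral_cst //; apply: le_Rintegral => //; exact: i2.
Qed.

Let Lo (a : R) : set (measurableTypeR R) := [set t | t < a].
Let Hi (a : R) : set (measurableTypeR R) := [set t | a <= t].

Lemma measurable_Lo a : measurable (Lo a).
Proof. by have := @measurable_itv R `]-oo, a[; rewrite set_itvE. Qed.

Lemma measurable_Hi a : measurable (Hi a).
Proof. by have := @measurable_itv R `[a, +oo[; rewrite set_itvE. Qed.

Lemma Lo_compl a : ~` (Lo a) = Hi a.
Proof.
apply/seteqP; split=> t; rewrite /Lo /Hi /=; first by move/negP; rewrite -leNgt.
by move=> h; apply/negP; rewrite -leNgt.
Qed.

Lemma E_neg (b : R) u : b < 0 -> E (Lo b) u = 0.
Proof.
move=> b0; have mb := measurable_Lo b; apply: f_def; apply/eqP; rewrite -sqrf_eq0.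
have := S_le mb (fun t => @ltW _ _ t b) (Eid u mb).
have := Sp (E (Lo b) u); rewrite lecE => /andP[_ h1] h2.
have h3 := sqr_ge0 (nr f (E (Lo b) u)).
by apply/eqP; apply/eqP; rewrite eq_le h3 andbT -(nmulr_rge0 _ b0); apply: le_trans h1 h2.
Qed.

Lemma E_zero (b : R) u : (forall v, S v = 0) -> 0 < b -> E (Hi b) u = 0.
Proof.
move=> S0 b0; have mb := measurable_Hi b; apply: f_def; apply/eqP; rewrite -sqrf_eq0.
have := S_ge mb (fun t h => h) (Eid u mb); rewrite S0 (psd0l Hf) /= pmulr_rle0 // => h.
by rewrite eq_le h sqr_ge0.
Qed.

(* Compare the growth of both sides of [W G^k = G^k W] as [k] tends to infinity. *)
Lemma intertwiner0 (G W : V -> V) (P Q : V -> Prop) (alpha beta c : R) :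
  0 <= beta -> beta < alpha -> 0 <= c ->
  (forall u, P u -> P (G u)) -> (forall u, Q u -> Q (G u)) ->
  (forall u, P u -> nr f (G u) <= beta * nr f u) ->
  (forall u, Q u -> alpha * nr f u <= nr f (G u)) ->
  (forall u, P u -> Q (W u)) -> (forall u, P u -> W (G u) = G (W u)) ->
  (forall u, nr f (W u) <= c * nr f u) ->
  forall u, P u -> W u = 0.
Proof.
move=> b0 ab c0 PG QG Gb Ga PQ WG Wc u Pu.
have a0 : 0 < alpha by exact: le_lt_trans ab.
have PI k : P (iter k G u) by elim: k => //= k IH; exact: PG.
have QI k : Q (iter k G (W u)) by elim: k => [|k IH] /=; [exact: PQ|exact: QG].
have WI k : W (iter k G u) = iter k G (W u).
  by elim: k => //= k IH; rewrite WG // IH.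
have up k : nr f (iter k G u) <= beta ^+ k * nr f u.
  elim: k => [|k IH]; first by rewrite mul1r.
  by rewrite exprS -mulrA (le_trans (Gb _ (PI k))) // ler_wpM2l.
have lo k : alpha ^+ k * nr f (W u) <= nr f (iter k G (W u)).
  elim: k => [|k IH]; first by rewrite mul1r.
  by rewrite exprS -mulrA; apply: le_trans (Ga _ (QI k)); rewrite ler_pM2l.
apply: f_def; apply/eqP; rewrite eq_le nr_ge0 andbT leNgt; apply/negP => w0.
have key k : nr f (W u) <= (beta / alpha) ^+ k * (c * nr f u).
  rewrite expr_div_n mulrAC ler_pdivlMr ?exprn_gt0 // mulrC.
  apply: le_trans (lo k) _; rewrite -WI; apply: le_trans (Wc _) _.
  by rewrite mulrCA ler_wpM2l.
have q1 : `|beta / alpha| < 1.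
  by rewrite ger0_norm ?divr_ge0 // ?(ltW a0) // ltr_pdivrMr // mul1r.
have := cvg_geometric (c * nr f u) q1.
move/cvgrPdist_lt => /(_ _ w0) [N _] /(_ N (leqnn N)) /=.
rewrite sub0r normrN ger0_norm; last first.
  by rewrite mulr_ge0 ?exprn_ge0 ?divr_ge0 ?(ltW a0) // mulr_ge0 ?nr_ge0.
by rewrite mulrC ltNge key.
Qed.

Lemma E_contr X u : measurable X -> nr f (E X u) <= nr f u.
Proof.
move=> mX; have [e0|e0] := eqVneq (nr f (E X u)) 0; first by rewrite e0 nr_ge0.
have ep : 0 < nr f (E X u) by rewrite lt_def e0 nr_ge0.
rewrite -(ler_pM2l ep) -expr2 -E_nr //.
exact: le_trans (Re_le_normc _) (psd_CS Hf _ _).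
Qed.

(** Supplies the gap between [a'] and [a] that [intertwiner0] needs, by continuity from below of the
    measure of [u]. *)
Lemma E_left_continuous a u e : 0 < a -> 0 < e ->
  exists a', [/\ 0 < a', a' < a & nr f (E (Lo a) u - E (Lo a') u) < e].
Proof.
move=> a0 e0; have [nu [nuE nui _]] := Eint u.
pose an n := a - a / n.+2%:R.
have an_lt n : an n < a by rewrite /an ltrBlDr ltrDl divr_gt0 ?ltr0n.
have an_gt n : 0 < an n by rewrite /an subr_gt0 ltr_pdivrMr ?ltr0n // ltr_pMr // ltr1n.
have mL := measurable_Lo.
have U : \bigcup_n Lo (an n) = Lo a.
  apply/seteqP; split=> [t [n _] /= h|t /= h]; first exact: lt_trans h (an_lt n).
  have h' : 0 < a - t by rewrite subr_gt0.
  exists (Num.truncn (a / (a - t))) => //=; rewrite /Lo /an /=.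
  rewrite ltrBrDr addrC -ltrBrDr ltr_pdivrMr ?ltr0n // mulrC -ltr_pdivrMr //.
  apply: lt_trans (truncnS_gt _) _; by rewrite ltr_nat.
have := @nondecreasing_cvg_mu _ _ _ nu (fun n => Lo (an n)) (fun n => mL _).
rewrite U => /(_ (mL _)) cv.
have {}cv : (nu \o (fun n => Lo (an n))) @ \oo --> nu (Lo a).
  apply: cv => m n mn; apply/subsetPset => t /= h; apply: lt_le_trans h _.
  rewrite /an lerD2l lerN2 ler_pM2l // lef_pV2 ?posrE ?ltr0n // ler_nat.
  by [].
have nuL b : nu (Lo b) = (nr f (E (Lo b) u) ^+ 2)%:E by rewrite nuE // E_nr.
have e2 : 0 < e ^+ 2 by rewrite exprn_gt0.
have [n Hn] : exists n, nr f (E (Lo a) u) ^+ 2 - e ^+ 2 < nr f (E (Lo (an n)) u) ^+ 2.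
  apply: contrapT => no.
  have : (nu (Lo a) <= (nr f (E (Lo a) u) ^+ 2 - e ^+ 2)%:E)%E.
    rewrite -(cvg_lim _ cv) //; apply: lime_le; first exact: cvgP cv.
    apply: nearW => n /=; rewrite nuL lee_fin leNgt; apply/negP => h.
    by apply: no; exists n.
  by rewrite nuL lee_fin; lra.
exists (an n); split=> //.
rewrite -(@ltr_pXn2r _ 2) ?nnegrE ?nr_ge0 ?(ltW e0) //.
have sub : Lo (an n) `&` Lo a = Lo (an n).
  by apply/setIidPl => t /= h; exact: lt_trans h (an_lt n).
have p' : E (Lo (an n)) u = E (Lo (an n)) (E (Lo a) u) by rewrite -EI // sub.
rewrite (sqr_nrD Hf) (nrN Hf) (psdNr Hf) ReN.
have -> : complex.Re (f (E (Lo a) u) (E (Lo (an n)) u)) = nr f (E (Lo (an n)) u) ^+ 2.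
  by rewrite {1}p' -Es // E_nr // -p'.
lra.
Qed.

(** An elementary substitute for functional calculus: the off-diagonal blocks of [T] between
    spectral subspaces separated by a gap intertwine restrictions of S^2 with different growth
    rates, hence vanish; left continuity then closes the gap. *)
Lemma E_commutant (T : V -> V) (c L a : R) : linear T -> 0 <= c -> 0 < a ->
  (forall u, nr f (T u) <= c * nr f u) ->
  (forall u, nr f (S u) ^+ 2 <= L * nr f u ^+ 2) ->
  (forall u, T (S (S u)) = S (S (T u))) ->
  forall u, T (E (Lo a) u) = E (Lo a) (T u).
Proof.
move=> Tl c0 a0 Tc SL TS.
have mL := measurable_Lo; have mH := measurable_Hi.
have Ssym := pos_symmetric Hf Sl Sp.
have SE := S_commutes_E.
have WS X u : measurable X -> E X u = u -> E X (S u) = S u.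
  by move=> mX e; rewrite -SE // e.
have PE X : measurable X -> linear (fun u => E X (T u)).
  by move=> mX z u v; rewrite Tl (El mX).
have Wc X u : measurable X -> nr f (E X (T u)) <= c * nr f u.
  by move=> mX; apply: le_trans (E_contr _ mX) (Tc u).
have hiS u : E (Hi a) u = u -> a * nr f u <= nr f (S u).
  apply: (pos_nr_ge Hf (W := fun u => E (Hi a) u = u)) => [|v]; first exact: ltW.
  by apply: S_ge.
have loS a' u : 0 <= a' -> E (Lo a') u = u -> nr f (S u) <= a' * nr f u.
  move=> a'0; apply: (pos_nr_le Hf Sl Sp (W := fun u => E (Lo a') u = u)) => // v.
    exact: WS.
  by apply: S_le => // t /ltW.
have stepA a' u : 0 < a' -> a' < a -> E (Lo a') u = u -> E (Hi a) (T u) = 0.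
  move=> a'0 a'a.
  apply: (@intertwiner0 (fun u => S (S u)) (fun u => E (Hi a) (T u))
     (fun u => E (Lo a') u = u) (fun u => E (Hi a) u = u) (a ^+ 2) (a' ^+ 2) c) => //.
  - exact: sqr_ge0.
  - by rewrite ltrXn2r // ltW.
  - by move=> v h; rewrite -!SE // h.
  - by move=> v h; rewrite -!SE // h.
  - move=> v h; rewrite expr2 -mulrA.
    apply: le_trans (loS _ _ (ltW a'0) (WS _ _ (mL _) h)) _.
    by rewrite ler_wpM2l ?(ltW a'0) // loS // ltW.
  - move=> v h; rewrite expr2 -mulrA.
    apply: le_trans (hiS _ (WS _ _ (mH _) h)).
    by rewrite ler_wpM2l ?(ltW a0) // hiS.
  - by move=> v _; rewrite Eid.
  - by move=> v _; rewrite TS -!SE.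
  - by move=> v; exact: Wc.
(* For the opposite block the order must be reversed: M - S^2 is larger on the low subspace.
   [M >= L] makes it positive and [M >= a ^ 2] makes the rates nonnegative. *)
pose M := Num.max L (a ^+ 2).
pose G u := M%:C *: u - S (S u).
have Gl : linear G.
  move=> z u v; rewrite /G Sl Sl scalerDr scalerBr !scalerA [z * _]mulrC.
  by rewrite opprD addrACA.
have GE u : f (G u) u = (M * nr f u ^+ 2 - nr f (S u) ^+ 2)%:C.
  by rewrite /G (psdBl Hf) (psdZl Hf) Ssym !(psdE Hf) -rmorphM -rmorphB.
have Gp u : 0 <= f (G u) u.
  rewrite GE ler0c subr_ge0; apply: le_trans (SL u) _.
  by rewrite ler_wpM2r ?sqr_ge0 // le_max lexx.
have EG X u : measurable X -> E X (G u) = G (E X u).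
  by move=> mX; rewrite /G (linB (El mX)) (linZ (El mX)) -!SE.
have Ma : a ^+ 2 <= M by rewrite le_max lexx orbT.
have stepB a' u : 0 < a' -> a' < a -> E (Hi a) u = u -> E (Lo a') (T u) = 0.
  move=> a'0 a'a.
  have aa : a' ^+ 2 < a ^+ 2 by rewrite ltrXn2r // ltW.
  apply: (@intertwiner0 G (fun u => E (Lo a') (T u))
     (fun u => E (Hi a) u = u) (fun u => E (Lo a') u = u) (M - a' ^+ 2) (M - a ^+ 2) c) => //.
  - by rewrite subr_ge0.
  - by rewrite ltrD2l ltrN2.
  - by move=> v h; rewrite EG // h.
  - by move=> v h; rewrite EG // h.
  - apply: (pos_nr_le Hf Gl Gp (W := fun u => E (Hi a) u = u)) => [v h||v h].
    + by rewrite EG // h.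
    + by rewrite subr_ge0.
    + rewrite GE mulrBl /= lerD2l lerN2 -exprMn lerXn2r ?nnegrE ?nr_ge0 ?mulr_ge0 ?nr_ge0 ?(ltW a0) //.
      exact: hiS.
  - apply: (pos_nr_ge Hf (W := fun u => E (Lo a') u = u)) => [|v h].
      by rewrite subr_ge0; apply: le_trans (ltW aa) Ma.
    rewrite GE mulrBl /= lerD2l lerN2 -exprMn lerXn2r ?nnegrE ?nr_ge0 ?mulr_ge0 ?nr_ge0 ?(ltW a'0) //.
    by apply: loS => //; exact: ltW.
  - by move=> v _; rewrite Eid.
  - move=> v _; rewrite -EG // /G (linB Tl) (linZ Tl) TS.
    by [].
  - by move=> v; exact: Wc.
have small (v : V) (C : R) : 0 < C -> (forall e, 0 < e -> nr f v <= C * e) -> v = 0.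
  move=> C0 H; apply: f_def; apply/eqP; rewrite eq_le nr_ge0 andbT leNgt; apply/negP => v0.
  have := H (nr f v / (2 * C)); rewrite divr_gt0 ?mulr_gt0 // => /(_ isT).
  rewrite [C * _](_ : _ = nr f v / 2); last by field; rewrite gt_eqF.
  by move: v0; lra.
have FTE u : E (Hi a) (T (E (Lo a) u)) = 0.
  apply: (small _ (c + 1)) => [|e e0]; first by rewrite ltr_wpDl.
  have [a' [a'0 a'a le]] := E_left_continuous u a0 e0.
  have -> : E (Hi a) (T (E (Lo a) u)) = E (Hi a) (T (E (Lo a) u - E (Lo a') u)).
    rewrite (linB (PE _ (mH a))) (stepA a' (E (Lo a') u)) ?subr0 //.
    by rewrite Eid.
  apply: le_trans (Wc _ _ (mH a)) _; apply: ler_pM => //; rewrite ?nr_ge0 ?(ltW le) //.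
  by rewrite lerDl.
have ETF u : E (Hi a) u = u -> E (Lo a) (T u) = 0.
  move=> h; apply: (small _ 1) => // e e0.
  have [a' [a'0 a'a le]] := E_left_continuous (T u) a0 e0.
  by move: le; rewrite (stepB a' u) // subr0 mul1r => /ltW.
move=> u.
have LC v : v = E (Lo a) v + E (Hi a) v by rewrite -Lo_compl; exact: E_compl.
rewrite (LC (T (E (Lo a) u))) FTE addr0.
rewrite [in RHS](LC u) (linD Tl) (linD (El (mL a))) (ETF (E (Hi a) u)) ?addr0 //.
by rewrite Eid.
Qed.

(** The operator form of (1 - t^2/L)^N <= 1_{t < a} + (1 - a^2/L)^N for 0 <= t^2 <= L, obtained by
    splitting [u] along [E (Lo a)] and [E (Hi a)], which [B] preserves. *)
Lemma iter_compl_le (L a : R) (N : nat) : 0 < L -> 0 <= a -> a ^+ 2 <= L ->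
  (forall u, nr f (S u) ^+ 2 <= L * nr f u ^+ 2) ->
  forall u, let B := fun v => v - L^-1%:C *: S (S v) in
  0 <= f (iter N B u) u /\
  complex.Re (f (iter N B u) u) <=
    complex.Re (f (E (Lo a) u) u) + (1 - a ^+ 2 / L) ^+ N * nr f u ^+ 2.
Proof.
move=> L0 a0 aL SL u B.
have mL := measurable_Lo a; have mH := measurable_Hi a.
have Ssym := pos_symmetric Hf Sl Sp.
have Bl : linear B.
  move=> z v w; rewrite /B Sl Sl scalerDr scalerBr !scalerA [z * _]mulrC.
  by rewrite opprD addrACA.
have BE v : f (B v) v = (nr f v ^+ 2 - nr f (S v) ^+ 2 / L)%:C.
  rewrite /B (psdBl Hf) (psdZl Hf) Ssym !(psdE Hf) -rmorphM -rmorphB mulrC.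
  by [].
have Bp v : 0 <= f (B v) v.
  by rewrite BE ler0c subr_ge0 ler_pdivrMr // mulrC.
have EB X v : measurable X -> E X (B v) = B (E X v).
  by move=> mX; rewrite /B (linB (El mX)) (linZ (El mX)) -!S_commutes_E.
have EBN X v k : measurable X -> E X (iter k B v) = iter k B (E X v).
  by move=> mX; elim: k => //= k IH; rewrite EB // IH.
have B1 := @pos_iter_form _ _ f Hf B Bl Bp (fun=> True) 1 (fun _ _ => I) ler01.
have {}B1 v : 0 <= f (iter N B v) v /\ complex.Re (f (iter N B v) v) <= nr f v ^+ 2.
  have [|//|h1 h2] := B1 _ N v => [w _|].
    by rewrite mul1r BE /= gerBl divr_ge0 ?sqr_ge0 // ltW.
  by split=> //; move: h2; rewrite expr1n mul1r.
split; first by have [] := B1 u.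
have q0 : 0 <= 1 - a ^+ 2 / L by rewrite subr_ge0 ler_pdivrMr // mul1r.
have B2 v : E (Hi a) v = v -> complex.Re (f (iter N B v) v) <= (1 - a ^+ 2 / L) ^+ N * nr f v ^+ 2.
  have WB w : E (Hi a) w = w -> E (Hi a) (B w) = B w by move=> h; rewrite EB // h.
  have WS w : E (Hi a) w = w ->
      complex.Re (f (B w) w) <= (1 - a ^+ 2 / L) * nr f w ^+ 2.
    move=> h; rewrite BE /= mulrBl mul1r lerD2l lerN2 mulrAC ler_pM2r ?invr_gt0 //.
    rewrite -exprMn lerXn2r ?nnegrE ?nr_ge0 ?mulr_ge0 ?nr_ge0 //.
    by apply: (pos_nr_ge Hf (W := fun u => E (Hi a) u = u)) h => // z hz; apply: S_ge hz.
  by move=> Ev; have [] := pos_iter_form Hf Bl Bp WB q0 WS N Ev.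
have LC : u = E (Lo a) u + E (Hi a) u by rewrite -Lo_compl; exact: E_compl.
set p := E (Lo a) u in LC *; set q := E (Hi a) u in LC.
have Ep : E (Lo a) p = p by rewrite Eid.
have Eq0 : E (Lo a) q = 0.
  have := E_compl p mL; rewrite Lo_compl Ep => /eqP.
  rewrite -{1}[p]addr0 (inj_eq (addrI p)) /p /q -Ess // => /eqP <-.
  by [].
have iB0 k : iter k B 0 = 0.
  by elim: k => //= k ->; rewrite (lin0 Bl).
have iBD v w k : iter k B (v + w) = iter k B v + iter k B w.
  by elim: k => //= k ->; rewrite (linD Bl).
have c1 : f (iter N B p) q = 0.
  by rewrite -[p]Ep -EBN // Es // Eq0 (psd0r Hf).
have c2 : f (iter N B q) p = 0.
  by rewrite -[p]Ep -Es // EBN // Eq0 iB0 (psd0l Hf).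
have -> : f (iter N B u) u = f (iter N B p) p + f (iter N B q) q.
  by rewrite LC iBD (psdDl Hf) !(psdDr Hf) c1 c2 addr0 add0r.
rewrite ReD lerD //.
  by have [_ h] := B1 p; rewrite E_nr.
apply: le_trans (B2 q _) _; first by rewrite Eid.
rewrite ler_wpM2l ?exprn_ge0 // lerXn2r ?nnegrE ?nr_ge0 //.
exact: E_contr.
Qed.

End SpectralMeasure.

(** * Operators, states and tensor products *)

Section HilbertSpace.
Context {R : realType} {H : hilbert R}.
Implicit Types (a b : H -> H) (u v : H).

Lemma inner_psd : psd (inner H).
Proof.
split=> [c u v w|u v|u].
- by rewrite linearPl.
- by rewrite hermC expr0 mul1r.
- by rewrite -inner_norm exprn_ge0.
Qed.

Lemma normE u : `|u| = (nr (inner H) u)%:C.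
Proof.
apply/eqP; rewrite -(@eqrXn2 _ 2) ?ler0c ?nr_ge0 // inner_norm (psdE inner_psd).
by rewrite rmorphXn.
Qed.

Lemma inner_def u : nr (inner H) u = 0 -> u = 0.
Proof. by move=> u0; apply: normr0_eq0; rewrite normE u0. Qed.

Lemma bounded_opP a : bounded_op a <->
  linear a /\ exists c, 0 <= c /\ forall u, nr (inner H) (a u) <= c * nr (inner H) u.
Proof.
split=> [[al ac]|[al [c [c0 ac]]]]; split=> //.
  pose g := GRing.isLinear.Build _ _ _ _ a al.
  pose h : {linear H -> H} := HB.pack a g.
  have : continuous h by exact: ac.
  move=> /linear_bounded_continuous /linear_boundedP /pinfty_ex_gt0 [r r0 Hr].
  exists (complex.Re r); split.
    by move: r0; rewrite ltcE => /andP[_ /ltW].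
  move=> u; have := Hr u; rewrite !normE lecE Re_mul /= mulr0 subr0 => /andP[_].
  by [].
pose g := GRing.isLinear.Build _ _ _ _ a al.
pose h : {linear H -> H} := HB.pack a g.
have : continuous h; last by [].
apply/linear_bounded_continuous/linear_boundedP.
exists c%:C; split; first by rewrite complex_real.
move=> r cr u; rewrite !normE.
apply: (@le_trans _ _ (c%:C * (nr (inner H) u)%:C)); first by rewrite -rmorphM lecR ac.
by rewrite ler_wpM2r ?ler0c ?nr_ge0 // ltW.
Qed.

Lemma bounded_op_lin a : bounded_op a -> linear a.
Proof. by case. Qed.

Lemma bounded_id : bounded_op (id : H -> H).
Proof. by apply/bounded_opP; split=> //; exists 1; split=> // u; rewrite mul1r. Qed.

Lemma bounded_comp a b : bounded_op a -> bounded_op b -> bounded_op (a \o b).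
Proof.
move=> /bounded_opP[al [c [c0 ac]]] /bounded_opP[bl [e [e0 be]]].
apply/bounded_opP; split=> [k u v|]; first by rewrite /= bl al.
exists (c * e); split=> [|u /=]; first exact: mulr_ge0.
by apply: le_trans (ac _) _; rewrite -mulrA ler_wpM2l.
Qed.

Lemma bounded_lin c a b : bounded_op a -> bounded_op b -> bounded_op (c *: a + b).
Proof.
move=> /bounded_opP[al [k [k0 ak]]] /bounded_opP[bl [e [e0 be]]].
apply/bounded_opP; split=> [z u v|].
  rewrite !fctE al bl !scalerDr !scalerA [z * c]mulrC.
  by rewrite addrACA.
exists (normc c * k + e); split=> [|u].
  by rewrite addr_ge0 ?mulr_ge0 ?normc_ge0.
rewrite !fctE; apply: le_trans (nrD inner_psd _ _) _; rewrite (nrZ inner_psd) mulrDl -mulrA.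
by rewrite lerD // ler_wpM2l ?normc_ge0.
Qed.

Lemma fun0E u : (0 : H -> H) u = 0. Proof. by []. Qed.

Lemma bounded_0 : bounded_op (0 : H -> H).
Proof.
apply/bounded_opP; split=> [z u v|]; first by rewrite !fun0E scaler0 addr0.
by exists 0; split=> // u; rewrite mul0r fun0E (nr0 inner_psd).
Qed.

Definition adjoint a b := bounded_op b /\ forall u v, inner H (a u) v = inner H u (b v).

Lemma adjoint_adj a b : adjoint a b -> adj a = b.
Proof.
move=> [bb ab]; rewrite /adj; case: xgetP => [c _ [cb ac]|/(_ b)]; last by case.
apply/funext => v; apply/eqP; rewrite -subr_eq0; apply/eqP; apply: inner_def; apply/eqP.
rewrite -sqrf_eq0 (sqr_nr inner_psd) (psdBr inner_psd).
by rewrite -ac -ab subrr.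
Qed.

Lemma adjoint_id : adjoint id id.
Proof. by split=> //; exact: bounded_id. Qed.

Lemma adjoint0 : adjoint 0 0.
Proof.
by split=> [|u v]; [exact: bounded_0|rewrite !fun0E (psd0l inner_psd) (psd0r inner_psd)].
Qed.

Lemma adjoint_comp a b a' b' : adjoint a a' -> adjoint b b' -> adjoint (a \o b) (b' \o a').
Proof.
move=> [a'b aa] [b'b bb]; split=> [|u v /=]; first exact: bounded_comp.
by rewrite aa bb.
Qed.

Lemma adjoint_lin c a b a' b' : adjoint a a' -> adjoint b b' ->
  adjoint (c *: a + b) (c^* *: a' + b').
Proof.
move=> [a'b aa] [b'b bb]; split=> [|u v]; first exact: bounded_lin.
rewrite !fctE (psdDl inner_psd) (psdDr inner_psd) (psdZl inner_psd) (psdZr inner_psd).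
by rewrite conjCK aa bb.
Qed.

(* If [a] and [b] are each other's formal adjoint then they are adjoint: the
   junk value [0] of [adj] can only occur on both sides. *)
Lemma adj_adj a b : bounded_op a -> adj a = b -> adj b = a ->
  forall u v, inner H (a u) v = inner H u (b v).
Proof.
move=> ab aE bE u v; move: aE; rewrite /adj.
case: xgetP => [c -> [_ ac] <-|no b0]; first exact: ac.
move: bE; rewrite -b0 (_ : adj (fun=> 0) = 0).
  by move=> <-; rewrite !fun0E (psd0l inner_psd) (psd0r inner_psd).
exact: adjoint_adj adjoint0.
Qed.

Lemma commutantP (S : set (H -> H)) b : commutant S b <->
  bounded_op b /\ forall a, S a -> forall u, a (b u) = b (a u).
Proof.
split=> [[bb h]|[bb h]]; split=> // a Sa.
  by move=> u; have := congr1 (fun g => g u) (h a Sa).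
by apply/funext => u; exact: h.
Qed.

Lemma commutant_sub (S T : set (H -> H)) : S `<=` T -> commutant T `<=` commutant S.
Proof. by move=> ST b [bb h]; split=> // a /ST; exact: h. Qed.

Lemma commutant_comp S a b : commutant S a -> commutant S b -> commutant S (a \o b).
Proof.
move=> /commutantP[aa ha] /commutantP[bb hb]; apply/commutantP.
by split=> [|c Sc u /=]; [exact: bounded_comp|rewrite ha // hb].
Qed.

Lemma commutant_lin (S : set (H -> H)) c a b : S `<=` [set a | bounded_op a] ->
  commutant S a -> commutant S b -> commutant S (c *: a + b).
Proof.
move=> Sb /commutantP[aa ha] /commutantP[bb hb]; apply/commutantP.
split=> [|e Se u]; first exact: bounded_lin.
by have el := bounded_op_lin (Sb _ Se); rewrite !fctE el ha // hb.
Qed.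

Lemma commutant_id S : commutant S (id : H -> H).
Proof. by apply/commutantP; split=> //; exact: bounded_id. Qed.

Lemma commutant_0 (S : set (H -> H)) : S `<=` [set a | bounded_op a] -> commutant S 0.
Proof.
move=> Sb; apply/commutantP; split=> [|a Sa u]; first exact: bounded_0.
by rewrite !fun0E (lin0 (bounded_op_lin (Sb _ Sa))).
Qed.

(* The part of the theory of von Neumann algebras that is needed: closure under
   the operations and under double commutants of subsets. *)
Record bicommutant_closed (N : set (H -> H)) : Prop := BicommutantClosed {
  bc_id : N id;
  bc_0 : N 0;
  bc_comp : forall a b, N a -> N b -> N (a \o b);
  bc_lin : forall c a b, N a -> N b -> N (c *: a + b);
  bc_sub : forall S, S `<=` N -> commutant (commutant S) `<=` N }.

Lemma von_neumann_bc N : von_neumann N -> bicommutant_closed N.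
Proof.
move=> [_ NN]; have cb : commutant N `<=` [set a | bounded_op a] by move=> a [].
split=> [||||S SN a aS]; rewrite -NN.
- exact: commutant_id.
- exact: commutant_0.
- by move=> a b; exact: commutant_comp.
- by move=> c a b; exact: commutant_lin.
- by apply: commutant_sub aS; exact: commutant_sub.
Qed.

(** Each closure property passes to the intersection of the von Neumann algebras containing [S]. *)
Lemma vN_gen_bc (S : set (H -> H)) : bicommutant_closed (vN_gen S).
Proof.
split=> [N vN _|N vN _|a b Na Nb N vN SN|c a b Na Nb N vN SN|T TN a aT N vN SN].
- exact: bc_id (von_neumann_bc vN).
- exact: bc_0 (von_neumann_bc vN).
- by apply: (bc_comp (von_neumann_bc vN)); [exact: Na|exact: Nb].
- by apply: (bc_lin (von_neumann_bc vN)); [exact: Na|exact: Nb].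
- by apply: (bc_sub (von_neumann_bc vN)) aT => b /TN; exact.
Qed.

Lemma sub_vN_gen (S : set (H -> H)) : S `<=` vN_gen S.
Proof. by move=> a Sa N _; exact. Qed.

End HilbertSpace.

Section States.
Context {R : realType} {H : hilbert R} (N : set (H -> H)) (tau : (H -> H) -> R[i]).
Hypotheses (bcN : bicommutant_closed N) (tauN : tracial_state N tau).

Lemma state0 : tau 0 = 0.
Proof.
have := state_linear tauN 1 (bc_0 bcN) (bc_0 bcN); rewrite scaler0 addr0 mul1r.
by move/eqP; rewrite -subr_eq subrr => /eqP/esym.
Qed.

Lemma stateZ c a : N a -> tau (c *: a) = c * tau a.
Proof.
by move=> Na; rewrite -[c *: a]addr0 (state_linear tauN _ Na (bc_0 bcN)) state0 addr0.
Qed.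

Lemma bcZ c a : N a -> N (c *: a).
Proof. by move=> Na; rewrite -[c *: a]addr0; apply: bc_lin (bc_0 bcN). Qed.

Lemma bcD a b : N a -> N b -> N (a + b).
Proof. by move=> Na Nb; rewrite -[a]scale1r; apply: bc_lin. Qed.

Lemma stateD a b : N a -> N b -> tau (a + b) = tau a + tau b.
Proof.
by move=> Na Nb; rewrite -{1}[a]scale1r (state_linear tauN _ Na Nb) mul1r.
Qed.

Lemma bc_sum I (s : seq I) (F : I -> H -> H) : (forall i, N (F i)) ->
  N (\sum_(i <- s) F i).
Proof.
move=> NF; elim: s => [|i s IH]; rewrite ?big_nil ?big_cons; first exact: bc_0.
exact: bcD.
Qed.

Lemma state_sum I (s : seq I) (F : I -> H -> H) : (forall i, N (F i)) ->
  tau (\sum_(i <- s) F i) = \sum_(i <- s) tau (F i).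
Proof.
move=> NF; elim: s => [|i s IH]; first by rewrite !big_nil state0.
by rewrite !big_cons stateD ?IH //; exact: bc_sum.
Qed.

(* Normality, applied to the two-element directed set [a <= b], says that the
   state is monotone: no square roots of positive elements are needed. *)
Lemma state_le a b : N a -> N b -> ge0_op a -> ge0_op b -> ge0_op (b - a) ->
  complex.Re (tau a) <= complex.Re (tau b).
Proof.
move=> Na Nb a0 b0 ab; pose D := [set c | c = a \/ c = b].
have z0 c : ge0_op (c - c) by move=> u; rewrite subrr fun0E (psd0l inner_psd).
have DE : complex.Re (tau b) = sup [set complex.Re (tau c) | c in D].
  apply: (state_normal tauN) => [|c [->|->]//|c e|]; first by exists a; left.
    by move=> [->|->] [->|->]; exists b; split=> //; right.
  by split=> // [c [->|->] //|c Nc cD]; apply: cD; right.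
rewrite DE; apply: ub_le_sup; last by exists a => //; left.
exists (Num.max (complex.Re (tau a)) (complex.Re (tau b))) => _ [c [->|->] <-];
  by rewrite le_max lexx ?orbT.
Qed.

End States.

Section Tensors.
Context {R : realType} {H K : hilbert R} (tens : H -> H -> K).
Variables (M : set (H -> H)) (tau : (H -> H) -> R[i]) (tau2 : (K -> K) -> R[i]).
Hypotheses (tensP : hilbert_tensor tens) (Mtau : tracial_vNa M tau).
Hypothesis (tau2P : tensor_trace tens M tau tau2).
Variables (d : nat) (x : 'I_d -> H -> H).
Hypothesis (xs : forall j, selfadj (x j)) (xM : forall j, M (x j)).

Definition wop (w : seq 'I_d) : H -> H := wordeval (fun a b => a \o b) id x w.
Arguments wop : simpl never.

Let bcM : bicommutant_closed M := von_neumann_bc (proj1 Mtau).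
Let tauM : tracial_state M tau := proj2 Mtau.
Let bcT : bicommutant_closed (tensor_vN tens M) := vN_gen_bc _.
Let tauT : tracial_state (tensor_vN tens M) tau2 := proj1 tau2P.

Lemma wop_cons j w : wop (j :: w) = x j \o wop w. Proof. by []. Qed.

Lemma wop_cat v w : wop (v ++ w) = wop v \o wop w.
Proof. by elim: v => // j v IH; rewrite cat_cons !wop_cons IH. Qed.

Lemma wop_M w : M (wop w).
Proof. by elim: w => [|j w IH]; [exact: bc_id|apply: bc_comp]. Qed.

Lemma wop_bounded w : bounded_op (wop w).
Proof.
elim: w => [|j w IH]; first exact: bounded_id.
by rewrite wop_cons; apply: bounded_comp => //; case: (xs j).
Qed.

Lemma adjoint_wop w : adjoint (wop w) (wop (rev w)).
Proof.
elim: w => [|j w IH]; first exact: adjoint_id.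
rewrite wop_cons rev_cons -cats1 wop_cat; apply: adjoint_comp => //.
split=> [|u v]; first exact: wop_bounded.
by have [b e] := xs j; exact: (adj_adj b e e).
Qed.

Lemma tens_linl v : linear (tens^~ v). Proof. by case: tensP. Qed.

Lemma tensDl u u' v : tens (u + u') v = tens u v + tens u' v.
Proof. exact: (linD (tens_linl v)). Qed.

Lemma tensZl c u v : tens (c *: u) v = c *: tens u v.
Proof. exact: (linZ (tens_linl v)). Qed.

Lemma tensDZr u c v w : tens u (c *: v + w) = c^* *: tens u v + tens u w.
Proof. by case: tensP => _ + _ _; exact. Qed.

Lemma inner_tens u v u' v' :
  inner K (tens u v) (tens u' v') = inner H u u' * inner H v' v.
Proof. by case: tensP => _ _ + _; exact. Qed.

Definition is_optens (a b : H -> H) (T : K -> K) :=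
  bounded_op T /\ forall u v, T (tens u v) = tens (a u) (adj b v).

(* If the bounded extension did not exist, [optens a b] would be the junk value
   [0], whose trace is not [tau a * tau b]. *)
Lemma optens_exists a b : M a -> M b -> tau a != 0 -> tau b != 0 ->
  exists T, is_optens a b T.
Proof.
move=> Ma Mb a0 b0; apply: contrapT => no.
have : tau2 (optens tens a b) = tau a * tau b by case: tau2P => _; exact.
rewrite /optens; case: xgetP => [T _ PT|_]; first by case: no; exists T.
move/esym/eqP; rewrite [tau2 _](state0 bcT tauT) mulf_eq0 (negPf a0) (negPf b0).
by [].
Qed.

(** A word may have trace 0, in which case [optens_exists] says nothing about it; adding a scalar
    repairs this. *)
Lemma shift_state w : exists c, M (c *: id + wop w) /\ tau (c *: id + wop w) != 0.
Proof.
have E c : tau (c *: id + wop w) = c + tau (wop w).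
  by rewrite (state_linear tauM _ (bc_id bcM) (wop_M w)) (state_id tauM) mulr1.
have [w0|w0] := eqVneq (tau (wop w)) 0.
  exists 1; rewrite E w0 addr0 oner_eq0; split=> //.
  by apply: bc_lin => //; [exact: bc_id|exact: wop_M].
exists 0; rewrite E add0r; split=> //.
by apply: bc_lin => //; [exact: bc_id|exact: wop_M].
Qed.

Lemma adj_id : adj (id : H -> H) = id.
Proof. exact: adjoint_adj adjoint_id. Qed.

Lemma id_state_neq0 : tau id != 0.
Proof. by rewrite (state_id tauM) oner_eq0. Qed.

(** The extension is the product of those of v (x) 1 and 1 (x) w, each obtained from a shifted word
    by subtracting the scalar again. *)
Lemma optens_word v w : exists T, is_optens (wop v) (wop w) T.
Proof.
have [c [Mc c0]] := shift_state v; have [e [Me e0]] := shift_state w.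
have [T [Tb TE]] := optens_exists Mc (bc_id bcM) c0 id_state_neq0.
have [S [Sb SE]] := optens_exists (bc_id bcM) Me id_state_neq0 e0.
have T'b : bounded_op ((- c) *: (id : K -> K) + T) by apply: bounded_lin => //; exact: bounded_id.
have S'b : bounded_op ((- e) *: (id : K -> K) + S) by apply: bounded_lin => //; exact: bounded_id.
exists (((- c) *: id + T) \o ((- e) *: id + S)); split; first exact: bounded_comp.
have S'E u z : ((- e) *: id + S) (tens u z) = tens u (wop (rev w) z).
  rewrite !fctE SE (adjoint_adj (adjoint_lin e adjoint_id (adjoint_wop w))).
  by rewrite !fctE tensDZr conjCK scaleNr addrA addNr add0r.
move=> u z; rewrite [LHS]/comp S'E !fctE TE adj_id !fctE tensDl tensZl.
by rewrite scaleNr addrA addNr add0r (adjoint_adj (adjoint_wop w)).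
Qed.

Definition actK (a b : seq 'I_d) : K -> K := optens tens (wop a) (wop b).

Lemma actK_bounded a b : bounded_op (actK a b).
Proof.
rewrite /actK /optens; case: xgetP => [T _ [] //|no].
by have [T HT] := optens_word a b; case: (no T).
Qed.

(** The second leg carries the adjoint of the word [b], whose self-adjoint letters come in reverse
    order. *)
Lemma actK_tens a b u v : actK a b (tens u v) = tens (wop a u) (wop (rev b) v).
Proof.
rewrite /actK /optens; case: xgetP => [T _ [_ ->]|no].
  by rewrite (adjoint_adj (adjoint_wop b)).
by have [T HT] := optens_word a b; case: (no T).
Qed.

Lemma actK_tensor_vN a b : tensor_vN tens M (actK a b).
Proof.
by apply: sub_vN_gen; exists (wop a); [exact: wop_M|exists (wop b); [exact: wop_M|]].
Qed.

Lemma tau2_actK a b : tau2 (actK a b) = tau (wop a) * tau (wop b).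
Proof. by case: tau2P => _ -> //; exact: wop_M. Qed.

Lemma tens_dense (z : K) e : 0 < e -> exists s : seq (H * H),
  nr (inner K) (z - \sum_(p <- s) tens p.1 p.2) < e.
Proof.
move=> e0; have : closure [set \sum_(p <- s) tens p.1 p.2 | s in [set: seq (H * H)]] z.
  by have [_ _ _ ->] := tensP.
move/(_ (ball z e%:C)) => [|_ [[s _ <-]]].
  by apply: nbhsx_ballx; rewrite -[0]/(0%:C) ltcR.
rewrite -ball_normE /= normE ltcR => le; exists s.
by [].
Qed.

Lemma bounded_ext S T : bounded_op S -> bounded_op T ->
  (forall u v, S (tens u v) = T (tens u v)) -> S = T.
Proof.
move=> Sb Tb ST; apply/funext => z; apply/eqP; rewrite -subr_eq0; apply/eqP.
have /bounded_opP[Dl [c [c0 Dc]]] : bounded_op ((-1) *: T + S) by exact: bounded_lin.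
apply: inner_def; apply/eqP; rewrite eq_le nr_ge0 andbT leNgt; apply/negP => n0.
set n := nr _ _ in n0.
have [|s le] := @tens_dense z (n / (c + 1)); first by rewrite divr_gt0 // ltr_wpDl.
have : n <= c * (n / (c + 1)).
  apply: le_trans (ler_wpM2l c0 (ltW le)); apply: le_trans (Dc _).
  rewrite (linB Dl) (lin_sum Dl) [X in _ - X]big1 ?subr0.
    by rewrite !fctE scaleN1r addrC.
  by move=> p _; rewrite !fctE scaleN1r ST addNr.
rewrite mulrA ler_pdivlMr ?ltr_wpDl // mulrC ler_pM2r //; lra.
Qed.

Lemma adjoint_ext S T : bounded_op S -> bounded_op T ->
  (forall u v u' v', inner K (S (tens u v)) (tens u' v') =
                     inner K (tens u v) (T (tens u' v'))) ->
  forall z w, inner K (S z) w = inner K z (T w).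
Proof.
move=> /bounded_opP[Sl [c [c0 Sc]]] /bounded_opP[Tl [e [e0 Te]]] ST z w.
have Hk := @inner_psd _ K.
pose D z w := inner K (S z) w - inner K z (T w).
have DB z1 z2 w1 : D (z1 - z2) w1 = D z1 w1 - D z2 w1.
  by rewrite /D (linB Sl) !(psdBl Hk); ring.
have DBr z1 w1 w2 : D z1 (w1 - w2) = D z1 w1 - D z1 w2.
  by rewrite /D (linB Tl) !(psdBr Hk); ring.
have Dle z1 w1 : normc (D z1 w1) <= (c + e) * (nr (inner K) z1 * nr (inner K) w1).
  rewrite /D; apply: le_trans (le_normcD _ _) _; rewrite normcN mulrDl lerD //.
    by apply: le_trans (psd_CS Hk _ _) _; rewrite mulrA ler_wpM2r ?nr_ge0.
  by apply: le_trans (psd_CS Hk _ _) _; rewrite mulrCA ler_wpM2l ?nr_ge0.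
have D0 (s t : seq (H * H)) : D (\sum_(p <- s) tens p.1 p.2) (\sum_(p <- t) tens p.1 p.2) = 0.
  rewrite /D (lin_sum Sl) (lin_sum Tl) !(psd_suml Hk) -sumrB big1 // => p _.
  by rewrite !(psd_sumr Hk) -sumrB big1 // => q _; rewrite ST subrr.
have ce0 : 0 <= c + e by exact: addr_ge0.
have small (r C : R) : 0 <= C -> (forall eps, 0 < eps -> r <= C * eps) -> r <= 0.
  move=> C0 h; rewrite leNgt; apply/negP => r0.
  have := h (r / (C + 1)); rewrite divr_gt0 ?ltr_wpDl // => /(_ isT).
  rewrite mulrA ler_pdivlMr ?ltr_wpDl // mulrC ler_pM2r //; lra.
have Dz (s : seq (H * H)) w1 : D (\sum_(p <- s) tens p.1 p.2) w1 = 0.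
  set z1 := \sum_(p <- s) _; apply: eq0_normc; apply/eqP; rewrite eq_le normc_ge0 andbT.
  apply: (small _ ((c + e) * nr (inner K) z1)) => [|eps eps0].
    by rewrite mulr_ge0 ?nr_ge0.
  have [t le] := tens_dense w1 eps0.
  rewrite -[D z1 w1]subr0 -(D0 s t) -DBr; apply: le_trans (Dle _ _) _.
  by rewrite -mulrA ler_wpM2l // ler_wpM2l ?nr_ge0 // ltW.
suff : D z w = 0 by move/eqP; rewrite subr_eq0 => /eqP.
apply: eq0_normc; apply/eqP; rewrite eq_le normc_ge0 andbT.
apply: (small _ ((c + e) * nr (inner K) w)) => [|eps eps0].
  by rewrite mulr_ge0 ?nr_ge0.
have [s le] := tens_dense z eps0.
rewrite -[D z w]subr0 -(Dz s w) -DB; apply: le_trans (Dle _ _) _.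
by rewrite -mulrA ler_wpM2l // mulrC ler_wpM2l ?nr_ge0 // ltW.
Qed.

Lemma actK_bimodule : bimodule_action (inner K) actK.
Proof.
split=> [|a b|z|a b a' b' z|a b].
- exact: inner_psd.
- exact: bounded_op_lin (actK_bounded a b).
- suff -> : actK [::] [::] = id by [].
  by apply: bounded_ext (actK_bounded _ _) bounded_id _ => u v; rewrite actK_tens.
- suff -> : actK (a ++ a') (b' ++ b) = actK a b \o actK a' b' by [].
  apply: bounded_ext; [exact: actK_bounded|by apply: bounded_comp; exact: actK_bounded|].
  by move=> u v; rewrite /= !actK_tens wop_cat rev_cat wop_cat.
- apply: adjoint_ext; [exact: actK_bounded|exact: actK_bounded|].
  move=> u v u' v'; rewrite !actK_tens !inner_tens revK.
  have [_ ->] := adjoint_wop a; have [_ e] := adjoint_wop b.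
  by rewrite e.
Qed.

End Tensors.

(** * The spectral measure of |D_f(x)| *)

Section OperatorMatrices.
Context {R : realType} {K : hilbert R} {d : nat}.
Implicit Types (A B : opmx K d) (u v : 'I_d -> K).

Local Notation ip := (vip (d := d) (inner K)).
Let Hk := @inner_psd _ K.
Let Hd : psd ip := vip_psd Hk.

Definition opmx_act A u : 'I_d -> K := fun i => \sum_j A i j (u j).

Definition single (i : 'I_d) (z : K) : 'I_d -> K := fun j => if j == i then z else 0.

Lemma vip_def u : nr ip u = 0 -> u = 0.
Proof.
move/eqP; rewrite -sqrf_eq0 (sqr_nr Hd) Re_sum psumr_eq0 => [/allP u0|j _]; last first.
  exact: Re_psd_ge0.
apply/funext => j; apply: inner_def; apply/eqP; rewrite -sqrf_eq0 (sqr_nr Hk).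
exact: u0.
Qed.

Lemma sqr_nr_vip u : nr ip u ^+ 2 = \sum_j nr (inner K) (u j) ^+ 2.
Proof. by rewrite (sqr_nr Hd) Re_sum; apply: eq_bigr => j _; rewrite (sqr_nr Hk). Qed.

Lemma nr_coord_vip u j : nr (inner K) (u j) <= nr ip u.
Proof.
rewrite -(@ler_pXn2r _ 2) ?nnegrE ?nr_ge0 // sqr_nr_vip (bigD1 j) //= lerDl.
by apply: sumr_ge0 => i _; exact: sqr_ge0.
Qed.

Lemma vip_single u i z : ip u (single i z) = inner K (u i) z.
Proof.
rewrite /vip (bigD1 i) //= big1 => [|j ji]; first by rewrite /single eqxx addr0.
by rewrite /single (negPf ji) (psd0r Hk).
Qed.

Lemma nr_single i z : nr ip (single i z) = nr (inner K) z.
Proof. by rewrite /nr vip_single /single eqxx. Qed.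

Lemma sum_single u : u = \sum_i single i (u i).
Proof.
apply/funext => j; rewrite fct_sumE (bigD1 j) //= big1 => [|i ij].
  by rewrite /single eqxx addr0.
by rewrite /single eq_sym (negPf ij).
Qed.

Lemma opmx_formE A u : opmx_form A u = ip (opmx_act A u) u.
Proof. by apply: eq_bigr => i _; rewrite (psd_suml Hk). Qed.

Lemma opmx_act_mul A B u : opmx_bounded A -> opmx_act (opmx_mul A B) u = opmx_act A (opmx_act B u).
Proof.
move=> Ab; apply/funext => i; rewrite /opmx_act /opmx_mul.
under eq_bigr do rewrite fct_sumE; rewrite exchange_big; apply: eq_bigr => k _ /=.
by rewrite (lin_sum (bounded_op_lin (Ab i k))).
Qed.

Lemma opmx_act1 u : opmx_act opmx1 u = u.
Proof.
apply/funext => i; rewrite /opmx_act /opmx1 (bigD1 i) //= eqxx big1 ?addr0 // => j ji.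
by rewrite eq_sym (negPf ji).
Qed.

Lemma opmx_act_linear A : opmx_bounded A -> linear (opmx_act A).
Proof.
move=> Ab c u v; apply/funext => i; rewrite /opmx_act !fctE scaler_sumr -big_split.
by apply: eq_bigr => j _; exact: bounded_op_lin.
Qed.

Lemma nr_vip_le u : nr ip u <= \sum_i nr (inner K) (u i).
Proof.
rewrite {1}[u]sum_single; apply: le_trans (nr_sum Hd _ _ _) _.
by apply: ler_sum => i _; rewrite nr_single.
Qed.

Lemma opmx_act_bounded A : opmx_bounded A ->
  exists c, 0 <= c /\ forall u, nr ip (opmx_act A u) <= c * nr ip u.
Proof.
move=> Ab; have /choice[c cA] : forall p : 'I_d * 'I_d, exists c, 0 <= c /\
    forall z, nr (inner K) (A p.1 p.2 z) <= c * nr (inner K) z.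
  by move=> p; have /bounded_opP[_ [c h]] := Ab p.1 p.2; exists c.
exists (\sum_i \sum_j c (i, j)); split=> [|u].
  by apply: sumr_ge0 => i _; apply: sumr_ge0 => j _; case: (cA (i, j)).
apply: le_trans (nr_vip_le _) _; rewrite mulr_suml; apply: ler_sum => i _.
apply: le_trans (nr_sum Hk _ _ _) _; rewrite mulr_suml; apply: ler_sum => j _.
have [c0 /(_ (u j)) le] := cA (i, j); apply: le_trans le _.
by rewrite ler_wpM2l // nr_coord_vip.
Qed.

Lemma opmx_act_single_diag A i z : opmx_bounded A -> opmx_act A (single i z) i = A i i z.
Proof.
move=> Ab; rewrite /opmx_act (bigD1 i) //= big1 => [|j ji]; first by rewrite /single eqxx addr0.
by rewrite /single (negPf ji) (lin0 (bounded_op_lin (Ab i j))).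
Qed.

Lemma entry_form A i z : opmx_bounded A ->
  inner K (A i i z) z = ip (opmx_act A (single i z)) (single i z).
Proof. by move=> Ab; rewrite vip_single opmx_act_single_diag. Qed.

Definition opmx_diag (T : K -> K) : opmx K d := fun i j => if i == j then T else 0.

Lemma opmx_diag_bounded T : bounded_op T -> opmx_bounded (opmx_diag T).
Proof. by move=> Tb i j; rewrite /opmx_diag; case: eqP => // _; exact: bounded_0. Qed.

Lemma opmx_act_diag T u i : opmx_act (opmx_diag T) u i = T (u i).
Proof.
rewrite /opmx_act /opmx_diag (bigD1 i) //= eqxx big1 ?addr0 // => j ji.
by rewrite eq_sym (negPf ji).
Qed.

Section Resolution.
Variables (S : opmx K d) (E : set (measurableTypeR R) -> opmx K d).
Hypothesis SE : spectral_resolution S E.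

Lemma resolution_sym X u v : measurable X -> ip (opmx_act (E X) u) v = ip u (opmx_act (E X) v).
Proof.
move=> mX; rewrite /vip /opmx_act; under eq_bigr do rewrite (psd_suml Hk).
under [RHS]eq_bigr do rewrite (psd_sumr Hk).
rewrite exchange_big; apply: eq_bigr => j _; apply: eq_bigr => i _.
have e := resolution_selfadj SE mX.
apply: adj_adj; first exact: (resolution_bounded SE mX).
  by rewrite -[in RHS]e.
by rewrite -[in RHS]e.
Qed.

Lemma resolution_lin X : measurable X -> linear (opmx_act (E X)).
Proof. by move=> mX; apply: opmx_act_linear; exact: resolution_bounded SE _ mX. Qed.

Lemma resolution_T u : opmx_act (E setT) u = u.
Proof. by rewrite (resolution_setT SE) opmx_act1. Qed.

Lemma resolution_I X Y u : measurable X -> measurable Y ->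
  opmx_act (E (X `&` Y)) u = opmx_act (E X) (opmx_act (E Y) u).
Proof.
move=> mX mY; rewrite (resolution_setI SE) // opmx_act_mul //.
exact: resolution_bounded SE _ mX.
Qed.

Lemma resolution_int u :
    exists nu : {measure set (measurableTypeR R) -> \bar R},
      [/\ forall X, measurable X -> nu X = (complex.Re (ip (opmx_act (E X) u) u))%:E,
          nu.-integrable setT (fun t => t%:E) &
          ip (opmx_act S u) u = (\int[nu]_t t)%:C].
Proof.
have [nu [h1 h2 h3]] := resolution_integral SE u; exists nu.
by split=> // [X mX|]; rewrite -opmx_formE // h1.
Qed.

End Resolution.

End OperatorMatrices.

Section AbsoluteValue.
Context {R : realType} {H K : hilbert R} (tens : H -> H -> K).
Variables (M : set (H -> H)) (tau : (H -> H) -> R[i]) (tau2 : (K -> K) -> R[i]).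
Hypotheses (tensP : hilbert_tensor tens) (Mtau : tracial_vNa M tau).
Hypothesis (tau2P : tensor_trace tens M tau tau2).
Variables (d : nat) (x : 'I_d -> H -> H).
Hypothesis (xs : forall j, selfadj (x j)) (xM : forall j, M (x j)).
Variables (m : option nat) (f : nctuple R d m).

Local Notation ip := (vip (d := d) (inner K)).
Local Notation act := (actK tens x).
Let Hk := @inner_psd _ K.
Let Hd : psd ip := vip_psd Hk.
Let Hact : bimodule_action (inner K) act := actK_bimodule tensP Mtau tau2P xs xM.
Let bcT : bicommutant_closed (tensor_vN tens M) := vN_gen_bc _.
Let act_in a b : tensor_vN tens M (act a b) := actK_tensor_vN Mtau xM a b.

Lemma tev_in T : tensor_vN tens M (tev act T).
Proof.
have -> : tev act T = \sum_(p <- T) p.1 *: act p.2.1 p.2.2.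
  by apply/funext => z; rewrite fct_sumE.
by apply: (bc_sum bcT) => p; apply: (bcZ bcT); exact: act_in.
Qed.

Lemma tau2_tev T : tau2 (tev act T) = ttr (fun w => tau (wop x w)) T.
Proof.
have -> : tev act T = \sum_(p <- T) p.1 *: act p.2.1 p.2.2.
  by apply/funext => z; rewrite fct_sumE.
have tauT := proj1 tau2P.
rewrite (state_sum bcT tauT) => [|p]; last first.
  by apply: (bcZ bcT); exact: act_in.
apply: eq_bigr => p _; rewrite (stateZ bcT tauT); last exact: act_in.
by rewrite (tau2_actK Mtau tau2P xM).
Qed.

Lemma tev_bounded T : bounded_op (tev act T).
Proof.
rewrite /tev; elim: T => [|p T IH].
  by rewrite (_ : (fun _ => _) = 0); [exact: bounded_0|apply/funext => z; rewrite big_nil].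
have -> : (fun v => \sum_(q <- p :: T) q.1 *: act q.2.1 q.2.2 v) =
    p.1 *: act p.2.1 p.2.2 + tev act T by apply/funext => z; rewrite big_cons.
by apply: bounded_lin => //; exact: (actK_bounded tensP Mtau tau2P xs xM).
Qed.

Lemma adj_tev T : adj (tev act T) = tev act (tstar T).
Proof.
by apply: adjoint_adj; split=> [|u v]; [exact: tev_bounded|exact: tev_star Hact _ _ _].
Qed.

Lemma DmxE l j : Dmx tens x f l j = tev act (Dtp f l j).
Proof.
apply/funext => z; case: l => [i|] /=.
  rewrite /nceval2 /tev /tp_of fct_sumE big_map.
  by apply: eq_bigr => p _.
by rewrite /tev big_cons big_seq1 /= scale1r scaleN1r.
Qed.

Lemma absD_squareE : (fun j k => \sum_(l <- rows f)
    (adj (Dmx tens x f l j) \o Dmx tens x f l k)) = (fun j k => tev act (gram f j k)).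
Proof.
apply/funext => j; apply/funext => k; apply/funext => z.
rewrite fct_sumE /gram /tmx_gram tev_flatten big_map; apply: eq_bigr => l _.
by rewrite DmxE adj_tev DmxE /= (tev_mul Hact).
Qed.

(** The right alternative is the default value 0 of [opmx_sqrt]; it is excluded in [absD_square]. *)
Lemma absD_spec (S := absD tens x f) :
  [/\ opmx_bounded S, forall u, 0 <= ip (opmx_act S u) u &
   (forall u, opmx_act S (opmx_act S u) = mev act (gram f) u) \/ (forall u, opmx_act S u = 0)].
Proof.
rewrite {}/S /absD -/(rows f) absD_squareE /opmx_sqrt.
case: xgetP => [S _ [Sb Sp SS]|_]; split=> //.
- by move=> u; rewrite -opmx_formE.
- by left=> u; rewrite -opmx_act_mul // SS.
- by move=> i j; exact: bounded_0.
- by move=> u; rewrite (_ : opmx_act _ u = 0) ?(psd0l Hd) //; apply/funext => i; rewrite /opmx_act big1.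
- by right=> u; apply/funext => i; rewrite /opmx_act big1.
Qed.

End AbsoluteValue.

(** * Small spectral values and integrability of the logarithm *)

Section LogarithmicTail.
Context {R : realType}.

Lemma count_lt_le (y : R) K : \sum_(k < K) ((k.+1%:R < y)%R : nat)%:R <= Num.max 0 y.
Proof.
elim: K => [|K IH]; first by rewrite big_ord0 le_max lexx.
rewrite big_ord_recr /=; case: ltrP => [lt|_]; last by rewrite addr0.
have : \sum_(k < K) ((k.+1%:R < y)%R : nat)%:R <= K%:R :> R.
  rewrite -[leRHS]mulr1 -[K in leRHS]card_ord mulr_natl -sumr_const.
  by apply: ler_sum => k _; rewrite -[1]/(1%:R) ler_nat leq_b1.
move=> le; rewrite le_max; apply/orP; right; apply: le_trans (ltW lt).
by rewrite -natr1 lerD2r.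
Qed.

Lemma measurable_abs_lne (D : set (measurableTypeR R)) :
  measurable_fun D (fun t : R => `|lne t%:E|%E).
Proof.
apply: (@measurable_funTS) => //; apply: measurableT_comp => //.
apply: measurable_fun_ifT => //.
  by apply: measurable_fun_ler => //; exact: measurable_id.
by apply/measurable_EFinP; exact: measurable_ln.
Qed.

(** For t > 0 the k counted on the left are those with [k.+1 < - 4 * ln t]. At t = 0 the right-hand
    side is infinite. *)
Lemma count_le_abs_lne (t : R) K : 0 <= t ->
  ((\sum_(k < K) ((t < expR (- k.+1%:R / 4))%R : nat)%:R)%:E <= 4%:E * `|lne t%:E|)%E.
Proof.
rewrite le_eqVlt => /predU1P[<-|t0]; first by rewrite /= lexx gt0_muley ?leey // lte_fin.
rewrite lne_EFin // -EFinM lee_fin.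
apply: (@le_trans _ _ (Num.max 0 (- 4 * ln t))); last first.
  rewrite ge_max mulr_ge0 //= mulNr -mulrN ler_wpM2l // -normrN ler_norm //.
apply: le_trans (count_lt_le _ K); rewrite le_eqVlt; apply/orP; left; apply/eqP.
apply: eq_bigr => k _; congr ((nat_of_bool _)%:R).
rewrite -{1}(@lnK _ t) ?posrE // ltr_expR; apply/idP/idP => h; lra.
Qed.

(** A layer-cake argument: integrate [count_le_abs_lne] over the half-line. Negative t have measure
    0, so each set may be cut down to the domain of the integral. *)
Lemma log_tail_sum (mu : {measure set (measurableTypeR R) -> \bar R}) :
  (mu setT < +oo)%E -> mu [set t | t < 0] = 0%E ->
  (\int[mu]_(t in `[0%R, +oo[) `|lne t%:E| < +oo)%E ->
  exists C : R, 0 <= C /\ forall K,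
    \sum_(k < K) fine (mu [set t | t < expR (- k.+1%:R / 4)]) <= C.
Proof.
move=> mufin mu0 Ifin; set I := (\int[mu]_(t in _) _)%E in Ifin.
have I0 : (0 <= I)%E by apply: integral_ge0.
exists (4 * fine I); split=> [|K]; first by rewrite mulr_ge0 ?fine_ge0.
pose A k : set (measurableTypeR R) := [set t | t < expR (- (k : nat).+1%:R / 4)].
pose P : set (measurableTypeR R) := `[0%R, +oo[%classic.
have mP : measurable P by exact: measurable_itv.
have mA k : measurable (A k).
  by have := @measurable_itv R `]-oo, (expR (- k.+1%:R / 4))[; rewrite set_itvE.
have PC : ~` P = [set t | t < 0].
  rewrite /P; apply/seteqP; split=> t /=; rewrite in_itv /= andbT.
    by move/negP; rewrite -ltNge.
  by move=> t0; apply/negP; rewrite -ltNge.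
have muA k : mu (A k) = (\int[mu]_(t in P) (\1_(A k) t)%:E)%E.
  rewrite integral_indic // (measureDI mu (mA k) mP) [X in (X + _)%E](_ : _ = 0%E) ?add0e //.
  apply/eqP; rewrite eq_le measure_ge0 andbT -mu0 -PC.
  apply: le_measure; rewrite ?inE //; first exact: measurableD.
  exact: measurableC.
have fin k : mu (A k) \is a fin_num.
  by rewrite ge0_fin_numE //; apply: le_lt_trans mufin; apply: le_measure; rewrite ?inE.
have : ((\sum_(k < K) fine (mu (A k)))%:E <= 4%:E * I)%E.
  rewrite -sumEFin; under eq_bigr do rewrite fineK // muA.
  rewrite -ge0_integral_sum // => [|k]; last first.
    by apply/measurable_EFinP; exact: measurable_indic.
  rewrite -ge0_integralZl_EFin //; last exact: measurable_abs_lne.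
  apply: ge0_le_integral => //.
  - by move=> t _; apply: sume_ge0.
  - by apply: emeasurable_sum => k; apply/measurable_EFinP; exact: measurable_indic.
  - by apply: measurable_funeM; exact: measurable_abs_lne.
  - move=> t; rewrite /P /= in_itv /= andbT => t0.
    apply: le_trans (count_le_abs_lne K t0); rewrite sumEFin lee_fin.
    apply: ler_sum => k _; rewrite indicE /A.
    by case: ltP => h; [rewrite ?lexx; case: (_ \in _)|rewrite memNset //= => h'; move: (lt_le_trans h' h); rewrite ltxx].
by rewrite -{1}(@fineK _ I) ?ge0_fin_numE // -EFinM lee_fin.
Qed.

End LogarithmicTail.

Section DecayRate.
Context {R : realType}.

(** Induction on [N], since (1 - y)(1 + (N + 1) y) = 1 + N y - (N + 1) y^2. *)
Lemma pow_compl_le (y : R) N : 0 <= y <= 1 -> (1 - y) ^+ N * (1 + N%:R * y) <= 1.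
Proof.
move=> /andP[y0 y1]; elim: N => [|N IH]; first by rewrite mul0r addr0 mulr1.
apply: le_trans IH; rewrite exprSr -mulrA ler_wpM2l ?exprn_ge0 ?subr_ge0 //.
rewrite -natr1; have : 0 <= (N%:R + 1) * y ^+ 2 by rewrite mulr_ge0 ?sqr_ge0 ?addr_ge0.
lra.
Qed.

Lemma sum_inv_exp2_le K : \sum_(k < K) ((2 ^ k)%:R : R)^-1 <= 2.
Proof.
suff -> : \sum_(k < K) ((2 ^ k)%:R : R)^-1 = 2 - 2 / (2 ^ K)%:R.
  by rewrite gerBl divr_ge0.
elim: K => [|K IH]; first by rewrite big_ord0 expn0 divr1 subrr.
rewrite big_ord_recr /= IH expnS natrM invfM.
have : (2 ^ K)%:R != 0 :> R by rewrite pnatr_eq0 expn_eq0.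
by move=> h; field.
Qed.

(** Because 1/2 <= e^(-1/2). With thresholds e^(-(k+1)/4) the squares lose at most a factor 2 per
    scale, while the exponents of the filter grow by 4. *)
Lemma expR_half_pow k : ((2 ^ k.+1)%:R : R)^-1 <= expR (- k.+1%:R / 4) ^+ 2.
Proof.
rewrite -expRM_natr natrX -exprVn.
have -> : - k.+1%:R / 4 * 2%:R = k.+1%:R * (- 2^-1) :> R by field.
rewrite expRM_natl lerXn2r ?nnegrE ?expR_ge0 //.
have := expR_ge1Dx (- 2^-1 : R); lra.
Qed.

(** With y = a2 / (2 L') and N = L' 4^k, N y = 4^k a2 / 2 is at least 2^k / 4, and [pow_compl_le]
    bounds the power by 1 / (1 + N y). *)
Lemma filter_decay (L' k : nat) : (0 < L')%N ->
  (1 - expR (- k.+1%:R / 4) ^+ 2 / (2 * L'%:R)) ^+ (L' * (2 ^ k) ^ 2) <=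
  4 / (2 ^ k)%:R :> R.
Proof.
move=> L'0; set a2 := expR _ ^+ 2; pose y := a2 / (2 * L'%:R).
have p0 : 0 < (2 ^ k)%:R :> R by rewrite ltr0n expn_gt0.
have l0 : 1 <= L'%:R :> R by rewrite ler1n.
have a20 : 0 <= a2 by exact: sqr_ge0.
have a21 : a2 <= 1.
  by rewrite exprn_ile1 ?expR_ge0 // -[leRHS]expR0 ler_expR mulNr oppr_le0 divr_ge0.
have y01 : 0 <= y <= 1.
  by rewrite /y divr_ge0 ?mulr_ge0 //= ler_pdivrMr ?mul1r; lra.
have big : (2 ^ k)%:R / 4 <= (L' * (2 ^ k) ^ 2)%:R * y.
  have -> : (L' * (2 ^ k) ^ 2)%:R * y = (2 ^ k)%:R * ((2 ^ k)%:R * a2 / 2).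
    rewrite /y natrM natrX; field; lra.
  rewrite ler_wpM2l ?ler0n // ler_pdivlMr //.
  have := ler_wpM2l (ltW p0) (expR_half_pow k).
  rewrite expnS natrM invfM mulrCA divff ?gt_eqF // -/a2; lra.
have := pow_compl_le (L' * (2 ^ k) ^ 2) y01.
have : 0 <= (1 - y) ^+ (L' * (2 ^ k) ^ 2).
  by rewrite exprn_ge0 // subr_ge0; case/andP: y01.
rewrite -/y; move: ((1 - y) ^+ _) ((L' * _)%:R * y) big => w z zp w0 h.
rewrite ler_pdivlMr //.
have : w * ((2 ^ k)%:R / 4) <= 1; last by lra.
apply: le_trans h; rewrite ler_wpM2l //; lra.
Qed.

End DecayRate.

Lemma complex_sub_ge0 (R : realType) (z w : R[i]) : 0 <= z -> 0 <= w ->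
  complex.Re z <= complex.Re w -> 0 <= w - z.
Proof.
move=> + + h; rewrite !lecE ImD ReD ImN ReN /= => /andP[/eqP-> _] /andP[/eqP-> _].
by rewrite subrr eqxx subr_ge0.
Qed.

(** * Filtered traces and spectral projections *)

Section SpectralSubspaces.
Context {R : realType} {H K : hilbert R} (tens : H -> H -> K).
Variables (M : set (H -> H)) (tau : (H -> H) -> R[i]) (tau2 : (K -> K) -> R[i]).
Hypotheses (tensP : hilbert_tensor tens) (Mtau : tracial_vNa M tau).
Hypothesis (tau2P : tensor_trace tens M tau tau2).
Variables (d : nat) (x : 'I_d -> H -> H).
Hypothesis (xs : forall j, selfadj (x j)) (xM : forall j, M (x j)).
Variables (m : option nat) (f : nctuple R d m).
Variables (E : set (measurableTypeR R) -> opmx K d).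
Hypothesis SE : spectral_resolution (absD tens x f) E.

Local Notation ip := (vip (d := d) (inner K)).
Local Notation act := (actK tens x).
Local Notation S := (absD tens x f).
Local Notation TvN := (tensor_vN tens M).
Let Hk := @inner_psd _ K.
Let Hd : psd ip := vip_psd Hk.
Let Hdef : forall u, nr ip u = 0 -> u = 0 := @vip_def _ _ _.
Let Hact : bimodule_action (inner K) act := actK_bimodule tensP Mtau tau2P xs xM.
Let bcT : bicommutant_closed TvN := vN_gen_bc _.
Let tauT : tracial_state TvN tau2 := proj1 tau2P.
Let Lo (a : R) : set (measurableTypeR R) := [set t | t < a].

Let Sb : opmx_bounded S. Proof. by case: (absD_spec tensP Mtau tau2P xs xM f). Qed.
Let Sp u : 0 <= ip (opmx_act S u) u.
Proof. by case: (absD_spec tensP Mtau tau2P xs xM f). Qed.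
Let Sl : linear (opmx_act S) := opmx_act_linear Sb.
Let El X : measurable X -> linear (opmx_act (E X)). Proof. exact: (resolution_lin SE). Qed.
Let Es X u v : measurable X -> ip (opmx_act (E X) u) v = ip u (opmx_act (E X) v).
Proof. exact: (resolution_sym SE). Qed.
Let ET := resolution_T SE.
Let EI X Y u : measurable X -> measurable Y ->
  opmx_act (E (X `&` Y)) u = opmx_act (E X) (opmx_act (E Y) u).
Proof. exact: (resolution_I SE). Qed.
Let Eint := resolution_int SE.
Let mL a : measurable (Lo a). Proof. exact: measurable_Lo. Qed.

(** The state is controlled only on the tensor product algebra, so the projections must lie in it.
    If [T] commutes with all pairs of words, its diagonal amplification commutes with S^2, whose
    entries are polynomials in them, hence with [E (Lo a)] by [E_commutant]. Each diagonal entry is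
    thus in the double commutant of the words. *)
Lemma resolution_diag_in (L a : R) i : 0 < a ->
  (forall u, nr ip (opmx_act S u) ^+ 2 <= L * nr ip u ^+ 2) ->
  (forall u, opmx_act S (opmx_act S u) = mev act (gram f) u) -> TvN (E (Lo a) i i).
Proof.
move=> a0 SL SS; pose G : set (K -> K) := [set T | exists v w, T = act v w].
have GT : G `<=` TvN by move=> _ [v [w ->]]; exact: (actK_tensor_vN Mtau xM).
apply: (bc_sub bcT GT); apply/commutantP.
have Eb := resolution_bounded SE (mL a).
split=> [|T /commutantP[Tb Tc] z]; first exact: Eb.
have Tl := bounded_op_lin Tb; have Db := opmx_diag_bounded (d := d) Tb.
have [c [c0 Dc]] := opmx_act_bounded Db.
have Tev p u : tev act p (T u) = T (tev act p u).
  rewrite /tev (lin_sum Tl); apply: eq_bigr => q _; rewrite (linZ Tl).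
  by congr (_ *: _); apply: Tc; exists q.2.1, q.2.2.
have TS u : opmx_act (opmx_diag T) (opmx_act S (opmx_act S u)) = opmx_act S (opmx_act S (opmx_act (opmx_diag T) u)).
  rewrite !SS; apply/funext => j; rewrite opmx_act_diag /mev (lin_sum Tl).
  by apply: eq_bigr => k _; rewrite opmx_act_diag Tev.
have := E_commutant Hd Hdef Sl Sp El Es ET EI Eint (opmx_act_linear Db) c0 a0 Dc SL TS (single i z).
move/(congr1 (fun u => u i)); rewrite opmx_act_diag opmx_act_single_diag // => ->.
have -> : opmx_act (opmx_diag T) (single i z) = single i (T z); last exact: opmx_act_single_diag.
by apply/funext => j; rewrite opmx_act_diag /single; case: eqP => // _; rewrite (lin0 Tl).
Qed.

Lemma resolution_form_ge0 X i z : measurable X -> 0 <= inner K (E X i i z) z.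
Proof.
move=> mX; rewrite entry_form; last exact: resolution_bounded SE _ mX.
set u := single i z.
suff -> : ip (opmx_act (E X) u) u = ip (opmx_act (E X) u) (opmx_act (E X) u) by exact: psd_ge0.
by rewrite -Es // -EI // setIid.
Qed.

(** [iter_compl_le] at vectors supported on coordinate [i] is an inequality between operators of the
    tensor product algebra, to which monotonicity of the state applies. *)
Lemma filter_trace_le (L a : R) N i : 0 < L -> 0 < a -> a ^+ 2 <= L ->
  (forall u, nr ip (opmx_act S u) ^+ 2 <= L * nr ip u ^+ 2) ->
  (forall u, opmx_act S (opmx_act S u) = mev act (gram f) u) ->
  complex.Re (ttr (fun w => tau (wop x w)) (tmx_pow (tmx_compl L (gram f)) N i i)) <=
  complex.Re (tau2 (E (Lo a) i i)) + (1 - a ^+ 2 / L) ^+ N.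
Proof.
move=> L0 a0 aL SL SS; set T := tmx_pow _ _ i i; set rho := (1 - _) ^+ N.
rewrite -(tau2_tev Mtau tau2P xM).
have TE := resolution_diag_in i a0 SL SS.
have rho0 : 0 <= rho by rewrite exprn_ge0 // subr_ge0 ler_pdivrMr // mul1r.
have -> : complex.Re (tau2 (E (Lo a) i i)) + rho =
    complex.Re (tau2 (rho%:C *: id + E (Lo a) i i)).
  rewrite (state_linear tauT _ (bc_id bcT) TE) (state_id tauT) mulr1 ReD addrC.
  by [].
have qE z : inner K (tev act T z) z =
    ip (iter N (fun v => v - L^-1%:C *: opmx_act S (opmx_act S v)) (single i z)) (single i z).
  have -> : iter N (fun v => v - L^-1%:C *: opmx_act S (opmx_act S v)) (single i z) =
      mev act (tmx_pow (tmx_compl L (gram f)) N) (single i z).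
    rewrite (mev_pow Hact); apply: eq_iter => v.
    by rewrite (mev_compl Hact) SS.
  rewrite vip_single /mev; congr (inner K _ z).
  rewrite (bigD1 i) //= big1 => [|j ji]; first by rewrite /single eqxx addr0.
  by rewrite /single (negPf ji) (lin0 (tev_linear Hact _)).
have bE z : inner K ((rho%:C *: id + E (Lo a) i i) z) z =
    rho%:C * inner K z z + inner K (E (Lo a) i i z) z.
  by rewrite !fctE (psdDl Hk) (psdZl Hk).
have b0 : ge0_op (rho%:C *: id + E (Lo a) i i).
  move=> z; rewrite bE addr_ge0 ?resolution_form_ge0 //.
  by rewrite mulr_ge0 ?ler0c // (psd_ge0 Hk).
have key z := iter_compl_le Hd Hdef Sl Sp El Es ET EI Eint N L0 (ltW a0) aL SL (single i z).
have q0 : ge0_op (tev act T) by move=> z; rewrite qE; case: (key z).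
apply: (state_le tauT) => //.
- exact: (tev_in Mtau xM).
- by apply: (bc_lin bcT) => //; exact: bc_id.
- move=> z; have := b0 z; have := q0 z; have [_] := key z.
  rewrite -/rho -qE -entry_form ?nr_single; last exact: resolution_bounded SE _ (mL a).
  rewrite (_ : (_ - _) z = (rho%:C *: id + E (Lo a) i i) z - tev act T z) //.
  rewrite (psdBl Hk) bE (psdE Hk z) => le0 le1 le2.
  apply: complex_sub_ge0 le1 le2 _.
  by rewrite ReD Re_mul /= mul0r subr0 addrC.
Qed.

End SpectralSubspaces.

Section OperatorSide.
Context {R : realType} {H K : hilbert R} (tens : H -> H -> K).
Variables (M : set (H -> H)) (tau : (H -> H) -> R[i]) (tau2 : (K -> K) -> R[i]).
Hypotheses (tensP : hilbert_tensor tens) (Mtau : tracial_vNa M tau).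
Hypothesis (tau2P : tensor_trace tens M tau tau2).
Variables (d : nat) (x : 'I_d -> H -> H).
Hypothesis (xs : forall j, selfadj (x j)) (xM : forall j, M (x j)).
Variables (m : option nat) (f : nctuple R d m).
Variable mu : {measure set (measurableTypeR R) -> \bar R}.
Hypothesis muP : spectral_measure tau2 (absD tens x f) mu.
Hypothesis log_integrable : (\int[mu]_(t in `[0%R, +oo[) `|lne t%:E| < +oo)%E.

Local Notation ip := (vip (d := d) (inner K)).
Local Notation act := (actK tens x).
Local Notation S := (absD tens x f).
Let Hd : psd ip := vip_psd (@inner_psd _ K).
Let Hdef : forall u, nr ip u = 0 -> u = 0 := @vip_def _ _ _.
Let tauT : tracial_state (tensor_vN tens M) tau2 := proj1 tau2P.
Let bcT : bicommutant_closed (tensor_vN tens M) := vN_gen_bc _.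
Let Lo (a : R) : set (measurableTypeR R) := [set t | t < a].
Let Hi (a : R) : set (measurableTypeR R) := [set t | a <= t].
Let mL a : measurable (Lo a). Proof. exact: measurable_Lo. Qed.
Let mH a : measurable (Hi a). Proof. exact: measurable_Hi. Qed.
Let Sb : opmx_bounded S. Proof. by case: (absD_spec tensP Mtau tau2P xs xM f). Qed.
Let Sp u : 0 <= ip (opmx_act S u) u.
Proof. by case: (absD_spec tensP Mtau tau2P xs xM f). Qed.

Lemma opmx_trace_sum (A : opmx K d) : (0 < d)%N ->
  \sum_i complex.Re (tau2 (A i i)) = d%:R * complex.Re (opmx_trace tau2 A).
Proof.
move=> d0; have dn0 : d%:R != 0 :> R[i] by rewrite pnatr_eq0 -lt0n.
rewrite -Re_sum -[X in complex.Re X](mulVKf dn0) -/(opmx_trace tau2 A).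
by rewrite -(rmorph_nat (real_complex R)) Re_mul /= mul0r subr0.
Qed.

Lemma spectral_measure_null X E : spectral_resolution S E ->
  (forall X, measurable X -> mu X = (complex.Re (opmx_trace tau2 (E X)))%:E) ->
  measurable X -> (forall u, opmx_act (E X) u = 0) -> mu X = 0%E.
Proof.
move=> SE muE mX E0; rewrite muE // /opmx_trace big1 ?mulr0 // => i _.
rewrite (_ : E X i i = 0) ?(state0 bcT tauT) //; apply/funext => z.
by rewrite -opmx_act_single_diag ?E0 //; exact: resolution_bounded SE _ mX.
Qed.

Lemma spectral_measure_lt0 : mu [set t | t < 0] = 0%E.
Proof.
have [E SE muE] := muP.
have -> : [set t : measurableTypeR R | t < 0] = \bigcup_n Lo (- n.+1%:R^-1).
  apply/seteqP; split=> [t /= t0|t [n _] /= h]; last first.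
    by apply: lt_trans h _; rewrite oppr_lt0 invr_gt0.
  have := archi_boundP (ltW (_ : 0 < (- t)^-1)); rewrite invr_gt0 oppr_gt0 => /(_ t0).
  set n := Num.bound _ => h; exists n => //; rewrite /Lo /= ltrNr.
  rewrite -[ltRHS]invrK ltf_pV2 ?posrE ?invr_gt0 ?oppr_gt0 //.
  by apply: lt_trans h _; rewrite ltr_nat.
apply: measure_negligible; first by apply: bigcup_measurable => n _; exact: mL.
apply: negligible_bigcup => n; apply/negligibleP; first exact: mL.
apply: (spectral_measure_null SE muE (mL _)) => u.
apply: (E_neg Hd Hdef Sp (resolution_T SE) _ (resolution_int SE)) => //.
by move=> X Y v mX mY; exact: (resolution_I SE).
Qed.

Lemma spectral_measure_total : (0 < d)%N -> mu setT = 1%E.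
Proof.
move=> d0; have [E SE muE] := muP; rewrite muE // (resolution_setT SE).
have dn0 : d%:R != 0 :> R by rewrite pnatr_eq0 -lt0n.
congr (_%:E); apply: (mulfI dn0); rewrite -opmx_trace_sum // mulr1.
under eq_bigr do rewrite /opmx1 eqxx (state_id tauT).
by rewrite /= sumr_const card_ord.
Qed.

(* With the junk value [absD = 0] the spectral measure would be the Dirac mass
   at [0], for which [log] is not integrable. *)
Lemma absD_square u : opmx_act S (opmx_act S u) = mev act (gram f) u.
Proof.
have [d0|d0] := posnP d; first by apply/funext => j; have := ltn_ord j; rewrite {2}d0.
have [_ _ [//|S0]] := absD_spec tensP Mtau tau2P xs xM f.
have [E SE muE] := muP; have mu1 := spectral_measure_total d0.
have [|C [C0 HC]] := log_tail_sum _ spectral_measure_lt0 log_integrable.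
  by rewrite mu1 ltry.
have muLo a : 0 < a -> mu (Lo a) = 1%E.
  move=> a0; rewrite -mu1 -(setUv (Lo a)) measureU //; last 2 first.
  - exact: measurableC.
  - by rewrite setICr.
  rewrite Lo_compl [X in (_ = _ + X)%E](_ : _ = 0%E) ?adde0 //.
  apply: (spectral_measure_null SE muE (mH _)) => v.
  apply: (E_zero Hd Hdef (resolution_T SE) _ (resolution_int SE)) => //.
  by move=> X Y w mX mY; exact: (resolution_I SE).
have := HC (Num.bound C); under eq_bigr do rewrite muLo ?expR_gt0 //=.
by rewrite sumr_const card_ord leNgt archi_boundP.
Qed.

Lemma filter_traces_summable : exists L1 : R, forall L' : nat, (0 < L')%N ->
  L1 <= 2 * L'%:R -> exists (C : R) (c : nat -> R), [/\ 0 <= C, forall N, \sum_(k < N) c k <= C &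
    forall k : nat, 0 <= c k /\
      complex.Re (\sum_j ttr (fun w => tau (wop x w))
        (tmx_pow (tmx_compl (2 * L'%:R) (gram f)) (L' * (2 ^ k) ^ 2) j j)) <= c k].
Proof.
(* [c] bounds the norm of |D_f(x)|, so [2 * L' >= c ^ 2] makes 1 - S^2 / (2 L') positive. *)
have [c [c0 Sc]] := opmx_act_bounded Sb; exists (c ^+ 2) => L' L'0 cL.
have [d0|d0] := posnP d.
  exists 0, (fun=> 0); split=> [|N|k] //; first by rewrite big1.
  by rewrite big1 // => j; have := ltn_ord j; rewrite {2}d0.
have [E SE muE] := muP; have mu1 := spectral_measure_total d0.
have [|C [C0 HC]] := log_tail_sum _ spectral_measure_lt0 log_integrable.
  by rewrite mu1 ltry.
pose a k : R := expR (- k.+1%:R / 4).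
exists (d%:R * C + d%:R * 8), (fun k => d%:R * fine (mu (Lo (a k))) + d%:R * (4 / (2 ^ k)%:R)).
split=> [|N|k].
- by rewrite addr_ge0 ?mulr_ge0.
- rewrite big_split /= -!mulr_sumr lerD // ?ler_wpM2l // -?mulr_sumr.
    by exact: HC.
  have := sum_inv_exp2_le (R := R) N; lra.
have fine0 : 0 <= fine (mu (Lo (a k))) by rewrite fine_ge0.
split; first by rewrite addr_ge0 ?mulr_ge0 ?divr_ge0.
rewrite muE // -opmx_trace_sum // Re_sum.
apply: (@le_trans _ _ (\sum_i (complex.Re (tau2 (E (Lo (a k)) i i)) + 4 / (2 ^ k)%:R))).
  apply: ler_sum => i _.
  have L0 : 1 <= L'%:R :> R by rewrite ler1n.
  have a1 : a k ^+ 2 <= 2 * L'%:R.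
    apply: (@le_trans _ _ 1); last lra.
    by rewrite exprn_ile1 ?expR_ge0 // -[leRHS]expR0 ler_expR mulNr oppr_le0 divr_ge0.
  apply: le_trans (filter_trace_le tensP Mtau tau2P xs xM SE _ i _ (expR_gt0 _) a1 _ absD_square) _.
  - lra.
  - move=> u; apply: (@le_trans _ _ ((c * nr ip u) ^+ 2)).
      by rewrite lerXn2r ?nnegrE ?nr_ge0 ?mulr_ge0 ?nr_ge0.
    by rewrite exprMn ler_wpM2r ?sqr_ge0.
  by rewrite lerD2l; exact: filter_decay.
by rewrite big_split /= sumr_const card_ord [d%:R * (4 / _)]mulr_natl.
Qed.

End OperatorSide.

(** * Laws and microstates *)

Section Moments.
Context {R : realType} {d : nat}.

Definition lmoment (l : @ncfun R d) (w : seq 'I_d) : R[i] :=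
  l (monalg.mkmalgU (monalg.FMonom w) 1).

Lemma nceval_mkmalgU (A : lmodType R[i]) mul one (y : 'I_d -> A) (w : seq 'I_d) :
  nceval mul one y (monalg.mkmalgU (monalg.FMonom w) 1) = wordeval mul one y w.
Proof.
pose F (v : monalg.fmonom 'I_d) := wordeval mul one y v.
by rewrite -[LHS]/(malg_sum F _) malg_sumU scale1r.
Qed.

Lemma lmoment_mxlaw n (X : @mxtuple R d n) w : lmoment (mxlaw X) w = mxmoment X w.
Proof. by rewrite /lmoment /mxlaw nceval_mkmalgU. Qed.

Lemma lmoment_law (H : hilbert R) tau (y : 'I_d -> H -> H) w :
  lmoment (law tau y) w = tau (wop y w).
Proof. by rewrite /lmoment /law /opeval nceval_mkmalgU. Qed.

Lemma lmoment_cvg (l0 : @ncfun R d) w : lmoment l w @[l --> l0] --> (lmoment l0 w : R[i]^o).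
Proof.
exact: (@proj_continuous (ncpoly R d) (fun=> R[i]^o) (monalg.mkmalgU (monalg.FMonom w) 1) l0).
Qed.

Lemma cvg_sum_seq (T : Type) (F : set_system T) {FF : Filter F} I (s : seq I)
    (G : I -> T -> R[i]^o) (g : I -> R[i]^o) :
  (forall i, G i t @[t --> F] --> g i) ->
  \sum_(i <- s) G i t @[t --> F] --> \sum_(i <- s) g i.
Proof.
move=> h; elim: s => [|i s IH].
  by under eq_fun do rewrite big_nil; rewrite big_nil; exact: cvg_cst.
by under eq_fun do rewrite big_cons; rewrite big_cons; apply: (@cvgD R[i] R[i]^o T F FF); [exact: h|exact: IH].
Qed.

Lemma ttr_cvg (l0 : @ncfun R d) T :
  ttr (lmoment l) T @[l --> l0] --> (ttr (lmoment l0) T : R[i]^o).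
Proof.
apply: (@cvg_sum_seq _ (nbhs l0) _ _ T
  (fun p l => p.1 * (lmoment l p.2.1 * lmoment l p.2.2))
  (fun p => p.1 * (lmoment l0 p.2.1 * lmoment l0 p.2.2))) => p.
apply: (@cvgM R[i] _ (nbhs l0)); first exact: cvg_cst.
by apply: (@cvgM R[i] _ (nbhs l0)); exact: lmoment_cvg.
Qed.

(* phi(p p^* ) *)
Definition sqr_moment (phi : seq 'I_d -> R[i]) (p : ncpoly R d) : R[i] :=
  \sum_(w <- monalg.msupp p) \sum_(v <- monalg.msupp p)
    monalg.mcoeff v p * ((monalg.mcoeff w p)^* * phi ((v : seq 'I_d) ++ rev w)).

Lemma sqr_moment_cvg (l0 : @ncfun R d) p :
  sqr_moment (lmoment l) p @[l --> l0] --> (sqr_moment (lmoment l0) p : R[i]^o).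
Proof.
pose F w v (phi : seq 'I_d -> R[i]) : R[i] :=
  monalg.mcoeff v p * ((monalg.mcoeff w p)^* * phi ((v : seq 'I_d) ++ rev w)).
apply: (@cvg_sum_seq _ (nbhs l0) _ _ _
  (fun w l => \sum_(v <- monalg.msupp p) F w v (lmoment l))
  (fun w => \sum_(v <- monalg.msupp p) F w v (lmoment l0))) => w.
apply: (@cvg_sum_seq _ (nbhs l0) _ _ _
  (fun v l => F w v (lmoment l)) (fun v => F w v (lmoment l0))) => v.
apply: (@cvgM R[i] _ (nbhs l0)); first exact: cvg_cst.
by apply: (@cvgM R[i] _ (nbhs l0)); [exact: cvg_cst|exact: lmoment_cvg].
Qed.

Lemma near_Re_le (l0 : @ncfun R d) (G : @ncfun R d -> R[i]^o) (e : R) : 0 < e ->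
  G l @[l --> l0] --> G l0 ->
  \forall l \near l0, complex.Re (G l) <= complex.Re (G l0) + e.
Proof.
move=> e0 /cvgrPdist_lt /(_ e%:C); rewrite -[0]/(0%:C) ltcR => /(_ e0).
apply: filterS => l lt; rewrite -lerBlDl.
apply: (@le_trans _ _ (complex.Re (G l - G l0))); first by rewrite ReD ReN.
apply: le_trans (Re_le_normc _) _; move: lt; rewrite distrC ltcE => /andP[_ /ltW].
by [].
Qed.

(** Expresses smallness of p(X) through finitely many moments, so that it holds in a neighbourhood
    of a law where p vanishes. *)
Lemma sqr_moment_peval n (X : 'I_d -> 'M[R[i]]_n) p : (0 < n)%N ->
  (forall j, (X j)^t* = X j) ->
  nF (peval X p) ^+ 2 = n%:R * complex.Re (sqr_moment (mxmoment X) p).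
Proof.
move=> n0 Xh; have nn : n%:R != 0 :> R[i] by rewrite pnatr_eq0 -lt0n.
have Hf := @fro_psd R n.
rewrite /nF (sqr_nr Hf).
have -> : fro (peval X p) (peval X p) = n%:R * sqr_moment (mxmoment X) p.
  rewrite pevalE (psd_sumr Hf) /sqr_moment mulr_sumr; apply: eq_bigr => w _.
  rewrite (psd_suml Hf) mulr_sumr; apply: eq_bigr => v _.
  rewrite (psdZl Hf) (psdZr Hf) froE mw_rev_adj // -mw_cat /mxmoment /mxtr.
  by move: (\tr _) (monalg.mcoeff _ _) (monalg.mcoeff _ _) => t a b; field.
by rewrite -(rmorph_nat (real_complex R)) Re_mul /= mul0r subr0.
Qed.

Lemma sqr_moment_law (H : hilbert R) (M : set (H -> H)) tau (y : 'I_d -> H -> H) p :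
  tracial_vNa M tau -> (forall j, M (y j)) -> opeval y p = 0 ->
  sqr_moment (fun w => tau (wop y w)) p = 0.
Proof.
move=> [vN tauM] yM y0; have bcM := von_neumann_bc vN; have wM := wop_M (conj vN tauM) yM.
rewrite /sqr_moment big1 // => w _.
rewrite [LHS](_ : _ = (monalg.mcoeff w p)^* * tau (opeval y p \o wop y (rev w))).
  by rewrite y0 (_ : 0 \o _ = 0) // (state0 bcM tauM) mulr0.
have -> : opeval y p \o wop y (rev w) =
    \sum_(v <- monalg.msupp p) monalg.mcoeff v p *: wop y ((v : seq _) ++ rev w).
  apply/funext => u; rewrite /opeval /nceval /= !fct_sumE; apply: eq_bigr => v _.
  by rewrite wop_cat.
rewrite (state_sum bcM tauM) => [|v]; last by apply: (bcZ bcM); exact: wM.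
rewrite mulr_sumr; apply: eq_bigr => v _.
by rewrite (stateZ bcM tauM) // mulrCA.
Qed.

End Moments.

Section OperatorNorm.
Context {R : realType} {H : hilbert R}.
Let Hk := @inner_psd _ H.

Lemma opnorm_le (a : H -> H) u : bounded_op a ->
  nr (inner H) (a u) <= opnorm a * nr (inner H) u.
Proof.
move=> /bounded_opP[al [c [c0 ac]]].
have Re_norm (v : H) : complex.Re `|v| = nr (inner H) v by rewrite normE.
have ub v : `|v| <= 1 -> nr (inner H) (a v) <= opnorm a.
  move=> v1; apply: ub_le_sup; last by exists v => //; rewrite Re_norm.
  exists c => _ [w /= w1 <-]; rewrite Re_norm; apply: le_trans (ac w) _.
  by rewrite ler_piMr //; move: w1; rewrite normE -[1]/(1%:C) lecR.
have [u0|u0] := eqVneq (nr (inner H) u) 0.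
  by rewrite (inner_def u0) (lin0 al) (nr0 Hk) mulr0.
have up : 0 < nr (inner H) u by rewrite lt_def u0 nr_ge0.
have := ub ((nr (inner H) u)^-1%:C *: u).
rewrite normE (linZ al) !(nrZ Hk) normcR ger0_norm ?invr_ge0 ?nr_ge0 // mulVf //.
by rewrite mulrC ler_pdivrMr //; exact.
Qed.

Lemma opnorm_ge0 (a : H -> H) : bounded_op a -> 0 <= opnorm a.
Proof.
move=> /bounded_opP[al [c [c0 ac]]]; apply: ub_le_sup; last first.
  by exists 0; rewrite /= ?normr0 // (lin0 al) normr0.
exists c => _ [w /= w1 <-]; rewrite normE; apply: le_trans (ac w) _.
by rewrite ler_piMr //; move: w1; rewrite normE -[1]/(1%:C) lecR.
Qed.

Lemma opnorm_le_tuple d (y : 'I_d -> H -> H) j : opnorm (y j) <= tuple_norm y.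
Proof. by rewrite /tuple_norm; exact: le_bigmax. Qed.

Lemma tuple_norm_ge0 d (y : 'I_d -> H -> H) : 0 <= tuple_norm y.
Proof. exact: bigmax_ge_id. Qed.

Lemma even_moment_le (M : set (H -> H)) tau d (y : 'I_d -> H -> H) r j k :
  tracial_vNa M tau -> (forall j, M (y j)) -> (forall j, selfadj (y j)) ->
  tuple_norm y <= r ->
  complex.Re (tau (wop y (nseq k j ++ nseq k j))) <= r ^+ (2 * k).
Proof.
move=> [vN tauM] yM ys yr; have bcM := von_neumann_bc vN.
have wM := wop_M (conj vN tauM) yM.
have r0 : 0 <= r by exact: le_trans (tuple_norm_ge0 y) yr.
have -> : r ^+ (2 * k) = complex.Re (tau ((r ^+ (2 * k))%:C *: id)).
  by rewrite (stateZ bcM tauM) ?(state_id tauM) ?mulr1 //; exact: bc_id.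
have pow u : nr (inner H) (wop y (nseq k j) u) <= r ^+ k * nr (inner H) u.
  elim: k => [|k IH]; first by rewrite mul1r.
  rewrite -[nseq k.+1 j]/(j :: nseq k j) wop_cons exprS -mulrA.
  have [yb _] := ys j; apply: le_trans (opnorm_le _ yb) _.
  apply: ler_pM => //; [exact: opnorm_ge0|exact: nr_ge0|].
  exact: le_trans (opnorm_le_tuple y j) yr.
have aE u : inner H (wop y (nseq k j ++ nseq k j) u) u =
    (nr (inner H) (wop y (nseq k j) u) ^+ 2)%:C.
  rewrite wop_cat /= (proj2 (adjoint_wop ys (nseq k j))) rev_nseq.
  by rewrite (psdE Hk).
apply: (state_le tauM) => //.
- by apply: (bcZ bcM); exact: bc_id.
- by move=> u; rewrite aE ler0c sqr_ge0.
- by move=> u; rewrite (psdZl Hk) (psdE Hk) -rmorphM ler0c mulr_ge0 ?exprn_ge0 ?nr_ge0.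
- move=> u; rewrite (psdBl Hk) aE (psdZl Hk) (psdE Hk) -rmorphM -rmorphB ler0c subr_ge0.
  by rewrite mulnC exprM -exprMn lerXn2r ?nnegrE ?mulr_ge0 ?exprn_ge0 ?nr_ge0.
Qed.

End OperatorNorm.

Lemma pow_bounded (R : realType) (q s n : R) : 0 < s ->
  (forall k, q ^+ k <= n * s ^+ k) -> q <= s.
Proof.
move=> s0 h; rewrite leNgt; apply/negP => sq.
have b k : (q / s) ^+ k <= n.
  by rewrite expr_div_n ler_pdivrMr ?exprn_gt0.
pose e := q / s - 1; have e0 : 0 < e by rewrite subr_gt0 ltr_pdivlMr ?mul1r.
have qs : q / s = 1 + e by rewrite /e addrC subrK.
have lin k : 1 + k%:R * e <= (q / s) ^+ k.
  elim: k => [|k IH]; first by rewrite mul0r addr0.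
  rewrite exprS qs in IH *; apply: le_trans (ler_wpM2l _ IH); last by rewrite addr_ge0 // ltW.
  rewrite -natr1; have : 0 <= k%:R * e ^+ 2 by rewrite mulr_ge0 ?sqr_ge0.
  lra.
have n0 : 0 <= n / e by rewrite divr_ge0 ?(ltW e0) //; apply: le_trans (b 0); rewrite expr0.
have := archi_boundP n0; rewrite ltr_pdivrMr // => lt.
have := le_trans (lin _) (b (Num.bound (n / e))); lra.
Qed.

Section MatrixMicrostates.
Context {R : realType} {d n : nat}.
Implicit Types (X : 'I_d -> 'M[R[i]]_n) (O : set (@ncfun R d)).

(** One eigenvalue satisfies lam^(2k) <= n r^(2k) for every k, and the fixed factor n cannot make up
    for an exponential gap. *)
Lemma opb_of_moments X j r : (0 < n)%N -> (X j)^t* = X j -> 0 < r ->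
  (forall k, complex.Re (mxmoment X (nseq k j ++ nseq k j)) <= r ^+ (2 * k)) ->
  opb (X j) r.
Proof.
move=> n0 Xh r0 h; have [P [lam [PP PP' XE]]] := hermitian_spectral (proj2 (hermsymmxP _) Xh).
pose D k := diag_mx (\row_i (lam i ^+ k)%:C).
have powE k : mw X (nseq k j) = P^t* *m D k *m P.
  elim: k => [|k IH].
    rewrite mw0 (_ : D 0 = 1%:M) ?mulmx1 //.
    by apply/matrixP => a b; rewrite !mxE expr0.
  rewrite -[nseq k.+1 j]/(j :: nseq k j) mw_cons IH XE -!mulmxA; congr (_ *m _).
  rewrite (mulmxA P) PP mul1mx mulmxA; congr (_ *m _).
  rewrite mulmx_diag; congr diag_mx; apply/matrixP => a b.
  by rewrite !mxE -rmorphM exprS.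
have lamr i : `|lam i| <= r.
  rewrite -(@ler_pXn2r _ 2) ?nnegrE ?(ltW r0) // real_normK ?num_real //.
  apply: (@pow_bounded _ _ _ n%:R); first by rewrite exprn_gt0.
  move=> k; have np : 0 < n%:R :> R by rewrite ltr0n.
  have := h k; rewrite /mxmoment /mxtr mw_cat !powE -!mulmxA (mulmxA P) PP mul1mx.
  rewrite mxtrace_mulC -!mulmxA PP mulmx1 mulmx_diag mxtrace_diag.
  rewrite (_ : n%:R^-1 = (n%:R^-1)%:C :> R[i]); last by rewrite fmorphV rmorph_nat.
  rewrite Re_mul /= mul0r subr0 mulrC ler_pdivrMr // Re_sum mulrC exprM => le.
  apply: le_trans le; rewrite (bigD1 i) //= !mxE -rmorphM ReC -exprMn -expr2 lerDl.
  by apply: sumr_ge0 => l _; rewrite !mxE -rmorphM ReC -expr2 sqr_ge0.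
rewrite XE -[r]mul1r -[r]mulr1 mulrA; apply: opbM; last exact: opb_unitary.
apply: opbM; first by apply: opb_adj; exact: opb_unitary.
by apply: opb_diag => [|i]; [exact: ltW|rewrite normcR].
Qed.

Lemma mw_conjt V X w : V *m V^t* = 1%:M -> mw (conjt V X) w = V *m mw X w *m V^t*.
Proof.
move=> VV; have VV' := mulmx1C VV; elim: w => [|j w IH].
  by rewrite !mw0 mulmx1.
by rewrite !mw_cons IH /conjt -!mulmxA (mulmxA (V^t*)) VV' mul1mx.
Qed.

Lemma mxlaw_conjt V (X Y : @mxtuple R d n) : V *m V^t* = 1%:M ->
  (forall j, Y j = conjt V X j) -> mxlaw Y = mxlaw X.
Proof.
move=> VV YE; have VV' := mulmx1C VV; have {}YE : (Y : 'I_d -> _) = conjt V X.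
  exact/funext.
apply/funext => p; rewrite /mxlaw -!/(peval _ _) YE !pevalE; congr (_ * _).
rewrite !raddf_sum; apply: eq_bigr => w _ /=; rewrite !mxtraceZ mw_conjt //.
by rewrite mxtrace_mulC mulmxA VV' mul1mx.
Qed.

Lemma microstates_conjt O V X : V *m V^t* = 1%:M ->
  microstates O [ffun j => X j] -> microstates O [ffun j => conjt V X j].
Proof.
move=> VV [Xh OX]; split=> [j|].
  apply/hermsymmxP; rewrite ffunE /conjt !trmx_mul !map_mxM trmxCK.
  by have /hermsymmxP := Xh j; rewrite ffunE => ->; rewrite mulmxA.
rewrite (@mxlaw_conjt V [ffun j => X j]) // => j.
by rewrite /conjt !ffunE.
Qed.

(** Membership in [laws r] only provides some other tuple, bounded by [r], with the same law; the
    norm of [X j] is recovered from the even moments that they share. *)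
Lemma microstates_bound O r X j : (0 < n)%N -> 0 < r ->
  O `<=` @laws R d r -> microstates O [ffun j => X j] -> (X j)^t* = X j /\ opb (X j) r.
Proof.
move=> n0 r0 Or [Xh OX].
have Xj : (X j)^t* = X j by have /hermsymmxP := Xh j; rewrite ffunE.
split=> //; apply: opb_of_moments => // k.
have [H [M [tau [y [Mtau yM yr lE]]]]] := Or _ OX.
have E w : mxmoment X w = tau (wop y w).
  rewrite -(lmoment_law tau y) -lE lmoment_mxlaw; congr (mxmoment _ w).
  by apply/funext => i; rewrite ffunE.
rewrite E; apply: (even_moment_le _ _ Mtau) => // i; by have [] := yM i.
Qed.

End MatrixMicrostates.

(** * Choice of the constants and of the neighbourhood of the law *)

Theorem theorem1p2 (R : realType)
    (* the tracial von Neumann algebra (M, tau), acting on H *)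
    (H : hilbert R) (M : set (H -> H)) (tau : (H -> H) -> R[i])
    (Mtau : tracial_vNa M tau)
    (d : nat) (x : 'I_d -> H -> H) (r : R)
    (xM : generates x M) (xr : tuple_norm x < r)
    (m : option nat) (f : nctuple R d m)
    (fx0 : forall i : idx m, opeval x (f i) = 0)
    (* the Hilbert space carrying M (x) M^op, and the trace tau (x) tau *)
    (K : hilbert R) (tens : H -> H -> K) (tensP : hilbert_tensor tens)
    (tau2 : (K -> K) -> R[i]) (tau2P : tensor_trace tens M tau tau2)
    (mu : {measure set (measurableTypeR R) -> \bar R})
    (muP : spectral_measure tau2 (absD tens x f) mu)
    (log_integrable : (\int[mu]_(t in `[0%R, +oo[) `|lne t%:E| < +oo)%E) :
  strongly_1_bounded M tau.
Proof.
have xs : forall j, selfadj (x j) by case: xM.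
have xin j : M (x j) by case: xM => _ <-; apply: sub_vN_gen; exists j.
have r0 : 0 < r := le_lt_trans (tuple_norm_ge0 x) xr.
exists d, x, r; split=> //; first exact: ltW.
have [L1 HL1] := filter_traces_summable tensP Mtau tau2P xs xin muP log_integrable.
pose rho := Num.max 1 r.
pose T := \sum_(l <- rows f) (\sum_j tbound rho (Dtp f l j)) ^+ 2.
(* The same [2 * L'] must dominate D_f^* D_f at [x] (through [L1]) and at all microstates (through
   [T]), since the filter polynomial is shared. *)
pose L' := (Num.bound (Num.max L1 T)).+1.
have [L1L TL] : L1 <= 2 * L'%:R /\ T <= 2 * L'%:R.
  have le : Num.max L1 T <= 2 * L'%:R.
    apply: le_trans (ltW (archi_boundP _)) _.
      by rewrite le_max; apply/orP; right; apply: sumr_ge0 => l _; exact: sqr_ge0.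
    by rewrite -natrM ler_nat /L'; lia.
  by move: le; rewrite ge_max => /andP.
have rho1 : 1 <= rho by rewrite le_max lexx.
have [E0 [g [C [E00 g0 C0 codableP]]]] := codable_iterate rho1 (ltn0Sn _ : (0 < L')%N) TL.
have [C' [c [C'0 cC' cP]]] := HL1 L' (ltn0Sn _) L1L.
(* Independent of [eps]: 2 from the sum of 2^-k, 1 from [K0 * n <= n ^ 2] for [n >= K0], and
   [C' + 2] from the traces [b k]. *)
apply: (@le_lt_trans _ _ (C * (3 + (C' + 2)))%:E); last exact: ltry.
apply: ge_ereal_sup => _ [eps /= eps0 <-].
(* Enough scales to get below [eps], as E0 / eps < K0 <= 16^K0. *)
pose K0 := Num.bound (E0 / eps); pose e := E0 / (2 ^ K0)%:R ^+ 4.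
have e0 : 0 <= e by rewrite divr_ge0 ?exprn_ge0 ?(ltW E00).
have ee : e < eps.
  rewrite ltr_pdivrMr ?exprn_gt0 ?ltr0n ?expn_gt0 // mulrC -ltr_pdivrMr //.
  apply: lt_le_trans (archi_boundP (divr_ge0 (ltW E00) (ltW eps0))) _.
  rewrite -natrX ler_nat; apply: leq_trans (ltnW (ltn_expl K0 (ltnSn 1))) _.
  by rewrite -[leqLHS]expn1 leq_pexp2l ?expn_gt0.
(* The summable slack 2^-k leaves room for a whole neighbourhood of the law of [x]. *)
pose l0 := law tau x; pose b k := c k + (2 ^ k)%:R^-1.
have b0 k : 0 <= b k by rewrite addr_ge0 ?invr_ge0 //; case: (cP k).
have bS : \sum_(k < K0) b k <= C' + 2.
  by rewrite big_split lerD // sum_inv_exp2_le.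
have l0E : lmoment l0 = fun w => tau (wop x w) by apply/funext => w; exact: lmoment_law.
pose s k : R := (g * (E0 / (2 ^ k)%:R ^+ 4) / (2 ^ k)%:R).
have s0 k : 0 < s k.
  by rewrite /s !(divr_gt0, mulr_gt0, exprn_gt0) // ltr0n expn_gt0.
pose G k l := \sum_j ttr (lmoment l)
  (tmx_pow (tmx_compl (2 * L'%:R) (gram f)) (L' * (2 ^ k) ^ 2) j j).
(* Finitely many scales and finitely many nonzero [f i] are involved, even for an infinite tuple, so
   the conditions hold near [l0]. *)
have W1 : \forall l \near (l0 : @ncfun R d), forall (k : 'I_K0) (i : finsupp f),
    complex.Re (sqr_moment (lmoment l) (f (val i))) <= s k ^+ 2.
  apply: (filter_forall (F := nbhs (l0 : @ncfun R d))) => k.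
  apply: (filter_forall (F := nbhs (l0 : @ncfun R d))) => i.
  have := near_Re_le (exprn_gt0 2 (s0 k)) (@sqr_moment_cvg _ _ l0 (f (val i))).
  by rewrite l0E (sqr_moment_law Mtau xin (fx0 _)) add0r.
have W2 : \forall l \near (l0 : @ncfun R d), forall k : 'I_K0, complex.Re (G k l) <= b k.
  apply: (filter_forall (F := nbhs (l0 : @ncfun R d))) => k.
  have Gc : G k l @[l --> l0] --> (G k l0 : R[i]^o).
    apply: (@cvg_sum_seq R _ (nbhs l0) _ _ (index_enum 'I_d)
      (fun j l => ttr (lmoment l) _) (fun j => ttr (lmoment l0) _)) => j.
    exact: ttr_cvg.
  have p0 : 0 < ((2 ^ k)%:R : R)^-1 by rewrite invr_gt0 ltr0n expn_gt0.
  apply: filterS (near_Re_le p0 Gc) => l le; apply: le_trans le _.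
  by rewrite lerD2r /G l0E; case: (cP k).
pose W := [set l : @ncfun R d |
  (forall (k : 'I_K0) (i : finsupp f), complex.Re (sqr_moment (lmoment l) (f (val i))) <= s k ^+ 2)
  /\ forall k : 'I_K0, complex.Re (G k l) <= b k].
have Wl0 : nbhs (l0 : @ncfun R d) W by near=> l; split; near: l.
pose O := W^° `&` @laws R d r.
apply: (@le_trans _ _ (h_open eps O)).
  apply: ereal_inf_lbound; exists O => //; split.
    by exists W^° => //; exact: open_interior.
  split=> //; exists H, M, tau, x; split=> //; exact: ltW.
apply: (@h_open_le _ _ _ _ _ K0) => n Kn n0.
apply: (@le_trans _ _ (expR (C * (2 * n%:R ^+ 2 + K0%:R * n%:R + n%:R ^+ 2 * \sum_(k < K0) b k)))%:E); last first.
  rewrite lee_fin ler_expR -mulrA ler_wpM2l //.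
  have n20 : 0 <= n%:R ^+ 2 :> R by exact: sqr_ge0.
  have : K0%:R * n%:R <= n%:R ^+ 2 :> R by rewrite expr2 ler_wpM2r // ler_nat.
  move: (ler_wpM2l n20 bS); move: (n%:R ^+ 2) (K0%:R * n%:R) (\sum_(k < K0) b k) => u v w.
  by clear; lra.
apply: (@Korb_le _ _ _ _ e) => //.
pose Om := [set X : 'I_d -> 'M[R[i]]_n | microstates O [ffun j => X j]].
have : codable Om (orb (e * Num.sqrt n%:R)) (C * (2 * n%:R ^+ 2 + K0%:R * n%:R + n%:R ^+ 2 * \sum_(k < K0) b k)).
  apply: (codableP n K0 Om b n0 b0) => [X V OX VV|X OX].
    exact: microstates_conjt.
  have Xb := microstates_bound _ n0 r0 (@subIsetr _ _ _) OX.
  have Xh j : (X j)^t* = X j by case: (Xb j).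
  have [_ [/interior_subset[h1 h2] _]] := OX.
  have XE : lmoment (mxlaw [ffun j => X j]) = mxmoment X.
    apply/funext => w; rewrite lmoment_mxlaw; congr (mxmoment _ w).
    by apply/funext => j; rewrite ffunE.
  split=> [j|k i kK fi|k kK].
  - by have [_ Xr] := Xb j; split=> //; apply: opb_le Xr; rewrite le_max lexx orbT.
  - have := h1 (Ordinal kK) (FSetSub fi); rewrite XE /= => le.
    have -> : small_at_scale E0 g n (2 ^ k) = s k * Num.sqrt n%:R by rewrite /small_at_scale /s; ring.
    have sk : 0 <= s k * Num.sqrt n%:R by apply: mulr_ge0; [exact: ltW|exact: sqrtr_ge0].
    rewrite -(@ler_pXn2r _ 2) ?nnegrE ?nF_ge0 //.
    rewrite (sqr_moment_peval _ n0 Xh) exprMn sqr_sqrtr; last exact: ler0n.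
    by rewrite mulrC; apply: ler_wpM2r le; exact: ler0n.
  - by have := h2 (Ordinal kK); rewrite /G XE.
move=> [N [code [Nle codeP]]]; exists N, code; split=> // X Y OX OY.
have ext (Z : @mxtuple R d n) : [ffun j => Z j] = Z by apply/ffunP => j; rewrite ffunE.
by apply: codeP; rewrite /Om /= ext.
Unshelve. all: by end_near.
Qed.
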